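(* Let $\mathfrak A=\overline{\bigcup_{n\in\mathbb N}\mathfrak A_n}^{\|\cdot\|_{\mathfrak A}}$ be a unital AF algebra (with $(\mathfrak A_n)_n$ a non-decreasing sequence of unital finite-dimensional C*-subalgebras, $\mathfrak A_0=\mathbb C1_{\mathfrak A}$) equipped with a faithful tracial state $\mu$. Denote $\mathcal U=(\mathfrak A_n)_{n\in\mathbb N}$ and let $(\beta(j))_{j\in\mathbb N}\subset(0,\infty)$ be summable. Let $$\mathsf L^\beta_{\mathcal U,\mu}(a)=\sup_{n\in\mathbb N}\frac{\|a-E_n(a)\|_{\mathfrak A}}{\beta(n)},$$ which is a $(2,0)$-quasi-Leibniz Lip-norm on $\mathfrak A$, where $E_n:\mathfrak A\to\mathfrak A_n$ is the unique $\mu$-preserving conditional expectation onto $\mathfrak A_n$. For each $n\in\mathbb N$ define $E_{n+1,n}:=E_n|_{\mathfrak A_{n+1}}:\mathfrak A_{n+1}\to\mathfrak A_n$, and let $\mathsf L^\beta_{\mathfrak A_n,E}$ and $\mathsf L^\beta_{\mathcal U,E}$ be the associated $(2,0)$-quasi-Leibniz Lip-norms on $\mathfrak A_n$ and $\mathfrak A$, respectively (as defined in the context). Then: (1) for each $n\in\mathbb N$, $\mathsf L^\beta_{\mathcal U,\mu}(a)=\mathsf L^\beta_{\mathfrak A_n,E}(a)$ for all $a\in\mathfrak A_n$; (2) for each $n\in\mathbb N$ and all $a\in\mathfrak{sa}(\mathfrak A_n)$, $$\mathsf L^\beta_{\mathcal U,\mu}(a)\le\mathsf L^\beta_{\mathcal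 U,E}(a)\le\max\{1,2\beta(0)/\beta(n-1)\}\,\mathsf L^\beta_{\mathcal U,\mu}(a),$$ where $\beta(-1):=\infty$ with the convention $1/\infty=0$; (3) there exists a quantum isometry $\pi:\mathfrak A\to\mathfrak A$ between $(\mathfrak A,\mathsf L^\beta_{\mathcal U,\mu})$ and $(\mathfrak A,\mathsf L^\beta_{\mathcal U,E})$, and so $\mathsf\Lambda^\ast\big((\mathfrak A,\mathsf L^\beta_{\mathcal U,\mu}),(\mathfrak A,\mathsf L^\beta_{\mathcal U,E})\big)=0$; (4) for each $n\in\mathbb N$, $$\mathsf\Lambda^\ast\big((\mathfrak A_n,\mathsf L^\beta_{\mathfrak A_n,E}),(\mathfrak A,\mathsf L^\beta_{\mathcal U,E})\big)\le2\,\mathsf\Lambda\big((\mathfrak A_n,\mathsf L^\beta_{\mathfrak A_n,E}),(\mathfrak A,\mathsf L^\beta_{\mathcal U,E})\big)\le2\beta(n),$$ and thus $\lim_{n\to\infty}\mathsf\Lambda\big((\mathfrak A_n,\mathsf L^\beta_{\mathfrak A_n,E}),(\mathfrak A,\mathsf L^\beta_{\mathcal U,E})\big)=0$, where $\mathsf\Lambda$ is the quantum Gromov–Hausdorff propinquity.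
   Context: $\mathbb N=\{0,1,2,\dots\}$; $\mathfrak{sa}(\cdot)$ denotes self-adjoint elements, $\mathscr S(\mathfrak A)$ the state space. A conditional expectation onto a unital C*-subalgebra $\mathfrak B\subseteq\mathfrak A$ is a surjective linear contractive completely positive map $E:\mathfrak A\to\mathfrak B$ with $E(b)=b$ and $E(bxb')=bE(x)b'$ for $b,b'\in\mathfrak B$, $x\in\mathfrak A$. Compact quantum metric spaces. A compact quantum metric space $(\mathfrak A,\mathsf L)$ is a unital C*-algebra $\mathfrak A$ with a $[0,\infty]$-valued seminorm $\mathsf L$ (over $\mathbb R$) on $\mathfrak{sa}(\mathfrak A)$ (called a Lip-norm), whose domain $\operatorname{dom}(\mathsf L)=\{a\in\mathfrak{sa}(\mathfrak A):\mathsf L(a)<\infty\}$ is a unital dense real subspace of $\mathfrak{sa}(\mathfrak A)$, such that $\{a:\mathsf L(a)=0\}=\mathbb R1_{\mathfrak A}$; the Monge–Kantorovich metric $\mathsf{mk}_{\mathsf L}(\varphi,\psi)=\sup\{|\varphi(a)-\psi(a)|:a\in\operatorname{dom}(\mathsf L),\mathsf L(a)\le1\}$ metrizes the weak* topology of $\mathscr S(\mathfrak A)$; and $\mathsf L$ is lower semi-continuous for $\|\cdot\|_{\mathfrak A}$. A seminorm given on all of $\mathfrak A$ is regarded as a Lip-norm via its restriction to $\mathfrak{sa}(\mathfrak A)$. It is $(2,0)$-quasi-Leibniz if $\max\{\mathsf L(\frac{ab+ba}2),\mathsf L(\frac{ab-ba}{2i})\}\le2(\|a\|\mathsf L(b)+\|b\|\mathsf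 L(a))$ for all $a,b\in\operatorname{dom}(\mathsf L)$. A quantum isometry from $(\mathfrak A,\mathsf L_{\mathfrak A})$ to $(\mathfrak B,\mathsf L_{\mathfrak B})$ is a *-isomorphism $\pi:\mathfrak A\to\mathfrak B$ with $\mathsf L_{\mathfrak B}\circ\pi=\mathsf L_{\mathfrak A}$. Dual propinquity. A $(2,0)$-tunnel from $(\mathfrak A_1,\mathsf L_1)$ to $(\mathfrak A_2,\mathsf L_2)$ is $(\mathfrak D,\mathsf L_{\mathfrak D},\pi_1,\pi_2)$ with $(\mathfrak D,\mathsf L_{\mathfrak D})$ a $(2,0)$-quasi-Leibniz compact quantum metric space and $\pi_j:\mathfrak D\to\mathfrak A_j$ unital *-epimorphisms with $\mathsf L_j(a)=\inf\{\mathsf L_{\mathfrak D}(d):d\in\mathfrak{sa}(\mathfrak D),\pi_j(d)=a\}$ for all $a\in\mathfrak{sa}(\mathfrak A_j)$. Its extent is $\max_{j=1,2}\mathrm{Haus}_{\mathsf{mk}_{\mathsf L_{\mathfrak D}}}(\mathscr S(\mathfrak D),\{\varphi\circ\pi_j:\varphi\in\mathscr S(\mathfrak A_j)\})$ (Hausdorff distance). The dual Gromov–Hausdorff propinquity $\mathsf\Lambda^\ast$ between two $(2,0)$-quasi-Leibniz compact quantum metric spaces is the infimum of the extents of all $(2,0)$-tunnels between them. Quantum propinquity. A bridge from $\mathfrak A$ to $\mathfrak B$ is $\gamma=(\mathfrak D,\omega,\pi_{\mathfrak A},\pi_{\mathfrak B})$ with $\mathfrak D$ a unital C*-algebra, $\omega\in\mathfrak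 D$ such that $\mathscr S_1(\omega)=\{\psi\in\mathscr S(\mathfrak D):\psi(d)=\psi(\omega d)=\psi(d\omega)\ \forall d\in\mathfrak D\}$ is non-empty, and unital *-monomorphisms $\pi_{\mathfrak A}:\mathfrak A\to\mathfrak D$, $\pi_{\mathfrak B}:\mathfrak B\to\mathfrak D$. Given Lip-norms $\mathsf L_{\mathfrak A},\mathsf L_{\mathfrak B}$, its length is the maximum of: its reach, i.e. the Hausdorff distance in $(\mathfrak D,\|\cdot\|_{\mathfrak D})$ between $\{\pi_{\mathfrak A}(a)\omega:a\in\mathfrak{sa}(\mathfrak A),\mathsf L_{\mathfrak A}(a)\le1\}$ and $\{\omega\pi_{\mathfrak B}(b):b\in\mathfrak{sa}(\mathfrak B),\mathsf L_{\mathfrak B}(b)\le1\}$; and its height, i.e. the maximum of $\mathrm{Haus}_{\mathsf{mk}_{\mathsf L_{\mathfrak A}}}(\mathscr S(\mathfrak A),\{\varphi\circ\pi_{\mathfrak A}:\varphi\in\mathscr S_1(\omega)\})$ and the same quantity for $\mathfrak B$. The quantum Gromov–Hausdorff propinquity $\mathsf\Lambda$ between two $(2,0)$-quasi-Leibniz compact quantum metric spaces is the infimum, over all finite chains of $(2,0)$-quasi-Leibniz compact quantum metric spaces starting at the first and ending at the second, with a bridge between each pair of consecutive spaces, of the sum of the lengths of the bridges. The Lip-norms $\mathsf L^\beta_{\mathfrak A_n,E}$. For $n>m\ge0$ put $E_{n,m}=E_{m+1,m}\circ\cdots\circ E_{n,n-1}$. For $n\ge1$ and $a\in\mathfrak A_n$,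 $\mathsf L^\beta_{\mathfrak A_n,E}(a)=\max_{0\le m\le n-1}\|a-E_{n,m}(a)\|_{\mathfrak A}/\beta(m)$, and $\mathsf L^\beta_{\mathfrak A_0,E}=0$ on $\mathfrak A_0$. The Lip-norm $\mathsf L^\beta_{\mathcal U,E}$. Write $\mathsf L_{\mathfrak A_n}=\mathsf L^\beta_{\mathfrak A_n,E}$. Let $\mathfrak D_n=\mathfrak A_n\oplus\mathfrak A_{n+1}$, $\mathsf L^n(a,b)=\max\{\mathsf L_{\mathfrak A_n}(a),\mathsf L_{\mathfrak A_{n+1}}(b),\frac{\|a-b\|_{\mathfrak A}}{2\beta(n)}\}$, $\pi_n(a,b)=a$, $\omega_n(a,b)=b$. Let $\mathfrak D=\prod_n\mathfrak D_n$ (bounded sequences), $S_0((d_n)_n)=\sup_n\mathsf L^n(d_n)$ on $\mathfrak{sa}(\mathfrak D)$, $\mathfrak K_0=\{d\in\mathfrak{sa}(\mathfrak D):\pi_{n+1}(d_{n+1})=\omega_n(d_n)\ \forall n\}$, $\mathfrak L_0=\{d\in\mathfrak K_0:S_0(d)<\infty\}$, $\mathfrak S_0=\{d\in\mathfrak D:\frac{d+d^*}2,\frac{d-d^*}{2i}\in\mathfrak L_0\}$, $\mathfrak G_0=\overline{\mathfrak S_0}^{\|\cdot\|_{\mathfrak D}}$ (a unital C*-subalgebra), $\mathfrak I_0=\{d\in\mathfrak G_0:\lim_n\|d_n\|=0\}$ (a closed two-sided ideal), $\mathfrak F^\tau=\mathfrak G_0/\mathfrak I_0$ with quotient map $q$,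 and $\mathsf L_\tau(a)=\inf\{S_0(d):d\in\mathfrak{sa}(\mathfrak G_0),q(d)=a\}$ for $a\in\mathfrak{sa}(\mathfrak F^\tau)$. Let $\psi_0(a)=((a,a))_{n\in\mathbb N}$ for $a\in\mathfrak A_0$ and, for $n\ge1$, $a\in\mathfrak A_n$, $\psi_n(a)=((0,0),\dots,(0,0),(0,a),(a,a),(a,a),\dots)$ with $(0,a)\in\mathfrak D_{n-1}$; these take values in $\mathfrak G_0$. Put $\psi^{(n)}=q\circ\psi_n$. There is a unique unital *-isomorphism $\psi:\mathfrak A\to\mathfrak F^\tau$ with $\psi|_{\mathfrak A_n}=\psi^{(n)}$ for all $n$, and $\mathsf L^\beta_{\mathcal U,E}:=\mathsf L_\tau\circ\psi$, a $(2,0)$-quasi-Leibniz Lip-norm on $\mathfrak A$. *)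

(* Defs.v *)
From HB Require Import structures.
From mathcomp Require Import all_boot all_order all_algebra.
From mathcomp Require Import complex.
From mathcomp Require Import all_classical all_reals all_analysis.
Set Implicit Arguments.
Unset Strict Implicit.
Unset Printing Implicit Defensive.
Import Order.TTheory GRing.Theory Num.Theory.
Import numFieldNormedType.Exports.
Local Open Scope classical_set_scope.
Local Open Scope complex_scope.
Local Open Scope ring_scope.

Fact normcN1 (R : rcfType) : ComplexField.Normc.normc (- 1 : R[i]) = 1.
Proof. by rewrite /= sqrrN expr1n oppr0 expr0n addr0 sqrtr1. Qed.

HB.mixin Record hasStar (R : realType) A & GRing.Algebra R[i] A := {
  star : A -> A;
  starK : involutive star;
  starD : {morph star : x y / x + y};
  starZ : forall (l : R[i]) (x : A), star (l *: x) = conjc l *: star x;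
  starM : forall x y : A, star (x * y) = star y * star x }.

#[short(type="starAlgType")]
HB.structure Definition StarAlgebra (R : realType) :=
  {A of GRing.Algebra R[i] A & hasStar R A}.

(* The norm is a field of its own, with values in R: the class of normed
   modules over R[i] has an R[i]-valued norm and cannot be joined with the
   class of rings, since Num.NumDomain already inherits from both. *)
HB.mixin Record isCstar (R : realType) A & StarAlgebra R A := {
  cnorm : A -> R;
  cnormD : forall x y : A, cnorm (x + y) <= cnorm x + cnorm y;
  cnormZ : forall (l : R[i]) (x : A),
    cnorm (l *: x) = ComplexField.Normc.normc l * cnorm x;
  cnorm_eq0 : forall x : A, cnorm x = 0 -> x = 0;
  cnormM : forall x y : A, cnorm (x * y) <= cnorm x * cnorm y;
  cnorm_star : forall x : A, cnorm (star x * x) = cnorm x ^+ 2;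
  cnorm_complete : forall u : nat -> A,
    (forall e : R, 0 < e -> exists N, forall m n, (N <= m)%N -> (N <= n)%N ->
       cnorm (u m - u n) < e) ->
    exists l, forall e : R, 0 < e -> exists N, forall n, (N <= n)%N ->
       cnorm (u n - l) < e }.

#[short(type="cstarAlgType")]
HB.structure Definition CstarAlgebra (R : realType) :=
  {A of StarAlgebra R A & isCstar R A}.

(* A unital C*-subalgebra: a norm-closed unital *-subalgebra of A. *)
Record cstar_subalg (R : realType) (A : cstarAlgType R) := CstarSubalg {
  subalg_pred :> {pred A};
  subalg_predP : subalg_closed subalg_pred;
  subalg_star : forall x, x \in subalg_pred -> star x \in subalg_pred;
  subalg_norm_closed : forall x,
    (forall e : R, 0 < e -> exists2 y, y \in subalg_pred & cnorm (x - y) < e) ->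
    x \in subalg_pred }.

Section CstarSubalgebra.
Variables (R : realType) (A : cstarAlgType R) (B : cstar_subalg A).

Record csub := CSub { csub_val : A; csub_valP : csub_val \in B }.

HB.instance Definition _ := [isSub for csub_val].
HB.instance Definition _ := [Choice of csub by <:].
HB.instance Definition _ := GRing.isSubalgClosed.Build R[i] A (subalg_pred B)
  (GRing.subalg_closed_semi (subalg_predP B)).
HB.instance Definition _ := [SubChoice_isSubAlgebra of csub by <:].

Definition csub_star (x : csub) : csub := CSub (subalg_star (csub_valP x)).
Definition csub_norm (x : csub) : R := cnorm (val x).

Fact csub_starK : involutive csub_star.
Proof. by move=> x; apply: val_inj; rewrite /= starK. Qed.
Fact csub_starD : {morph csub_star : x y / x + y}.
Proof. by move=> x y; apply: val_inj; rewrite /= starD. Qed.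
Fact csub_starZ (l : R[i]) (x : csub) :
  csub_star (l *: x) = conjc l *: csub_star x.
Proof. by apply: val_inj; rewrite /= starZ. Qed.
Fact csub_starM (x y : csub) : csub_star (x * y) = csub_star y * csub_star x.
Proof. by apply: val_inj; rewrite /= starM. Qed.

HB.instance Definition _ :=
  hasStar.Build R csub csub_starK csub_starD csub_starZ csub_starM.

Fact csub_normD (x y : csub) : csub_norm (x + y) <= csub_norm x + csub_norm y.
Proof. exact: cnormD. Qed.
Fact csub_normZ (l : R[i]) (x : csub) :
  csub_norm (l *: x) = ComplexField.Normc.normc l * csub_norm x.
Proof. exact: cnormZ. Qed.
Fact csub_norm_eq0 (x : csub) : csub_norm x = 0 -> x = 0.
Proof. by move=> /cnorm_eq0 x0; apply: val_inj. Qed.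
Fact csub_normM (x y : csub) : csub_norm (x * y) <= csub_norm x * csub_norm y.
Proof. exact: cnormM. Qed.
Fact csub_norm_star (x : csub) : csub_norm (star x * x) = csub_norm x ^+ 2.
Proof. exact: cnorm_star. Qed.
Fact csub_norm_complete (u : nat -> csub) :
  (forall e : R, 0 < e -> exists N, forall m n, (N <= m)%N -> (N <= n)%N ->
     csub_norm (u m - u n) < e) ->
  exists l, forall e : R, 0 < e -> exists N, forall n, (N <= n)%N ->
     csub_norm (u n - l) < e.
Proof.
move=> cu.
have [l ul] := cnorm_complete (fun n => val (u n)) cu.
have lB : l \in B.
  apply: subalg_norm_closed => e /ul[N uN].
  exists (val (u N)); first exact: csub_valP.
  rewrite -(opprB (val (u N)) l) -scaleN1r cnormZ.
  by rewrite normcN1 mul1r uN.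
by exists (CSub lB).
Qed.

HB.instance Definition _ := isCstar.Build R csub csub_normD csub_normZ
  csub_norm_eq0 csub_normM csub_norm_star csub_norm_complete.

End CstarSubalgebra.

Section DirectSum.
Variables (R : realType) (A B : cstarAlgType R).
Local Notation AB := (A * B)%type.

Definition sum_star (x : AB) : AB := (star x.1, star x.2).
Definition sum_norm (x : AB) : R := Num.max (cnorm x.1) (cnorm x.2).

Fact sum_starK : involutive sum_star.
Proof. by move=> [a b]; rewrite /sum_star /= !starK. Qed.
Fact sum_starD : {morph sum_star : x y / x + y}.
Proof. by move=> x y; rewrite /sum_star /= !starD. Qed.
Fact sum_starZ (l : R[i]) (x : AB) : sum_star (l *: x) = conjc l *: sum_star x.
Proof. by rewrite /sum_star /= !starZ. Qed.
Fact sum_starM (x y : AB) : sum_star (x * y) = sum_star y * sum_star x.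
Proof. by rewrite /sum_star /= !starM. Qed.

HB.instance Definition _ :=
  hasStar.Build R AB sum_starK sum_starD sum_starZ sum_starM.

Fact cnorm_ge0 (C : cstarAlgType R) (x : C) : 0 <= cnorm x.
Proof.
have n0 : cnorm (0 : C) = 0.
  by rewrite -(scale0r 0) cnormZ ComplexField.Normc.normc0 mul0r.
have := cnormD x (- x); rewrite subrr n0 -scaleN1r cnormZ.
by rewrite normcN1 mul1r -mulr2n pmulrn_lge0.
Qed.

Fact sum_normD (x y : AB) : sum_norm (x + y) <= sum_norm x + sum_norm y.
Proof.
by rewrite /sum_norm ge_max; apply/andP; split;
  apply: le_trans (cnormD _ _) _; apply: lerD; rewrite le_max lexx ?orbT.
Qed.
Fact sum_normZ (l : R[i]) (x : AB) :
  sum_norm (l *: x) = ComplexField.Normc.normc l * sum_norm x.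
Proof.
rewrite /sum_norm /= !cnormZ maxr_pMr //.
by case: l => a b; rewrite sqrtr_ge0.
Qed.
Fact sum_norm_eq0 (x : AB) : sum_norm x = 0 -> x = 0.
Proof.
case: x => a b /= n0.
have : sum_norm (a, b) <= 0 by rewrite n0.
rewrite /sum_norm ge_max /= => /andP[a0 b0].
congr pair; apply: cnorm_eq0; apply/eqP; rewrite eq_le cnorm_ge0 andbT //.
Qed.
Fact sum_normM (x y : AB) : sum_norm (x * y) <= sum_norm x * sum_norm y.
Proof.
by rewrite /sum_norm ge_max; apply/andP; split;
  apply: le_trans (cnormM _ _) _; apply: ler_pM; rewrite ?cnorm_ge0 //;
  rewrite le_max lexx ?orbT.
Qed.
Fact sum_norm_star (x : AB) : sum_norm (star x * x) = sum_norm x ^+ 2.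
Proof.
rewrite /sum_norm /= !cnorm_star.
have [ab|ba] := leP (cnorm x.1) (cnorm x.2).
  by apply: max_r; rewrite ler_sqr ?nnegrE ?cnorm_ge0.
by apply: max_l; rewrite ler_sqr ?nnegrE ?cnorm_ge0 // ltW.
Qed.
Fact sum_norm_complete (u : nat -> AB) :
  (forall e : R, 0 < e -> exists N, forall m n, (N <= m)%N -> (N <= n)%N ->
     sum_norm (u m - u n) < e) ->
  exists l, forall e : R, 0 < e -> exists N, forall n, (N <= n)%N ->
     sum_norm (u n - l) < e.
Proof.
move=> cu.
have [|l1 ul1] := cnorm_complete (fun n => (u n).1).
  move=> e /cu[N uN]; exists N => m n Nm Nn.
  by have := uN m n Nm Nn; rewrite gt_max => /andP[].
have [|l2 ul2] := cnorm_complete (fun n => (u n).2).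
  move=> e /cu[N uN]; exists N => m n Nm Nn.
  by have := uN m n Nm Nn; rewrite gt_max => /andP[].
exists (l1, l2) => e e0.
have [N1 uN1] := ul1 e e0; have [N2 uN2] := ul2 e e0.
exists (maxn N1 N2) => n; rewrite geq_max => /andP[N1n N2n].
by rewrite gt_max uN1 // uN2.
Qed.

HB.instance Definition _ := isCstar.Build R AB sum_normD sum_normZ
  sum_norm_eq0 sum_normM sum_norm_star sum_norm_complete.

End DirectSum.

Section CstarNotions.
Variable R : realType.
Implicit Types A B : cstarAlgType R.

Definition sa A : set A := [set a | star a = a].

Definition star_hom A B (f : A -> B) : Prop :=
  [/\ linear f, monoid_morphism f & {morph f : x / star x}].

Definition star_iso A B (f : A -> B) : Prop := star_hom f /\ bijective f.

Definition is_state A (phi : A -> R[i]) : Prop :=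
  [/\ scalar phi, forall a, 0 <= phi (star a * a) & phi 1 = 1].

Definition mxstar A n (M : 'M[A]_n) : 'M[A]_n := \matrix_(i, j) star (M j i).

Definition mxpositive A n (M : 'M[A]_n) : Prop :=
  exists X : 'M[A]_n, M = mxstar X *m X.

Definition completely_positive A B (f : A -> B) : Prop :=
  forall n (M : 'M[A]_n), mxpositive M -> mxpositive (map_mx f M).

Definition cond_exp A (B : cstar_subalg A) (E : A -> csub B) : Prop :=
  [/\ linear E, forall a, cnorm (E a) <= cnorm a, completely_positive E &
   [/\ forall b, exists a, E a = b,
       forall b, E (val b) = b
     & forall b b' x, E (val b * x * val b') = b * E x * b']].

Definition finite_dim A (B : cstar_subalg A) : Prop :=
  exists k (v : 'I_k -> A), forall x, x \in B ->
    exists c : 'I_k -> R[i], x = \sum_(i < k) c i *: v i.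

Definition af_filtration A (An : nat -> cstar_subalg A) : Prop :=
  [/\ forall n, {subset An n <= An n.+1},
      forall n, finite_dim (An n),
      forall x, x \in An 0 <-> exists c : R[i], x = c%:A
    & forall (x : A) (e : R), 0 < e ->
        exists n, exists2 y, y \in An n & cnorm (x - y) < e].

Definition faithful_tracial_state A (mu : A -> R[i]) : Prop :=
  [/\ is_state mu, forall a b, mu (a * b) = mu (b * a)
    & forall a, mu (star a * a) = 0 -> a = 0].

End CstarNotions.

Section QuantumMetric.
Variable R : realType.
Local Open Scope ereal_scope.

(* A seminorm on sa(A) is given by a function on A, whose values outside sa(A)
   are never used. *)
Section LipNorm.
Variables (A : cstarAlgType R) (L : A -> \bar R).

Definition lip_dom : set A := [set a | sa a /\ L a < +oo].

Definition lip_dom_dense : Prop :=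
  [/\ lip_dom 1%R & forall a (e : R), sa a -> (0 < e)%R ->
        exists2 b, lip_dom b & (cnorm (a - b)%R < e)%R].

Definition mk (phi psi : A -> R[i]) : \bar R :=
  ereal_sup [set (ComplexField.Normc.normc (phi a - psi a)%R)%:E |
             a in [set a | sa a /\ L a <= 1]].

Definition sa_seminorm : Prop :=
  [/\ forall a, sa a -> 0 <= L a,
      forall (t : R) a, sa a -> L (t%:C *: a) = `|t|%:E * L a
    & forall a b, sa a -> sa b -> L (a + b)%R <= L a + L b].

(* The weak* topology is the topology of pointwise convergence on A, restricted
   to the states. *)
Definition mk_metrizes_weak_star : Prop :=
  [/\ forall phi psi, is_state phi -> is_state psi -> mk phi psi < +oo,
      forall phi psi, is_state phi -> is_state psi ->
        mk phi psi = 0 -> phi = psi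
    & forall phi (U : set (A -> R[i])), is_state phi ->
        within (@is_state R A) (nbhs (phi : {ptws A -> R[i]^o})) U <->
        exists2 e : R, (0 < e)%R &
          forall psi, is_state psi -> mk phi psi < e%:E -> U psi].

Definition sa_lower_semicontinuous : Prop :=
  forall a (r : R), sa a -> r%:E < L a ->
    exists2 e : R, (0 < e)%R &
      forall b, sa b -> (cnorm (b - a)%R < e)%R -> r%:E < L b.

Definition lip_norm : Prop :=
  [/\ sa_seminorm,
      lip_dom_dense,
      forall a, sa a -> (L a = 0 <-> exists t : R, a = (t%:C)%:A),
      mk_metrizes_weak_star
    & sa_lower_semicontinuous].

Definition quasi_leibniz : Prop :=
  forall a b, lip_dom a -> lip_dom b ->
    maxe (L (2^-1 *: (a * b + b * a))%R)
         (L ((2 * 'i)^-1 *: (a * b - b * a))%R)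
    <= 2%:E * ((cnorm a)%:E * L b + (cnorm b)%:E * L a).

End LipNorm.

Definition qleibniz_lip_norm (A : cstarAlgType R) (L : A -> \bar R) : Prop :=
  lip_norm L /\ quasi_leibniz L.

(* (2,0)-quasi-Leibniz compact quantum metric spaces *)
Record qcms := QCMS {
  qcms_alg :> cstarAlgType R;
  lipn : qcms_alg -> \bar R;
  lipnP : qleibniz_lip_norm lipn }.

Definition quantum_isometry (X Y : qcms) (f : X -> Y) : Prop :=
  star_iso f /\ forall a, sa a -> lipn (f a) = lipn a.

Definition hausdorff_dist (T : Type) (d : T -> T -> \bar R) (S S' : set T) :
    \bar R :=
  maxe (ereal_sup [set ereal_inf [set d x y | y in S'] | x in S])
       (ereal_sup [set ereal_inf [set d x y | x in S] | y in S']).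

Definition lip_quotient (X Y : qcms) (f : X -> Y) : Prop :=
  forall a, sa a ->
    lipn a = ereal_inf [set lipn d | d in [set d | sa d /\ f d = a]].

Record tunnel (X1 X2 : qcms) := Tunnel {
  tun_space : qcms;
  tun_left : tun_space -> X1;
  tun_right : tun_space -> X2;
  tun_left_hom : star_hom tun_left;
  tun_right_hom : star_hom tun_right;
  tun_left_surj : forall a, exists d, tun_left d = a;
  tun_right_surj : forall a, exists d, tun_right d = a;
  tun_left_quotient : lip_quotient tun_left;
  tun_right_quotient : lip_quotient tun_right }.

Definition extent (X1 X2 : qcms) (t : tunnel X1 X2) : \bar R :=
  let states := [set phi | is_state phi] : set (tun_space t -> R[i]) in
  maxe
    (hausdorff_dist (mk (@lipn (tun_space t))) states
       [set phi \o @tun_left _ _ t | phi in [set phi | is_state phi]])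
    (hausdorff_dist (mk (@lipn (tun_space t))) states
       [set phi \o @tun_right _ _ t | phi in [set phi | is_state phi]]).

Definition dual_propinquity (X1 X2 : qcms) : \bar R :=
  ereal_inf [set l | exists t : tunnel X1 X2, l = extent t].

Definition level_set (D : cstarAlgType R) (omega : D) : set (D -> R[i]) :=
  [set psi | is_state psi /\
     forall d, psi d = psi (omega * d)%R /\ psi d = psi (d * omega)%R].

Record bridge (A B : cstarAlgType R) := Bridge {
  br_alg : cstarAlgType R;
  br_pivot : br_alg;
  br_left : A -> br_alg;
  br_right : B -> br_alg;
  br_level_neq0 : level_set br_pivot !=set0;
  br_left_hom : star_hom br_left;
  br_right_hom : star_hom br_right;
  br_left_inj : injective br_left;
  br_right_inj : injective br_right }.

Section BridgeLength.
Variables (X Y : qcms) (g : bridge X Y).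
Local Notation omega := (br_pivot g).

Definition bridge_reach : \bar R :=
  hausdorff_dist (fun c d : br_alg g => (cnorm (c - d)%R)%:E)
    [set (br_left g a * omega)%R | a in [set a | sa a /\ lipn a <= 1]]
    [set (omega * br_right g b)%R | b in [set b | sa b /\ lipn b <= 1]].

Definition bridge_height : \bar R :=
  maxe
    (hausdorff_dist (mk (@lipn X)) [set phi | is_state phi]
       [set phi \o br_left g | phi in level_set omega])
    (hausdorff_dist (mk (@lipn Y)) [set phi | is_state phi]
       [set phi \o br_right g | phi in level_set omega]).

Definition bridge_length : \bar R := maxe bridge_reach bridge_height.

End BridgeLength.

(* bridge_chain X Y l : there is a finite chain of bridges from X to Y whose
   lengths add up to l. *)
Inductive bridge_chain : qcms -> qcms -> \bar R -> Prop :=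
| bridge_chain1 (X Y : qcms) (g : bridge X Y) : bridge_chain X Y (bridge_length g)
| bridge_chain_cons (X Y Z : qcms) (g : bridge X Y) l :
    bridge_chain Y Z l -> bridge_chain X Z (bridge_length g + l).

Definition propinquity (X Y : qcms) : \bar R := ereal_inf (bridge_chain X Y).

End QuantumMetric.

Section InductiveSequence.
Variables (R : realType) (A : cstarAlgType R) (An : nat -> cstar_subalg A).
Variable beta : nat -> R.

Definition lip_state (E : forall n, A -> csub (An n)) (a : A) : \bar R :=
  ereal_sup (range (fun n => (cnorm (a - val (E n a)) / beta n)%:E)).

Definition cond_step (E : forall n, A -> csub (An n)) :
    forall n, csub (An n.+1) -> csub (An n) :=
  fun n a => E n (val a).

Section Steps.
(* The maps E_{n+1,n} *)
Variable Estep : forall n, csub (An n.+1) -> csub (An n).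

(* E_{n,m} a as an element of A; for n <= m, the element a itself. *)
Fixpoint Ecomp (m n : nat) : csub (An n) -> A :=
  match n return csub (An n) -> A with
  | 0 => fun a => val a
  | k.+1 => fun a => if (m <= k)%N then Ecomp m (Estep a) else val a
  end.

Definition lip_fin (n : nat) (a : csub (An n)) : \bar R :=
  (\big[Num.max/0]_(m < n) (cnorm (val a - Ecomp m a) / beta m))%:E.

(* The underlying family of an element of the product of the D_n *)
Definition dseq := forall n, (csub (An n) * csub (An n.+1))%type.
Implicit Types d e : dseq.

Definition lip_pair n (x : csub (An n) * csub (An n.+1)) : \bar R :=
  maxe (lip_fin x.1) (maxe (lip_fin x.2)
    (cnorm (val x.1 - val x.2) / (2 * beta n))%:E).

Definition dadd d e : dseq := fun n => d n + e n.
Definition dsub d e : dseq := fun n => d n - e n.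
Definition dmul d e : dseq := fun n => d n * e n.
Definition dscale (l : R[i]) d : dseq := fun n => l *: d n.
Definition dstar d : dseq := fun n => star (d n).
Definition dunit : dseq := fun n => 1.

Definition dnorm d : \bar R := ereal_sup (range (fun n => (cnorm (d n))%:E)).
Definition dprod : set dseq := [set d | (dnorm d < +oo)%E].
Definition dsa : set dseq := [set d | dprod d /\ dstar d = d].

Definition S0 d : \bar R := ereal_sup (range (fun n => lip_pair (d n))).

Definition K0 : set dseq := [set d | dsa d /\ forall n, (d n.+1).1 = (d n).2].
Definition L0 : set dseq := [set d | K0 d /\ (S0 d < +oo)%E].
Definition SS0 : set dseq :=
  [set d | [/\ dprod d, L0 (dscale 2^-1 (dadd d (dstar d)))
             & L0 (dscale (2 * 'i)^-1 (dsub d (dstar d)))]].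
Definition G0 : set dseq :=
  [set d | dprod d /\ forall e : R, 0 < e ->
             exists2 s, SS0 s & (dnorm (dsub d s) < e%:E)%E].
Definition I0 : set dseq :=
  [set d | G0 d /\ (fun n => cnorm (d n)) @ \oo --> (0 : R)].

(* The quotient G0 / I0 is the set of cosets modulo I0 of elements of G0; its
   operations are those of representatives. *)
Definition coset d : set dseq := [set e | G0 e /\ I0 (dsub e d)].
Definition Ftau : set (set dseq) := [set coset d | d in G0].

Definition lip_tau (c : set dseq) : \bar R :=
  ereal_inf [set S0 d | d in [set d | [/\ G0 d, dsa d & coset d = c]]].

(* The inclusion of A_m into A_n when m <= n *)
Definition incl m n (a : csub (An m)) : csub (An n) := insubd 0 (val a).

Definition psin n (a : csub (An n)) : dseq := fun k =>
  (if (n <= k)%N then incl k a else 0, if (n <= k.+1)%N then incl k.+1 a else 0).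

(* psi is a unital *-isomorphism of A onto G0 / I0 *)
Definition quotient_star_iso (psi : A -> set dseq) : Prop :=
  [/\ set_bij setT Ftau psi,
      psi 1 = coset dunit,
      forall a b d e, G0 d -> G0 e -> psi a = coset d -> psi b = coset e ->
        psi (a + b) = coset (dadd d e) /\ psi (a * b) = coset (dmul d e),
      forall (l : R[i]) a d, G0 d -> psi a = coset d ->
        psi (l *: a) = coset (dscale l d)
    & forall a d, G0 d -> psi a = coset d -> psi (star a) = coset (dstar d)].

Definition psi_spec (psi : A -> set dseq) : Prop :=
  quotient_star_iso psi /\
  forall n (a : csub (An n)), psi (val a) = coset (psin a).

(* The unique function satisfying psi_spec *)
Definition psi : A -> set dseq := xget (fun=> set0) psi_spec.

Definition lip_seq (a : A) : \bar R := lip_tau (psi a).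

End Steps.

End InductiveSequence.

(* Main.v *)
Require Import Defs.
From mathcomp Require Import all_boot all_order all_algebra.
From mathcomp Require Import complex ring lra.
From mathcomp Require Import all_classical all_reals all_analysis.
Set Implicit Arguments.
Unset Strict Implicit.
Unset Printing Implicit Defensive.
Import Order.TTheory GRing.Theory Num.Theory.
Import numFieldNormedType.Exports.
Local Open Scope classical_set_scope.
Local Open Scope complex_scope.
Local Open Scope ring_scope.

(* The infimum defining L_tau (psi a) runs over sequences a_n in A_n tending to a.
   On self-adjoint elements the martingale a_n = E_n a is an optimal lift: E_n is
   contractive and E_m E_n = E_m for m <= n, so its cost is at most L_mu a, while
   lower semicontinuity of L_mu bounds the cost of any lift below by L_mu a. Hence
   the two Lip-norms on A agree on sa(A), and the identity is a quantum isometry.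
   The map psi is the inverse of "take the limit"; uniqueness holds because star
   homomorphisms are contractive. Contractivity is elementary: if x is
   self-adjoint with `|x| < 1 then 1 - x^2 = y^2 with y self-adjoint commuting
   with x, and f(x)^2 + f(y)^2 = 1 forces `|f(x)| <= 1.

   For the propinquities, the inclusion of A_n in A with pivot 1 is a bridge of
   length at most beta n. The dual propinquity is bounded by absorbing a chain of
   bridges from its far end: a bridge (w, pi, rho) from X to Y of length < lam and
   a tunnel (D, p, q) from Y to Z give the tunnel X (+) D with
     L (a, d) = max (L_X a, L_D d, `|pi a * w - w * rho (p d)| / lam),
   whose extent exceeds that of the first one by at most 2 lam. *)

(** * C*-norms and states *)

(** The costly axiom is that the Monge-Kantorovich metric induces the weak* topology; it has to be
    established for L_mu on A, for its restrictions to the A_n and for every direct sum X (+) D.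
    Density of the domain already puts an mk-ball inside each weak* neighbourhood, so each case
    comes down to mk being finite, and small near each state. For L_mu this is a finite-dimensional
    estimate. On a direct sum, a state is a convex combination of states of the summands, and the
    coupling by the bridge keeps the summands at bounded distance.

    The 2 lam has two sources: moving a state into the level set of the pivot costs lam (the
    height), and carrying a level state across the bridge costs lam (the scale of the coupling
    seminorm). The absorption of a chain starts from the identity tunnel at the far end, of extent
    0, so the total is twice the length of the chain.

    Near points and lifts come from infima that need not be attained, so lengths, extents and
    Lip-norms are handled through strict upper bounds with a slack tending to 0. *)

Local Notation normc := ComplexField.Normc.normc.

Section ComplexModulus.
Variable R : realType.
Implicit Types (z : R[i]) (t : R).

Lemma normc_real t : normc t%:C = `|t|.
Proof. by rewrite /= expr0n addr0 sqrtr_sqr. Qed.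

Lemma normc_ge0 z : 0 <= normc z.
Proof. by case: z => a b; apply: sqrtr_ge0. Qed.

Lemma normr_normc z : `|z| = (normc z)%:C.
Proof. by []. Qed.

Lemma normcD z w : normc (z + w) <= normc z + normc w.
Proof. exact: le_normcD. Qed.

Lemma normcB z w : normc (z - w) = normc (w - z).
Proof. by rewrite -opprB normcN. Qed.

Lemma normc_i : normc ('i : R[i]) = 1.
Proof. by rewrite /= expr0n add0r expr1n sqrtr1. Qed.

Lemma normc_half : normc (2^-1 : R[i]) = 2^-1.
Proof.
by rewrite ComplexField.Normc.normcV -(rmorph_nat (real_complex R) 2) normc_real ger0_norm.
Qed.

Lemma normc_half_i : normc ((2 * 'i)^-1 : R[i]) = 2^-1.
Proof.
rewrite ComplexField.Normc.normcV ComplexField.Normc.normcM normc_i mulr1.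
by rewrite -(rmorph_nat (real_complex R) 2) normc_real ger0_norm.
Qed.

Lemma normc0P z : normc z <= 0 -> z = 0.
Proof.
by move=> z0; apply: ComplexField.Normc.eq0_normc; apply/eqP; rewrite eq_le z0 normc_ge0.
Qed.

End ComplexModulus.

Section CstarNorm.
Variables (R : realType) (A : cstarAlgType R).
Implicit Types (x y : A) (t : R) (l : R[i]).

Lemma cnorm0 : cnorm (0 : A) = 0.
Proof. by rewrite -(scale0r 0) cnormZ ComplexField.Normc.normc0 mul0r. Qed.

Lemma cnormN x : cnorm (- x) = cnorm x.
Proof. by rewrite -scaleN1r cnormZ normcN1 mul1r. Qed.

Lemma cnormB x y : cnorm (x - y) = cnorm (y - x).
Proof. by rewrite -opprB cnormN. Qed.

Lemma cnorm_sub x y : cnorm (x - y) <= cnorm x + cnorm y.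
Proof. by rewrite -(cnormN y) cnormD. Qed.

Lemma cnorm_trans y x z : cnorm (x - z) <= cnorm (x - y) + cnorm (y - z).
Proof. by have := cnormD (x - y) (y - z); rewrite addrA subrK. Qed.

Lemma cnormZr t x : cnorm (t%:C *: x) = `|t| * cnorm x.
Proof. by rewrite cnormZ normc_real. Qed.

Lemma cnorm_half x : cnorm (2^-1 *: x) = 2^-1 * cnorm x.
Proof. by rewrite cnormZ normc_half. Qed.

Lemma star0 : star (0 : A) = 0.
Proof. by rewrite -(scale0r 0) starZ rmorph0 !scale0r. Qed.

Lemma starN x : star (- x) = - star x.
Proof. by rewrite -scaleN1r starZ rmorphN1 scaleN1r. Qed.

Lemma starB x y : star (x - y) = star x - star y.
Proof. by rewrite starD starN. Qed.

Lemma star1 : star (1 : A) = 1.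
Proof. by rewrite -[LHS]mulr1 -{2}(starK 1) -starM mulr1 starK. Qed.

Lemma norm_star x : cnorm (star x) = cnorm x.
Proof.
suff le y : cnorm y <= cnorm (star y).
  by apply/eqP; rewrite eq_le le -{2}(starK x) le.
have [->|y0] := eqVneq (cnorm y) 0; first exact: cnorm_ge0.
have y_gt0 : 0 < cnorm y by rewrite lt_def y0 cnorm_ge0.
by rewrite -(ler_pM2r y_gt0) -expr2 -cnorm_star cnormM.
Qed.

Lemma cnorm_eq0P x : cnorm x <= 0 -> x = 0.
Proof. by move=> x0; apply: cnorm_eq0; apply/eqP; rewrite eq_le x0 cnorm_ge0. Qed.

Lemma cnorm1_le1 : cnorm (1 : A) <= 1.
Proof.
have := cnorm_star (1 : A); rewrite star1 mulr1.
have := cnorm_ge0 (1 : A); nra.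
Qed.

Definition re_part x : A := 2^-1 *: (x + star x).
Definition im_part x : A := (2 * 'i)^-1 *: (x - star x).

Lemma conjc_half : conjc (2^-1 : R[i]) = 2^-1.
Proof. by rewrite fmorphV rmorph_nat. Qed.

Lemma conjc_half_i : conjc ((2 * 'i)^-1 : R[i]) = - (2 * 'i)^-1.
Proof.
rewrite fmorphV rmorphM rmorph_nat /= -invrN -mulrN; congr ((_ * _)^-1).
by apply/eqP; rewrite eq_complex /= oppr0 !eqxx.
Qed.

Lemma sa_re_part x : sa (re_part x).
Proof. by rewrite /sa /= starZ conjc_half starD starK addrC. Qed.

Lemma sa_im_part x : sa (im_part x).
Proof.
by rewrite /sa /= starZ conjc_half_i starB starK scaleNr -scalerN opprB.
Qed.

Lemma half_double x : 2^-1 *: (x + x) = x.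
Proof.
by rewrite -[x in x + _]scale1r -[x in _ + x]scale1r -scalerDl scalerA mulVf
  ?scale1r // pnatr_eq0.
Qed.

Lemma re_imE x : x = re_part x + 'i *: im_part x.
Proof.
rewrite /re_part /im_part scalerA.
have -> : 'i * (2 * 'i)^-1 = 2^-1 :> R[i].
  by rewrite invfM mulrCA divff ?mulr1 // -normr_eq0 normr_normc normc_i oner_eq0.
rewrite -scalerDr addrACA subrr addr0.
exact/esym/half_double.
Qed.

Lemma cnorm_re_part x : cnorm (re_part x) <= cnorm x.
Proof.
rewrite cnorm_half mulrC ler_pdivrMr // mulr_natr mulr2n.
by apply: le_trans (cnormD _ _) _; rewrite norm_star.
Qed.

Lemma re_part_sa x : sa x -> re_part x = x.
Proof.
rewrite /sa /re_part /= => ->.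
exact: half_double.
Qed.

Lemma sa0 : sa (0 : A). Proof. exact: star0. Qed.
Lemma sa1 : sa (1 : A). Proof. exact: star1. Qed.
Lemma saD x y : sa x -> sa y -> sa (x + y).
Proof. by rewrite /sa /= starD => -> ->. Qed.
Lemma saN x : sa x -> sa (- x).
Proof. by rewrite /sa /= starN => ->. Qed.
Lemma saB x y : sa x -> sa y -> sa (x - y).
Proof. by rewrite /sa /= starB => -> ->. Qed.
Lemma conjc_real t : conjc t%:C = t%:C.
Proof. by rewrite /= oppr0. Qed.
Lemma saZ t x : sa x -> sa (t%:C *: x).
Proof. by rewrite /sa /= starZ conjc_real => ->. Qed.
Lemma sa_jordan x y : sa x -> sa y -> sa (2^-1 *: (x * y + y * x)).
Proof.
by rewrite /sa /= => sx sy; rewrite starZ conjc_half starD !starM sx sy addrC.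
Qed.
Lemma sa_lie x y : sa x -> sa y -> sa ((2 * 'i)^-1 *: (x * y - y * x)).
Proof.
rewrite /sa /= => sx sy.
by rewrite starZ conjc_half_i starB !starM sx sy scaleNr -scalerN opprB.
Qed.

Lemma sa_scalarP l : sa (l%:A : A) -> l = (complex.Re l)%:C.
Proof.
rewrite /sa /= starZ star1 => /eqP; rewrite -subr_eq0 -scalerBl scaler_eq0.
rewrite (negbTE (oner_neq0 _)) orbF subr_eq0.
case: l => a b /eqP /= [] bN; congr (_ +i* _); lra.
Qed.

End CstarNorm.

(** * Norm convergence of sequences *)

Section NormConvergence.
Variables (R : realType) (A : cstarAlgType R).
Implicit Types (u v : nat -> A) (x y l : A).

(** Convergence is read off the real sequence of norms, since [cnorm] is a field of the algebra and
    not the norm of a topological structure. The limit laws below are obtained by squeezing. *)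
Definition ctends u l : Prop := (fun n => cnorm (u n - l)) @ \oo --> (0 : R).

Lemma ctendsP u l :
  ctends u l <-> forall e : R, 0 < e -> exists N, forall n, (N <= n)%N -> cnorm (u n - l) < e.
Proof.
split=> [ul e e0|ul].
  move/cvgrPdist_lt: ul => /(_ e e0)[N _ uN]; exists N => n Nn.
  by have := uN n Nn; rewrite /= sub0r normrN ger0_norm // cnorm_ge0.
apply/cvgrPdist_lt => e /ul[N uN]; exists N => // n Nn.
by rewrite /= sub0r normrN ger0_norm ?cnorm_ge0 // uN.
Qed.

Lemma ctends_squeeze u l (b : nat -> R) :
  (\forall n \near \oo, cnorm (u n - l) <= b n) -> b @ \oo --> (0 : R) -> ctends u l.
Proof.
move=> ub b0; apply: (@squeeze_cvgr _ _ _ _ (fun=> 0) b) => //; last exact: cvg_cst.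
by apply: filterS ub => n ->; rewrite cnorm_ge0.
Qed.

Lemma ctends_cst x : ctends (fun=> x) x.
Proof. by rewrite /ctends subrr cnorm0; exact: cvg_cst. Qed.

Lemma ctends_near u v l : (\forall n \near \oo, u n = v n) -> ctends u l -> ctends v l.
Proof.
move=> uv ul; apply: ctends_squeeze ul.
by apply: filterS uv => n ->.
Qed.

Lemma ctends_unique u x y : ctends u x -> ctends u y -> x = y.
Proof.
move=> ux uy; apply/eqP; rewrite -subr_eq0; apply/eqP/cnorm_eq0P.
have := cvgD ux uy; rewrite addr0 => /(_ _)/cvgr_to_ge; apply.
apply: nearW => n.
rewrite (le_trans (cnorm_trans (u n) x y)) //= lerD2r.
by rewrite cnormB.
Qed.

Lemma ctendsD u v x y : ctends u x -> ctends v y -> ctends (fun n => u n + v n) (x + y).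
Proof.
move=> ux vy; apply: ctends_squeeze; last by have := cvgD ux vy; rewrite addr0; apply.
by apply: nearW => n /=; rewrite opprD addrACA cnormD.
Qed.

Lemma ctendsZ (l : R[i]) u x : ctends u x -> ctends (fun n => l *: u n) (l *: x).
Proof.
move=> ux; apply: ctends_squeeze; last first.
  by have := cvgM (cvg_cst (normc l)) ux; rewrite mulr0; apply.
by apply: nearW => n /=; rewrite -scalerBr cnormZ.
Qed.

Lemma ctendsN u x : ctends u x -> ctends (fun n => - u n) (- x).
Proof.
move=> ux; apply: ctends_squeeze ux.
by apply: nearW => n /=; rewrite -opprD cnormN.
Qed.

Lemma ctendsB u v x y : ctends u x -> ctends v y -> ctends (fun n => u n - v n) (x - y).
Proof. by move=> ux /ctendsN; exact: ctendsD. Qed.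

Lemma ctends_star u x : ctends u x -> ctends (fun n => star (u n)) (star x).
Proof.
move=> ux; apply: ctends_squeeze ux.
by apply: nearW => n /=; rewrite -starB norm_star.
Qed.

Lemma ctends_norm u x : ctends u x -> (fun n => cnorm (u n)) @ \oo --> cnorm x.
Proof.
move=> ux; apply/cvgrPdist_le => e e0.
move/ctendsP: ux => /(_ e e0)[N uN]; exists N => // n /uN/ltW un /=.
apply: le_trans un; rewrite cnormB ler_norml; apply/andP; split.
  by rewrite lerNl opprB lerBlDr -{1}(subrK x (u n)) cnormB cnormD.
by rewrite lerBlDr -{1}(subrK (u n) x) cnormD.
Qed.

Lemma ctendsM u v x y : ctends u x -> ctends v y -> ctends (fun n => u n * v n) (x * y).
Proof.
move=> ux vy; apply: ctends_squeeze; last first.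
  have := cvgD (cvgM ux (ctends_norm vy)) (cvgM (cvg_cst (cnorm x)) vy).
  by rewrite mul0r mulr0 addr0; apply.
apply: nearW => n /=.
have -> : u n * v n - x * y = (u n - x) * v n + x * (v n - y).
  by rewrite mulrBl mulrBr addrA subrK.
by apply: le_trans (cnormD _ _) _; apply: lerD; exact: cnormM.
Qed.

Lemma ctends_shift u x : ctends u x -> ctends (fun n => u n.+1) x.
Proof.
move=> /ctendsP ux; apply/ctendsP => e /ux[N uN]; exists N => n Nn.
by rewrite uN // (leq_trans Nn).
Qed.

Lemma cauchy_ctends u :
  (forall e : R, 0 < e -> exists N, forall m n, (N <= m)%N -> (N <= n)%N ->
     cnorm (u m - u n) < e) -> exists l, ctends u l.
Proof. by move=> /cnorm_complete[l ul]; exists l; apply/ctendsP. Qed.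

(** Increments telescope to a difference of partial sums. It serves twice: with a geometric series
    for square roots, and with [beta] for sequences of finite cost. *)
Lemma summable_cauchy u (b : nat -> R) : cvgn (series b) ->
  (forall n, cnorm (u n - u n.+1) <= b n) ->
  forall e : R, 0 < e -> exists N, forall m n, (N <= m)%N -> (N <= n)%N ->
     cnorm (u m - u n) < e.
Proof.
move=> sb ub e e0.
have le m n : (m <= n)%N -> cnorm (u m - u n) <= series b n - series b m.
  elim: n => [|n IH]; first by rewrite leqn0 => /eqP ->; rewrite !subrr cnorm0.
  rewrite leq_eqVlt => /predU1P[->|]; first by rewrite !subrr cnorm0.
  rewrite ltnS => /IH mn; apply: le_trans (cnorm_trans (u n) _ _) _.
  by rewrite seriesSr addrAC; apply: lerD.
move/cvgrPdist_lt: (sb) => /(_ _ (divr_gt0 e0 (ltr0Sn _ 1)))[N _ sN].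
exists N => m n Nm Nn; wlog mn : m n Nm Nn / (m <= n)%N => [th|].
  by case/orP: (leq_total m n) => [/th|/th]; [exact|rewrite cnormB; exact].
apply: le_lt_trans (le _ _ mn) _.
have := sN m Nm; have := sN n Nn; rewrite /= !ltr_norml => /andP[] + + /andP[].
lra.
Qed.

End NormConvergence.

(** * Square roots and contractivity of star homomorphisms *)

Section SquareRoot.
Variables (R : realType) (A : cstarAlgType R).
Implicit Types x y : A.

(** Each iterate is a polynomial in x, so self-adjointness and commutation with whatever commutes
    with x pass to the limit. *)
Fixpoint sqrt_iter x n : A :=
  if n is k.+1 then 2^-1 *: (x + sqrt_iter x k * sqrt_iter x k) else 0.

Lemma sqrt_iter_comm x y n : x * y = y * x -> sqrt_iter x n * y = y * sqrt_iter x n.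
Proof.
move=> xy; elim: n => [|n IH] /=; first by rewrite mul0r mulr0.
by rewrite -scalerAl -scalerAr mulrDl mulrDr xy -mulrA IH mulrA IH mulrA.
Qed.

Lemma sqrt_iter_sa x n : sa x -> sa (sqrt_iter x n).
Proof.
rewrite /sa /= => sx; elim: n => [|n IH] /=; first exact: star0.
by rewrite starZ conjc_half starD starM sx IH.
Qed.

(* 1 - x = y ^+ 2 amounts to 1 - y being a fixed point of z |-> (x + z ^+ 2) / 2,
   a contraction of ratio `|x| on the ball of radius `|x|. *)
Lemma one_sub_sqrt x : sa x -> cnorm x < 1 ->
  exists y, [/\ sa y, y * y = 1 - x & forall z, x * z = z * x -> y * z = z * y].
Proof.
move=> sx x1; set r := cnorm x in x1; have r0 : 0 <= r := cnorm_ge0 _.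
pose u := sqrt_iter x.
have ur n : cnorm (u n) <= r.
  elim: n => [|n IH] /=; first by rewrite cnorm0.
  rewrite cnorm_half.
  have := cnormD x (u n * u n); have := cnormM (u n) (u n).
  have := cnorm_ge0 (u n); rewrite -/(u n) -/r; nra.
have du n : cnorm (u n - u n.+1) <= r * r ^+ n.
  elim: n => [|n IH].
    rewrite sub0r cnormN cnorm_half /= mulr0 addr0 expr0 mulr1 -/r; lra.
  rewrite [u n.+1]/= [u n.+2]/= -/(u n) -/(u n.+1) -scalerBr cnorm_half.
  (* This splitting of a difference of squares uses no commutation. Each summand is at most r times
     the increment, and the factor 1/2 in the iteration restores the ratio r. *)
  have -> : x + u n * u n - (x + u n.+1 * u n.+1) =
            u n * (u n - u n.+1) + (u n - u n.+1) * u n.+1.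
    by rewrite mulrBr mulrBl addrA subrK opprD addrACA subrr add0r.
  have := cnormD (u n * (u n - u n.+1)) ((u n - u n.+1) * u n.+1).
  have := cnormM (u n) (u n - u n.+1); have := cnormM (u n - u n.+1) (u n.+1).
  have := ur n; have := ur n.+1; have := cnorm_ge0 (u n - u n.+1).
  have := cnorm_ge0 (u n); have := cnorm_ge0 (u n.+1).
  rewrite exprS; set a := cnorm (u n); set b := cnorm (u n.+1).
  set d := cnorm (u n - _) in IH *; set rn := r ^+ n in IH *.
  move=> b0 a0 d0 br ar h1 h2 h3.
  have : a * d <= r * (r * rn) by apply: ler_pM.
  have : d * b <= (r * rn) * r by apply: ler_pM.
  lra.
have [|l ul] := cauchy_ctends (summable_cauchy (b := geometric r r) _ du).
  by apply: is_cvg_geometric_series; rewrite ger0_norm.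
have lE : l = 2^-1 *: (x + l * l).
  apply: ctends_unique (ctends_shift ul) _.
  exact: ctendsZ (ctendsD (ctends_cst x) (ctendsM ul ul)).
exists (1 - l); split.
- apply: (saB (@sa1 _ A)); apply: ctends_unique (ctends_star ul) _.
  rewrite (_ : (fun n => _) = u) //; apply/funext => n.
  exact: sqrt_iter_sa.
- have l2 : l + l = x + l * l.
    by rewrite -[RHS]half_double scalerDr -lE.
  have -> : (1 - l) * (1 - l) = 1 - (l + l) + l * l.
    by rewrite mulrBr mulr1 mulrBl mul1r !opprD opprK !addrA.
  by rewrite l2 opprD addrA subrK.
move=> z xz; rewrite mulrBl mulrBr mul1r mulr1; congr (_ - _).
apply: ctends_unique (ctendsM ul (ctends_cst z)) _.
rewrite (_ : (fun n => _) = (fun n => z * u n)).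
  exact: ctendsM (ctends_cst z) ul.
by apply/funext => n; exact: sqrt_iter_comm.
Qed.

End SquareRoot.

Section StarHom.
Variables (R : realType) (A B : cstarAlgType R) (f : A -> B).
Hypothesis hf : star_hom f.

Lemma star_homD x y : f (x + y) = f x + f y.
Proof. by case: hf => fl _ _; have := fl 1 x y; rewrite !scale1r. Qed.
Lemma star_hom0 : f 0 = 0.
Proof. by apply: (addrI (f 0)); rewrite -star_homD !addr0. Qed.
Lemma star_homZ l x : f (l *: x) = l *: f x.
Proof. by case: hf => fl _ _; have := fl l x 0; rewrite !addr0 star_hom0 addr0. Qed.
Lemma star_homN x : f (- x) = - f x.
Proof. by rewrite -scaleN1r star_homZ scaleN1r. Qed.
Lemma star_homB x y : f (x - y) = f x - f y.
Proof. by rewrite star_homD star_homN. Qed.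
Lemma star_homM x y : f (x * y) = f x * f y.
Proof. by case: hf => _ [_ fM] _. Qed.
Lemma star_hom1 : f 1 = 1.
Proof. by case: hf => _ [f1 _] _. Qed.
Lemma star_hom_star x : f (star x) = star (f x).
Proof. by case: hf. Qed.
Lemma star_hom_sa x : sa x -> sa (f x).
Proof. by rewrite /sa /= -star_hom_star => ->. Qed.

(* u is the real part of w = u + i v, and `|w|^2 = `|w^* w| = `|u^2 + v^2|. *)
Lemma sa_sqr_le (u v : B) : sa u -> sa v -> u * v = v * u ->
  cnorm u ^+ 2 <= cnorm (u * u + v * v).
Proof.
rewrite /sa /= => su sv uv; set w := u + 'i *: v.
have ci : conjc ('i : R[i]) = - 'i by apply/eqP; rewrite eq_complex /= oppr0 !eqxx.
have sw : star w = u - 'i *: v by rewrite starD starZ su sv ci scaleNr.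
have -> : u * u + v * v = star w * w.
  have h1 : u * ('i *: v) = ('i *: v) * u by rewrite -scalerAl -scalerAr uv.
  have h2 : ('i *: v) * ('i *: v) = - (v * v).
    by rewrite -scalerAl -scalerAr scalerA -expr2 sqrCi scaleN1r.
  by rewrite sw mulrBl !mulrDr h1 h2 opprD opprK addrA addrK.
rewrite cnorm_star ler_pXn2r ?nnegrE ?cnorm_ge0 //.
suff -> : u = re_part w by exact: cnorm_re_part.
by rewrite /re_part sw addrACA subrr addr0 half_double.
Qed.

Lemma star_hom_contractive x : cnorm (f x) <= cnorm x.
Proof.
have main y : sa y -> cnorm y < 1 -> cnorm (f y) <= 1.
  move=> sy y1; have syy : sa (y * y) by rewrite /sa /= starM sy.
  have [|z [sz zz zc]] := one_sub_sqrt syy.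
    apply: le_lt_trans (cnormM _ _) _; have := cnorm_ge0 y; nra.
  have yz : z * y = y * z by apply: zc; rewrite mulrA.
  have := sa_sqr_le (star_hom_sa sy) (star_hom_sa sz).
  rewrite -!star_homM yz => /(_ erefl).
  rewrite -star_homD zz addrC subrK star_hom1.
  have := cnorm1_le1 B; have := cnorm_ge0 (f y); nra.
have {main}sac y : sa y -> cnorm (f y) <= cnorm y.
  move=> sy; apply/ler_addgt0Pr => e e0; set t := cnorm y + e.
  have t0 : 0 < t by rewrite ltr_wpDl // cnorm_ge0.
  have := main (t^-1%:C *: y) (saZ _ sy).
  rewrite star_homZ !cnormZr ger0_norm ?invr_ge0 ?(ltW t0) // mulrC ltr_pdivrMr // mul1r.
  rewrite ltrDl => /(_ e0); rewrite mulrC ler_pdivrMr // mul1r //.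
(* The C*-identity carries the bound from the self-adjoint element [star x * x] to x. *)
have sxx : sa (star x * x) by rewrite /sa /= starM starK.
have := sac _ sxx; rewrite star_homM star_hom_star !cnorm_star.
by rewrite ler_pXn2r ?nnegrE ?cnorm_ge0.
Qed.

End StarHom.

(** * Positive functionals and states *)

Section States.
Variables (R : realType) (A : cstarAlgType R) (phi : A -> R[i]).
Hypothesis hphi : is_state phi.

Lemma stateD x y : phi (x + y) = phi x + phi y.
Proof. by case: hphi => fl _ _; have := fl 1 x y; rewrite scale1r mul1r. Qed.
Lemma state0 : phi 0 = 0.
Proof. by apply: (addrI (phi 0)); rewrite -stateD !addr0. Qed.
Lemma stateZ l x : phi (l *: x) = l * phi x.
Proof. by case: hphi => fl _ _; have := fl l x 0; rewrite !addr0 state0 addr0. Qed.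
Lemma stateN x : phi (- x) = - phi x.
Proof. by rewrite -scaleN1r stateZ mulN1r. Qed.
Lemma stateB x y : phi (x - y) = phi x - phi y.
Proof. by rewrite stateD stateN. Qed.
Lemma state1 : phi 1 = 1.
Proof. by case: hphi. Qed.
Lemma state_ge0 x : 0 <= phi (star x * x).
Proof. by case: hphi. Qed.
Lemma state_sum (I : Type) (s : seq I) (F : I -> A) :
  phi (\sum_(i <- s) F i) = \sum_(i <- s) phi (F i).
Proof. by elim/big_ind2: _ => //; [exact: state0|move=> x a y b <- <-; exact: stateD]. Qed.

Lemma state_scalar l : phi l%:A = l.
Proof. by rewrite stateZ state1 mulr1. Qed.

End States.

(** For t > [cnorm b] the element t - b is t times the square of a self-adjoint element, so phi (t -
    b) >= 0; both conclusions come from this one inequality. Functionals of any mass are allowed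
    because the restrictions of a state to the summands of a direct sum are not normalised. *)
Lemma positive_bound (R : realType) (A : cstarAlgType R) (phi : A -> R[i]) :
  scalar phi -> (forall a, 0 <= phi (star a * a)) ->
  forall a, sa a -> phi a = (complex.Re (phi a))%:C /\
    `|complex.Re (phi a)| <= cnorm a * complex.Re (phi 1).
Proof.
move=> phil phi_ge0 a saa.
have phiD x y : phi (x + y) = phi x + phi y by have := phil 1 x y; rewrite scale1r mul1r.
have phi0 : phi 0 = 0 by apply: (addrI (phi 0)); rewrite -phiD !addr0.
have phiZ l x : phi (l *: x) = l * phi x.
  by have := phil l x 0; rewrite !addr0 phi0 addr0.
have pos b t : sa b -> cnorm b < t -> 0 <= t%:C * phi 1 - phi b.
  move=> sb bt; have t0 : 0 < t by apply: le_lt_trans bt; exact: cnorm_ge0.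
  have [|y [sy yy _]] := one_sub_sqrt (saZ t^-1 sb).
    by rewrite cnormZr ger0_norm ?invr_ge0 ?ltW // mulrC ltr_pdivrMr // mul1r.
  have := phi_ge0 y; rewrite sy yy -scaleN1r phiD !phiZ mulN1r.
  have tC : 0 < t%:C :> R[i] by rewrite ltcR.
  rewrite -(pmulr_rge0 _ tC) mulrBr mulrA -rmorphM divff ?gt_eqF // rmorph1 mul1r //.
have [p p1] : exists p : R, phi 1 = p%:C.
  have := phi_ge0 1; rewrite star1 mulr1; case: (phi 1) => p q.
  by rewrite lecE /= => /andP[/eqP -> _]; exists p.
have p0 : 0 <= p by have := phi_ge0 1; rewrite star1 mulr1 p1 lecR.
have real b : sa b -> phi b = (complex.Re (phi b))%:C.
  (* A nonnegative element of [R[i]] has zero imaginary part; the added 1 makes the norm inequality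
     strict. *)
  move=> sb; have := pos b (cnorm b + 1) sb; rewrite ltrDl ltr01 => /(_ isT).
  rewrite p1; case: (phi b) => c d; rewrite lecE /= => /andP[+ _].
  rewrite mulr0 mul0r addr0 add0r oppr_eq0 => /eqP -> //.
have key b t : sa b -> cnorm b < t -> complex.Re (phi b) <= t * p.
  move=> sb /(pos _ _ sb); rewrite p1 (real _ sb) -rmorphM -rmorphB /= lecR.
  by rewrite subr_ge0.
split; first exact: real.
have bnd b : sa b -> complex.Re (phi b) <= cnorm b * p.
  (* The mass p may be 0, so the slack is divided by p + 1. *)
  move=> sb; apply/ler_addgt0Pr => e e0; have p10 : 0 < p + 1 by lra.
  have := key b (cnorm b + e / (p + 1)) sb; rewrite ltrDl divr_gt0 // => /(_ isT).
  move=> /le_trans; apply; rewrite mulrDl lerD2l mulrAC ler_pdivrMr //; nra.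
rewrite p1 /= ler_norml; apply/andP; split; last exact: bnd.
have := bnd _ (saN saa); rewrite cnormN -scaleN1r phiZ mulN1r.
by rewrite (real _ saa) -rmorphN /= => h; rewrite lerNl.
Qed.

Section StateBounds.
Variables (R : realType) (A : cstarAlgType R) (phi : A -> R[i]).
Hypothesis hphi : is_state phi.

Lemma state_real a : sa a -> phi a = (complex.Re (phi a))%:C.
Proof. by case: hphi => fl fp _ /(positive_bound fl fp)[]. Qed.

Lemma state_sa_bound a : sa a -> normc (phi a) <= cnorm a.
Proof.
case: hphi => fl fp f1 sa_a; have [-> h] := positive_bound fl fp sa_a.
by rewrite normc_real; apply: le_trans h _; rewrite f1 /= mulr1.
Qed.

Lemma state_star a : phi (star a) = conjc (phi a).
Proof.
have h b : phi b = phi (re_part b) + 'i * phi (im_part b).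
  by rewrite {1}(re_imE b) (stateD hphi) (stateZ hphi 'i).
have -> : star a = re_part a - 'i *: im_part a.
  rewrite {1}(re_imE a) starD (starZ 'i) (sa_re_part a) (sa_im_part a).
  by rewrite -scaleNr; congr (_ + _ *: _); apply/eqP; rewrite eq_complex /= oppr0 !eqxx.
rewrite (stateB hphi) (stateZ hphi 'i) (h a).
rewrite (state_real (sa_re_part a)) (state_real (sa_im_part a)).
apply/eqP; rewrite eq_complex /=; apply/andP; split; apply/eqP; ring.
Qed.

(** Cauchy-Schwarz against the unit: with c = phi a, positivity at a - c bounds the squared modulus
    of c by the value of phi at [star a * a], to which the self-adjoint bound and the C*-identity
    apply. *)
Lemma state_bound a : normc (phi a) <= cnorm a.
Proof.
set c := phi a; have sqC : conjc c * c = (normc c ^+ 2)%:C.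
  by rewrite mulrC -sqr_normc normr_normc rmorphXn.
have saa : sa (star a * a) by rewrite /sa /= starM starK.
have := state_ge0 hphi (a - c%:A).
rewrite starB starZ star1 mulrBl !mulrBr -!scalerAl -!scalerAr !mul1r !mulr1.
rewrite !(stateB hphi) !(stateZ hphi) state_star (state1 hphi) -/c mulr1 subrr subr0.
rewrite (state_real saa) mulrC sqC -rmorphB lecR subr_ge0 => h.
have := state_sa_bound saa; rewrite (state_real saa) normc_real cnorm_star => h'.
rewrite -(ler_pXn2r (ltn0Sn 1)) ?nnegrE ?normc_ge0 ?cnorm_ge0 //.
by apply: le_trans h _; apply: le_trans h'; exact: ler_norm.
Qed.

End StateBounds.

Lemma state_eq_sa (R : realType) (A : cstarAlgType R) (phi psi : A -> R[i]) :
  is_state phi -> is_state psi -> (forall a, sa a -> phi a = psi a) -> phi = psi.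
Proof.
move=> hp hs e; apply/funext => a.
rewrite (re_imE a) (stateD hp) (stateD hs) (stateZ hp 'i) (stateZ hs 'i).
by rewrite !e //; [exact: sa_im_part|exact: sa_re_part].
Qed.

Lemma is_state_comp (R : realType) (A B : cstarAlgType R) (f : A -> B)
  (phi : B -> R[i]) : star_hom f -> is_state phi -> is_state (phi \o f).
Proof.
move=> hf hp; split=> [l x y|a|] /=.
- by rewrite (star_homD hf) (star_homZ hf) (stateD hp) (stateZ hp).
- by rewrite (star_homM hf) (star_hom_star hf); exact: state_ge0.
by rewrite (star_hom1 hf) (state1 hp).
Qed.

Lemma is_state_conv (R : realType) (A : cstarAlgType R) (phi psi : A -> R[i]) (t : R) :
  0 <= t <= 1 -> is_state phi -> is_state psi ->
  is_state (fun a => t%:C * phi a + (1 - t)%:C * psi a).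
Proof.
move=> /andP[t0 t1] hp hs; split=> [l x y|a|] /=.
- rewrite (stateD hp) (stateZ hp) (stateD hs) (stateZ hs) !mulrDr !(mulrCA _ l).
  by rewrite addrACA.
- by rewrite addr_ge0 // mulr_ge0 ?state_ge0 // lecR // subr_ge0.
by rewrite (state1 hp) (state1 hs) !mulr1 -rmorphD subrKC rmorph1.
Qed.

(** * The Monge-Kantorovich metric and the weak* topology *)

Section MongeKantorovich.
Variables (R : realType) (A : cstarAlgType R) (L : A -> \bar R).
Local Open Scope ereal_scope.
Implicit Types phi psi : A -> R[i].

Lemma mk_le phi psi (r : \bar R) :
  (forall a, sa a -> L a <= 1 -> (normc (phi a - psi a)%R)%:E <= r) -> mk L phi psi <= r.
Proof. by move=> h; apply: ge_ereal_sup => _ [a [sa_a La] <-]; exact: h. Qed.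

Lemma mk_ge phi psi a : sa a -> L a <= 1 -> (normc (phi a - psi a)%R)%:E <= mk L phi psi.
Proof. by move=> sa_a La; apply: ereal_sup_ubound; exists a. Qed.

Hypothesis semi : sa_seminorm L.

Lemma seminorm_ge0 a : sa a -> 0 <= L a. Proof. by case: semi => + _ _; exact. Qed.

Lemma seminormZ (t : R) a : sa a -> L (t%:C *: a) = `|t|%:E * L a.
Proof. by case: semi => _ + _; exact. Qed.

Lemma seminormD a b : sa a -> sa b -> L (a + b)%R <= L a + L b.
Proof. by case: semi => _ _; exact. Qed.

Lemma seminorm0 : L 0%R = 0.
Proof.
by have := seminormZ 0 (@sa0 _ A); rewrite scale0r normr0 mul0e.
Qed.

Lemma seminorm_unit_scale a (l : R) : sa a -> (0 < l)%R -> L a <= l%:E ->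
  L (l^-1%:C *: a) <= 1.
Proof.
move=> sa_a l0 La; rewrite seminormZ // ger0_norm ?invr_ge0 ?(ltW l0) //.
apply: (@le_trans _ _ (l^-1%:E * l%:E)).
  by apply: lee_wpmul2l => //; rewrite lee_fin invr_ge0 ltW.
by rewrite -EFinM mulVf ?gt_eqF.
Qed.

Lemma mk_refl phi : mk L phi phi = 0.
Proof.
apply/eqP; rewrite eq_le; apply/andP; split.
  by apply: mk_le => a _ _; rewrite subrr ComplexField.Normc.normc0.
have := @mk_ge phi phi 0%R (@sa0 _ A); rewrite seminorm0 subrr ComplexField.Normc.normc0.
by apply; exact: lee01.
Qed.

Lemma mk_ge0 phi psi : 0 <= mk L phi psi.
Proof.
apply: (@le_trans _ _ (normc (phi 0 - psi 0)%R)%:E); first by rewrite lee_fin normc_ge0.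
by apply: mk_ge; [exact: sa0|rewrite seminorm0 lee01].
Qed.

Lemma mk_scale phi psi a (l r : R) : is_state phi -> is_state psi -> sa a ->
  (0 < l)%R -> L a <= l%:E -> mk L phi psi <= r%:E -> (normc (phi a - psi a) <= l * r)%R.
Proof.
move=> hp hs sa_a l0 La mr.
have := le_trans (mk_ge phi psi (saZ l^-1 sa_a) (seminorm_unit_scale sa_a l0 La)) mr.
rewrite lee_fin (stateZ hp) (stateZ hs) -mulrBr ComplexField.Normc.normcM normc_real.
by rewrite ger0_norm ?invr_ge0 ?(ltW l0) // mulrC ler_pdivrMr // mulrC.
Qed.

End MongeKantorovich.

Lemma ptws_nbhs_eval (I : eqType) (V : topologicalType) (f : I -> V) (a : I) (W : set V) :
  nbhs (f a) W -> nbhs (f : {ptws I -> V}) [set g | W (g a)].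
Proof. exact: (@proj_continuous I (fun=> V) a f W). Qed.

(** The pointwise topology is the initial one for the evaluations, so a filter is compared with the
    neighbourhoods of f one evaluation at a time. *)
Lemma ptws_cvg_sub (I : Type) (V : topologicalType) (f : I -> V)
    (G : set_system (I -> V)) : Filter G ->
  (forall a W, nbhs (f a) W -> G [set g | W (g a)]) -> nbhs (f : {ptws I -> V}) `<=` G.
Proof.
move=> FG Ge; have GP : G --> (f : {ptws I -> V}).
  apply/cvg_sup => a U [/= _ [[W /= oW <- /= Wf]]] /filterS; apply.
  by apply: Ge; exact: open_nbhs_nbhs.
exact: GP.
Qed.

Lemma within_sub (T : Type) (F : set_system T) (D P : set T) :
  Filter F -> F P -> within D F P.
Proof. by move=> FF; apply: filterS. Qed.

Section WeakStar.
Variables (R : realType) (A : cstarAlgType R).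
Implicit Types phi psi : A -> R[i].

Definition wstar phi : set_system (A -> R[i]) :=
  within (@is_state R A) (nbhs (phi : {ptws A -> R[i]^o})).

Global Instance wstar_filter phi : Filter (wstar phi).
Proof. exact: (within_filter _ (nbhs_filter (phi : {ptws A -> R[i]^o}))). Qed.

Lemma wstar_state phi : wstar phi (@is_state R A).
Proof. exact: (withinT _ (nbhs_filter (phi : {ptws A -> R[i]^o}))). Qed.

Lemma wstar_eval phi a (e : R) : 0 < e ->
  \forall psi \near wstar phi, normc (psi a - phi a) < e.
Proof.
move=> e0; have eC : 0 < e%:C :> R[i] by rewrite ltcR.
have near : nbhs (phi : {ptws A -> R[i]^o}) [set psi | ball (phi a : R[i]^o) e%:C (psi a)].
  exact: (ptws_nbhs_eval (nbhsx_ballx (phi a : R[i]^o) _ eC)).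
suff : wstar phi [set psi | normc (psi a - phi a) < e] by [].
apply: within_sub (nbhs_filter (phi : {ptws A -> R[i]^o})) _.
apply: (@filterS _ _ (nbhs_filter (phi : {ptws A -> R[i]^o})) _ _ _ near) => psi.
by rewrite /= /ball /= normr_normc ltcR normcB.
Qed.

(** Universal property of the weak* filter. With a push-forward filter as [G] it becomes a
    continuity criterion; it is applied to mk-balls, to segments of states, to components of states
    on a direct sum, and to extension of states along a retraction. *)
Lemma wstar_sub phi (G : set_system (A -> R[i])) : Filter G ->
  G (@is_state R A) ->
  (forall a (e : R), 0 < e -> G [set psi | normc (psi a - phi a) < e]) ->
  wstar phi `<=` G.
Proof.
move=> FG Gs Ge.
have GP : nbhs (phi : {ptws A -> R[i]^o}) `<=` G.
  apply: ptws_cvg_sub => a W /nbhs_ballP[[e i]].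
  rewrite /= ltcE /= => /andP[/eqP -> e0] eW.
  apply: filterS (Ge a e e0) => psi /= lt; apply: eW.
  by rewrite /ball /= normr_normc normcB ltcR.
move=> U /= /GP GU; apply: filterS2 GU Gs => psi /=; exact.
Qed.

End WeakStar.

Section Metrization.
Variables (R : realType) (A : cstarAlgType R) (L : A -> \bar R).
Implicit Types phi psi : A -> R[i].

Definition mk_ball_filter phi : set_system (A -> R[i]) :=
  [set U | exists2 e : R, 0 < e & forall psi, is_state psi -> (mk L phi psi < e%:E)%E -> U psi].

Lemma mk_ball_filterP phi : Filter (mk_ball_filter phi).
Proof.
split; first by exists 1.
  move=> U V [e e0 eU] [d d0 dV]; exists (Num.min e d); first by rewrite lt_min e0.
  move=> psi hs mlt; split.
    by apply: eU => //; apply: lt_le_trans mlt _; rewrite lee_fin ge_min lexx.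
  by apply: dV => //; apply: lt_le_trans mlt _; rewrite lee_fin ge_min lexx orbT.
by move=> U V UV [e e0 eU]; exists e => // psi hs mlt; apply: UV; exact: eU.
Qed.

Hypotheses (semi : sa_seminorm L) (dense : lip_dom_dense L).

Lemma lip_dom_bound a : (L a < +oo)%E -> exists2 l : R, 0 < l & (L a <= l%:E)%E.
Proof.
case: (L a) => [r| |] // _; last by exists 1; rewrite // leNye.
exists (Num.max 1 r); first by rewrite lt_max ltr01.
by rewrite lee_fin le_max lexx orbT.
Qed.

(** The metric controls values on dom(L); density extends the control to sa(A), and real and
    imaginary parts extend it to A. *)
Lemma wstar_sub_mk_ball phi : is_state phi -> wstar phi `<=` mk_ball_filter phi.
Proof.
move=> hp; have FG := mk_ball_filterP phi; apply: wstar_sub; first by exists 1.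
have main a (e : R) : sa a -> 0 < e -> mk_ball_filter phi [set psi | normc (psi a - phi a) < e].
  move=> sa_a e0; case: dense => _ /(_ a (e / 4) sa_a) [|b [sb /lip_dom_bound[l l0 Lb]] ab].
    by rewrite divr_gt0.
  (* By scaling, this radius makes phi and psi differ by at most e / 4 at b; replacing a by b costs
     another e / 4 for each of the two states. *)
  exists (e / (4 * l)); first by rewrite divr_gt0 // mulr_gt0.
  move=> psi hs /ltW mlt /=.
  have := mk_scale semi hp hs sb l0 Lb mlt.
  have -> : l * (e / (4 * l)) = e / 4 by field; rewrite gt_eqF.
  have := state_sa_bound hp (saB sa_a sb); have := state_sa_bound hs (saB sa_a sb).
  rewrite (stateB hp) (stateB hs) => h1 h2 h3.
  have -> : psi a - phi a = (psi a - psi b) + ((psi b - phi b) + (phi b - phi a)).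
    by rewrite !addrA !subrK.
  have := normcD (psi a - psi b) ((psi b - phi b) + (phi b - phi a)).
  have := normcD (psi b - phi b) (phi b - phi a).
  rewrite (normcB (psi b)) (normcB (phi b)); lra.
move=> a e e0; have e20 : 0 < e / 2 by rewrite divr_gt0.
have h1 := main _ _ (sa_re_part a) e20; have h2 := main _ _ (sa_im_part a) e20.
have hst : mk_ball_filter phi (@is_state R A) by exists 1.
apply: filterS3 h1 h2 hst => psi /= h1 h2 hs.
rewrite (re_imE a) (stateD hs) (stateD hp) (stateZ hs 'i) (stateZ hp 'i).
rewrite opprD addrACA -mulrBr; apply: le_lt_trans (normcD _ _) _.
by rewrite ComplexField.Normc.normcM normc_i mul1r [ltRHS](splitr e) ltrD.
Qed.

(** A state at mk-distance 0 from phi lies in every mk-ball around phi, hence in every weak*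
    neighbourhood, and so equals phi. Of the metrization axiom there remain finiteness of mk and its
    smallness near each state. *)
Lemma mk_metrizesP :
  (forall phi psi, is_state phi -> is_state psi -> (mk L phi psi < +oo)%E) ->
  (forall phi (e : R), is_state phi -> 0 < e ->
     \forall psi \near wstar phi, (mk L phi psi < e%:E)%E) ->
  mk_metrizes_weak_star L.
Proof.
move=> fin near; split => // [phi psi hp hs m0|phi U hp].
  apply: state_eq_sa => // a _; apply/eqP; rewrite -subr_eq0; apply/eqP.
  apply: normc0P; apply/ler_addgt0Pr => e e0; rewrite add0r.
  have [d d0] := wstar_sub_mk_ball hp (wstar_eval phi a e0).
  by move=> /(_ psi hs); rewrite m0 lte_fin => /(_ d0)/ltW; rewrite normcB.
split; first exact: wstar_sub_mk_ball.
case=> e e0 eU; rewrite -/(wstar phi U).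
apply: filterS2 (near phi e hp e0) (wstar_state phi) => psi mlt hs.
exact: eU.
Qed.

End Metrization.

Section LipNormTheory.
Variables (R : realType) (A : cstarAlgType R) (L : A -> \bar R).
Hypothesis hL : lip_norm L.
Implicit Types phi psi : A -> R[i].

Lemma lip_norm_seminorm : sa_seminorm L. Proof. by case: hL. Qed.

Lemma mk_near phi (e : R) : is_state phi -> 0 < e ->
  \forall psi \near wstar phi, (mk L phi psi < e%:E)%E.
Proof. by move=> hp e0; case: hL => _ _ _ [_ _ met] _; apply/(met phi _ hp); exists e. Qed.

Definition segment_filter phi : set_system (A -> R[i]) :=
  [set U | exists2 d : R, 0 < d & forall psi t, is_state psi -> 0 <= t <= 1 -> t < d ->
     U (fun a => t%:C * psi a + (1 - t)%:C * phi a)].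

Lemma segment_filterP phi : Filter (segment_filter phi).
Proof.
split; first by exists 1.
  move=> U V [e e0 eU] [d d0 dV]; exists (Num.min e d); first by rewrite lt_min e0.
  by move=> psi t hs t01; rewrite lt_min => /andP[te td]; split; [exact: eU|exact: dV].
by move=> U V UV [e e0 eU]; exists e => // psi t *; apply: UV; exact: eU.
Qed.

(* The segments (1 - t) phi + t psi tend to phi as t -> 0, uniformly in psi, so
   for small t they all enter the unit mk-ball around phi. *)
Lemma mk_bounded phi : is_state phi -> exists2 K : R, 0 < K &
  forall psi, is_state psi -> (mk L phi psi <= K%:E)%E.
Proof.
move=> hp; have sub : wstar phi `<=` segment_filter phi.
  apply: wstar_sub; first exact: segment_filterP.
    by exists 1 => // psi t hs t01 _; exact: is_state_conv.
  move=> a e e0; have a0 := cnorm_ge0 a.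
  have a1 : 0 < 4 * cnorm a + 1 by lra.
  exists (e / (4 * cnorm a + 1)); first by rewrite divr_gt0.
  move=> psi t hs /andP[t0 t1]; rewrite ltr_pdivlMr // => te /=.
  have -> : t%:C * psi a + (1 - t)%:C * phi a - phi a = t%:C * (psi a - phi a).
    by rewrite rmorphB rmorph1; ring.
  rewrite ComplexField.Normc.normcM normc_real ger0_norm //.
  have := normcD (psi a) (- phi a); rewrite normcN.
  have := state_bound hp a; have := state_bound hs a; nra.
have [d d0 dU] := sub _ (mk_near hp (@ltr01 R)).
pose t := Num.min 1 (d / 2).
have t0 : 0 < t by rewrite lt_min ltr01 divr_gt0.
have t1 : 0 <= t <= 1 by rewrite (ltW t0) ge_min lexx.
have td : t < d by rewrite gt_min; apply/orP; right; lra.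
(* Differences scale by t along the segment, so lying in the unit mk-ball at parameter t bounds t *
   [|phi a - psi a|] by 1. *)
exists t^-1; first by rewrite invr_gt0.
move=> psi hs; apply: mk_le => a sa_a La; rewrite lee_fin.
have := le_lt_trans (mk_ge phi _ sa_a La) (dU psi t hs t1 td).
rewrite lte_fin.
have -> : phi a - (t%:C * psi a + (1 - t)%:C * phi a) = t%:C * (phi a - psi a).
  by rewrite rmorphB rmorph1; ring.
rewrite ComplexField.Normc.normcM normc_real ger0_norm ?(ltW t0) //.
by rewrite -[t^-1]mul1r ler_pdivlMr // mulrC => /ltW.
Qed.

End LipNormTheory.

(** * The Lip-norm of a filtration by conditional expectations *)

Section FiniteDimExpansion.
Variables (R : realType) (A : cstarAlgType R) (mu : A -> R[i]).
Hypotheses (hmu : is_state mu) (mu_faithful : forall a, mu (star a * a) = 0 -> a = 0).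
Implicit Types (u v : seq A) (x y : A).

(** When u is orthonormal for the form mu (star y * x), this is the orthogonal projection onto the
    span of u. Orthonormality is never stated: below, u is characterised by its expansion fixing the
    required elements. *)
Definition mu_expand u x : A := \sum_(w <- u) mu (star w * x) *: w.

Lemma mu_starM x y : mu (star x * y) = conjc (mu (star y * x)).
Proof. by rewrite -(state_star hmu) starM starK. Qed.

Lemma mu_expandD u x y : mu_expand u (x + y) = mu_expand u x + mu_expand u y.
Proof.
rewrite /mu_expand -big_split; apply: eq_bigr => w _ /=.
by rewrite mulrDr (stateD hmu) scalerDl.
Qed.

Lemma mu_expandZ u l x : mu_expand u (l *: x) = l *: mu_expand u x.
Proof.
rewrite /mu_expand scaler_sumr; apply: eq_bigr => w _.
by rewrite -scalerAr (stateZ hmu) scalerA.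
Qed.

Lemma mu_expand_sym u x y : mu (star y * mu_expand u x) = mu (star (mu_expand u y) * x).
Proof.
rewrite (mu_starM (mu_expand u y)) /mu_expand !mulr_sumr !(state_sum hmu) rmorph_sum.
apply: eq_bigr => w _; rewrite -!scalerAr !(stateZ hmu) rmorphM /= -!mu_starM mulrC //.
Qed.

(* Gram-Schmidt for <y, x> = mu (y^* x). *)
Lemma mu_basis v : exists u, (forall w, w \in u -> mu_expand u w = w) /\
  (forall x, x \in v -> mu_expand u x = x).
Proof.
elim: v => [|x v [u [uu uv]]]; first by exists [::].
set r := x - mu_expand u x.
(* Symmetry of the expansion, together with its fixing u, does the work of the orthonormality
   relations. *)
have ur w : w \in u -> mu (star w * r) = 0.
  by move=> wu; rewrite mulrBr (stateB hmu) mu_expand_sym uu // subrr.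
have expand_r : mu_expand u r = 0.
  by rewrite /mu_expand big_seq big1 // => w wu; rewrite ur // scale0r.
have [r0|r0] := eqVneq r 0.
  exists u; split=> // y; rewrite inE => /predU1P[->|]; last exact: uv.
  by apply/eqP; rewrite eq_sym -subr_eq0; exact/eqP.
have : 0 <= mu (star r * r) := state_ge0 hmu _.
have : mu (star r * r) != 0 by apply: contra_neq r0 => /mu_faithful.
case Ep : (mu (star r * r)) => [p q] p0; rewrite lecE /= => /andP[/eqP q0 p_ge0].
have p_gt0 : 0 < p.
  by rewrite lt_def p_ge0 andbT; apply: contra_neq p0 => ->; rewrite q0.
have {q0}{}Ep : mu (star r * r) = p%:C by rewrite Ep q0.
pose s := Num.sqrt p; have s0 : 0 < s by rewrite sqrtr_gt0.
pose r' := s^-1%:C *: r; have rE : r = s%:C *: r'.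
  by rewrite /r' scalerA -rmorphM divff ?gt_eqF // scale1r.
have ur' w : w \in u -> mu (star w * r') = 0.
  by move=> wu; rewrite -scalerAr (stateZ hmu) ur // mulr0.
have r'u w : w \in u -> mu (star r' * w) = 0.
  by move=> wu; rewrite mu_starM ur' // rmorph0.
have r'r' : mu (star r' * r') = 1.
  rewrite starZ conjc_real -scalerAl -scalerAr scalerA (stateZ hmu) Ep -!rmorphM.
  by rewrite -expr2 exprVn sqr_sqrtr // mulVf ?gt_eqF.
have newE y : mu_expand (r' :: u) y = mu (star r' * y) *: r' + mu_expand u y.
  by rewrite /mu_expand big_cons.
have r'x y : mu (star r' * mu_expand u y) = 0.
  rewrite mu_expand_sym /r' mu_expandZ expand_r scaler0 star0 mul0r.
  exact: state0.
exists (r' :: u); split=> y; rewrite inE newE => /predU1P[->|yu].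
- by rewrite r'r' scale1r /r' mu_expandZ expand_r scaler0 addr0.
- by rewrite r'u // scale0r add0r uu.
- have xE : x = r + mu_expand u x by rewrite subrK.
  rewrite {1}xE mulrDr (stateD hmu) r'x addr0 rE -scalerAr (stateZ hmu) r'r' mulr1 -rE.
  by rewrite -xE.
- by rewrite -{1}(uv _ yu) r'x scale0r add0r uv.
Qed.

(** The coordinates mu (star w * x) are bounded by [cnorm w * cnorm x], so two states close on the
    finite list u are uniformly close on bounded parts of B. *)
Lemma finite_dim_expand (B : cstar_subalg A) : finite_dim B ->
  exists u, forall x, x \in B -> mu_expand u x = x.
Proof.
case=> k [v vB]; have [u [_ uv]] := mu_basis [seq v i | i <- enum 'I_k].
exists u => x /vB[c ->]; elim/big_ind: _ => [|y z yE zE|i _].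
- by rewrite -(scale0r 0) mu_expandZ !scale0r.
- by rewrite mu_expandD yE zE.
- by rewrite mu_expandZ uv // map_f // mem_enum.
Qed.

End FiniteDimExpansion.

Section ExpectationLipNorm.
Variables (R : realType) (A : cstarAlgType R) (An : nat -> cstar_subalg A).
Hypothesis hAn : af_filtration An.
Variable mu : A -> R[i].
Hypothesis hmu : faithful_tracial_state mu.
Variable beta : nat -> R.
Hypotheses (beta_gt0 : forall n, 0 < beta n) (beta_summable : cvgn (series beta)).
Variable E : forall n, A -> csub (An n).
Hypotheses (E_cond : forall n, cond_exp (E n)).
Hypothesis (E_mu : forall n a, mu (val (E n a)) = mu a).
Local Notation F n a := (val (E n a)).
Local Notation L := (lip_state beta E).

Let mu_state : is_state mu. Proof. by case: hmu. Qed.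
Let mu_faithful a : mu (star a * a) = 0 -> a = 0.
Proof. by case: hmu => _ _; exact. Qed.

Lemma cexpD n x y : F n (x + y) = F n x + F n y.
Proof. by case: (E_cond n) => El _ _ _; have := El 1 x y; rewrite !scale1r => ->. Qed.
Lemma cexp0 n : F n 0 = 0.
Proof. by apply: (addrI (F n 0)); rewrite -cexpD !addr0. Qed.
Lemma cexpZ n l x : F n (l *: x) = l *: F n x.
Proof.
have E0 : E n 0 = 0 by apply: val_inj; rewrite cexp0.
by case: (E_cond n) => El _ _ _; have := El l x 0; rewrite !addr0 E0 addr0 => ->.
Qed.
Lemma cexpN n x : F n (- x) = - F n x.
Proof. by rewrite -scaleN1r cexpZ scaleN1r. Qed.
Lemma cexpB n x y : F n (x - y) = F n x - F n y.
Proof. by rewrite cexpD cexpN. Qed.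
Lemma cexp_norm n x : cnorm (F n x) <= cnorm x.
Proof. by case: (E_cond n) => _ + _ _; exact. Qed.
Lemma cexp_in n x : F n x \in An n. Proof. exact: csub_valP. Qed.

Lemma filtration_le m n : (m <= n)%N -> {subset An m <= An n}.
Proof.
case: hAn => Am _ _ _; elim: n => [|n IH]; first by rewrite leqn0 => /eqP ->.
by rewrite leq_eqVlt ltnS => /predU1P[-> //|/IH mn x /mn/Am].
Qed.

Lemma cexp_id n x : x \in An n -> F n x = x.
Proof.
by move=> xn; case: (E_cond n) => _ _ _ [_ /(_ (CSub xn)) + _]; move=> /(congr1 val).
Qed.

Lemma cexp_id_le m n x : (m <= n)%N -> x \in An m -> F n x = x.
Proof. by move=> /filtration_le mn /mn; exact: cexp_id. Qed.

Lemma subalgD n x y : x \in An n -> y \in An n -> x + y \in An n.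
Proof. by move=> xn yn; exact: (csub_valP (CSub xn + CSub yn)). Qed.
Lemma subalgB n x y : x \in An n -> y \in An n -> x - y \in An n.
Proof. by move=> xn yn; exact: (csub_valP (CSub xn - CSub yn)). Qed.
Lemma subalgM n x y : x \in An n -> y \in An n -> x * y \in An n.
Proof. by move=> xn yn; exact: (csub_valP (CSub xn * CSub yn)). Qed.
Lemma subalgZ n l x : x \in An n -> l *: x \in An n.
Proof. by move=> xn; exact: (csub_valP (l *: CSub xn)). Qed.
Lemma subalg1 n : 1 \in An n.
Proof. exact: (csub_valP (1 : csub (An n))). Qed.

Lemma cexp_modl n b x : b \in An n -> F n (b * x) = b * F n x.
Proof.
move=> bn; case: (E_cond n) => _ _ _ [_ _ /(_ (CSub bn) 1 x)].
by rewrite !mulr1 => /(congr1 val).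
Qed.

Lemma mu_cexp n b x : b \in An n -> mu (b * F n x) = mu (b * x).
Proof. by move=> bn; rewrite -cexp_modl // E_mu. Qed.

(** Faithfulness, tested at b = star (x - y). With [mu_cexp] it determines E_n x inside A_n by the
    numbers mu (b * x), from which the tower property and compatibility with the involution
    follow. *)
Lemma mu_separates n x y : x \in An n -> y \in An n ->
  (forall b, b \in An n -> mu (b * x) = mu (b * y)) -> x = y.
Proof.
move=> xn yn xy; apply/eqP; rewrite -subr_eq0; apply/eqP/mu_faithful.
rewrite mulrBr (stateB mu_state) xy ?subrr //.
by apply: subalg_star; exact: subalgB.
Qed.

Lemma cexp_comp m n x : (m <= n)%N -> F m (F n x) = F m x.
Proof.
move=> mn; apply: (@mu_separates m); [exact: cexp_in..|move=> b bm].
by rewrite !mu_cexp //; exact: filtration_le bm.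
Qed.

Lemma cexp_star n x : F n (star x) = star (F n x).
Proof.
have mu_tr a b : mu (a * b) = mu (b * a) by case: hmu.
apply: (@mu_separates n); [exact: cexp_in|exact: subalg_star (cexp_in _ _)|move=> b bn].
have sbn : star b \in An n by exact: subalg_star.
(* Traciality brings [star b] back to the left, where [mu_cexp] applies. *)
rewrite mu_cexp // -{1 2}(starK b) -!starM !(state_star mu_state).
by rewrite !(mu_tr _ (star b)) mu_cexp.
Qed.

Lemma cexp_sa n x : sa x -> sa (F n x).
Proof. by rewrite /sa /= -cexp_star => ->. Qed.

Lemma cexp_scalar x : exists c : R[i], F 0 x = c%:A.
Proof. by case: hAn => _ _ /(_ (F 0 x)) + _ => /iffLR; apply; exact: cexp_in. Qed.

Lemma cexp_cvg x : ctends (fun n => F n x) x.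
Proof.
apply/ctendsP => e e0; case: hAn => _ _ _ /(_ x (e / 2)) [|N [b bN xb]].
  by rewrite divr_gt0.
exists N => n Nn; apply: le_lt_trans (cnorm_trans b _ _) _.
rewrite -{1}(cexp_id_le Nn bN) -cexpB (splitr e) ltrD //.
  by apply: le_lt_trans xb; exact: cexp_norm.
by rewrite cnormB.
Qed.

Lemma lip_state_ge n x (r : R) : (L x <= r%:E)%E -> cnorm (x - F n x) <= r * beta n.
Proof.
move=> Lx; have : ((cnorm (x - F n x) / beta n)%:E <= L x)%E.
  by apply: ereal_sup_ubound; exists n.
by move=> /le_trans/(_ Lx); rewrite lee_fin ler_pdivrMr.
Qed.

Lemma lip_state_le x (r : R) : (forall n, cnorm (x - F n x) <= r * beta n) -> (L x <= r%:E)%E.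
Proof.
by move=> h; apply: ge_ereal_sup => _ [n _ <-]; rewrite lee_fin ler_pdivrMr.
Qed.

Lemma lip_state_lt x (r : \bar R) : (r < L x)%E ->
  exists n, (r < (cnorm (x - F n x) / beta n)%:E)%E.
Proof. by move=> /ereal_sup_gt[_ [n _ <-]] rn; exists n. Qed.

Lemma lip_state_term n x : ((cnorm (x - F n x) / beta n)%:E <= L x)%E.
Proof. by apply: ereal_sup_ubound; exists n. Qed.

Lemma lip_state_ge0 x : (0 <= L x)%E.
Proof.
apply: le_trans (lip_state_term 0 x).
by rewrite lee_fin divr_ge0 ?cnorm_ge0 // ltW.
Qed.

(** Terms of index at least n vanish because E_k fixes x there; the sum of the finitely many others
    bounds the supremum. *)
Lemma lip_state_fin n x : x \in An n -> (L x < +oo)%E.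
Proof.
move=> xn; pose c := \sum_(k < n) cnorm (x - F k x) / beta k.
apply: (@le_lt_trans _ _ c%:E); last exact: ltry.
have c0 k : 0 <= cnorm (x - F k x) / beta k by rewrite divr_ge0 ?cnorm_ge0 // ltW.
apply: lip_state_le => k; rewrite -ler_pdivrMr //.
have [kn|nk] := ltnP k n.
  by rewrite /c (bigD1 (Ordinal kn)) //= lerDl sumr_ge0 // => i _; exact: c0.
by rewrite (cexp_id_le nk xn) subrr cnorm0 mul0r sumr_ge0 // => i _; exact: c0.
Qed.

Lemma lip_stateZ l x : L (l *: x) = ((normc l)%:E * L x)%E.
Proof.
rewrite /lip_state -ereal_supZl; last 2 first.
- by apply/set0P; exists (cnorm (x - F 0 x) / beta 0)%:E; exists 0%N.
- exact: normc_ge0.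
congr ereal_sup; apply/seteqP; split=> [_ [n _ <-]|_ [_ [n _ <-] <-]].
  exists (cnorm (x - F n x) / beta n)%:E; first by exists n.
  by rewrite cexpZ -scalerBr cnormZ -EFinM mulrA.
by exists n => //; rewrite cexpZ -scalerBr cnormZ -EFinM mulrA.
Qed.

Lemma lip_stateD x y : (L (x + y)%R <= L x + L y)%E.
Proof.
apply: ge_ereal_sup => _ [n _ <-].
apply: le_trans (leeD (lip_state_term n x) (lip_state_term n y)).
rewrite -EFinD lee_fin -mulrDl ler_pM2r ?invr_gt0 // cexpD opprD addrACA.
exact: cnormD.
Qed.

Lemma lip_state_seminorm : sa_seminorm L.
Proof.
split=> [x _|t x _|x y _ _]; [exact: lip_state_ge0| |exact: lip_stateD].
by rewrite lip_stateZ normc_real.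
Qed.

Lemma lip_state_dense : lip_dom_dense L.
Proof.
split=> [|a e sa_a e0]; first by split; [exact: sa1|apply: (@lip_state_fin 0); exact: subalg1].
case: hAn => _ _ _ /(_ a e e0)[n [b bn ab]].
have rbn : re_part b \in An n by apply/subalgZ/subalgD => //; exact: subalg_star.
exists (re_part b); first by split; [exact: sa_re_part|exact: lip_state_fin rbn].
apply: le_lt_trans ab; rewrite -{1}(re_part_sa sa_a) /re_part -scalerBr opprD addrACA -starB.
exact: cnorm_re_part.
Qed.

Lemma lip_state_eq0 a : sa a -> (L a = 0 <-> exists t : R, a = (t%:C)%:A).
Proof.
move=> sa_a; split=> [La0|[t ->]].
  have : cnorm (a - F 0 a) <= 0 * beta 0%N by apply: lip_state_ge; rewrite La0.
  rewrite mul0r => /cnorm_eq0P/eqP; rewrite subr_eq0 => /eqP aE.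
  have [c cE] := cexp_scalar a; exists (complex.Re c).
  have cR : c = (complex.Re c)%:C by apply: (@sa_scalarP _ A); rewrite -cE -aE.
  by rewrite -cR -cE.
apply/eqP; rewrite eq_le lip_state_ge0 andbT; apply: lip_state_le => n.
by rewrite cexp_id ?subrr ?cnorm0 ?mul0r //; apply/subalgZ/subalg1.
Qed.

Lemma sub_cexp_le n x : cnorm (x - F n x) <= 2 * cnorm x.
Proof.
apply: le_trans (cnorm_sub _ _) _; rewrite mulr2n mulrDl mul1r lerD2l.
exact: cexp_norm.
Qed.

Lemma lip_state_lsc : sa_lower_semicontinuous L.
Proof.
move=> a r sa_a /lip_state_lt[n]; rewrite lte_fin ltr_pdivlMr // => rn.
(* The map x |-> x - E_n x has norm at most 2, so half of the gap is a safe radius. *)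
exists ((cnorm (a - F n a) - r * beta n) / 2); first by rewrite divr_gt0 // subr_gt0.
move=> b sb ab; apply: lt_le_trans (lip_state_term n b).
rewrite lte_fin ltr_pdivlMr //.
have -> : b - F n b = (b - a - F n (b - a)) + (a - F n a).
  by rewrite cexpB opprB [RHS]addrACA subrK (addrAC (F n a)) subrr add0r.
have := cnorm_sub ((b - a - F n (b - a)) + (a - F n a)) (b - a - F n (b - a)).
rewrite addrAC subrr add0r; have := sub_cexp_le n (b - a); lra.
Qed.

(** E_n fixes the product of E_n x and E_n y, so x y may be replaced by its difference d from that
    product. The factor 2 bounds d - E_n d by d, and it is the constant of the (2,0)-quasi-Leibniz
    inequality. *)
Lemma cexp_leibniz n x y :
  cnorm (x * y - F n (x * y)) <=
    2 * (cnorm x * cnorm (y - F n y) + cnorm y * cnorm (x - F n x)).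
Proof.
pose d := x * y - F n x * F n y.
have Fxy : F n (F n x * F n y) = F n x * F n y.
  by apply/cexp_id/subalgM; exact: cexp_in.
have -> : x * y - F n (x * y) = d - F n d.
  by rewrite /d cexpB Fxy opprB addrA subrK.
apply: le_trans (sub_cexp_le _ _) _; rewrite ler_pM2l //.
have -> : d = x * (y - F n y) + (x - F n x) * F n y.
  by rewrite mulrBr mulrBl addrA subrK.
apply: le_trans (cnormD _ _) _; apply: lerD; first exact: cnormM.
apply: le_trans (cnormM _ _) _; rewrite mulrC ler_wpM2r ?cnorm_ge0 //.
exact: cexp_norm.
Qed.

Lemma lip_state_leibniz : quasi_leibniz L.
Proof.
have fin x : lip_dom L x -> exists2 p : R, L x = p%:E & 0 <= p.
  move=> [_]; have := lip_state_ge0 x; case: (L x) => // p; rewrite lee_fin => p0 _.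
  by exists p.
move=> x y /fin[p Lx p0] /fin[q Ly q0]; rewrite Lx Ly.
rewrite -EFinM.
pose r := 2 * (cnorm x * q + cnorm y * p); rewrite -/r.
have prod n : cnorm (x * y - F n (x * y)) <= r * beta n /\
    cnorm (y * x - F n (y * x)) <= r * beta n.
  have hx : cnorm (x - F n x) <= p * beta n by apply: lip_state_ge; rewrite Lx.
  have hy : cnorm (y - F n y) <= q * beta n by apply: lip_state_ge; rewrite Ly.
  have hx' := ler_wpM2l (cnorm_ge0 y) hx; have hy' := ler_wpM2l (cnorm_ge0 x) hy.
  by split; apply: le_trans (cexp_leibniz _ _ _) _; rewrite /r; lra.
rewrite ge_max; apply/andP; split; apply: lip_state_le => n; have [h1 h2] := prod n.
  rewrite cexpZ -scalerBr cnorm_half cexpD opprD addrACA.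
  have := cnormD (x * y - F n (x * y)) (y * x - F n (y * x)); lra.
rewrite cexpZ -scalerBr cnormZ normc_half_i cexpB (opprD (F n (x * y))) addrACA -opprD.
have := cnorm_sub (x * y - F n (x * y)) (y * x - F n (y * x)); lra.
Qed.

Lemma state_cexp_diff n phi psi a : is_state phi -> is_state psi -> sa a -> (L a <= 1)%E ->
  normc ((phi a - psi a) - (phi (F n a) - psi (F n a))) <= 2 * beta n.
Proof.
move=> hp hs sa_a La; have an := lip_state_ge n La; rewrite mul1r in an.
have sd : sa (a - F n a) by apply: saB => //; exact: cexp_sa.
have := state_sa_bound hp sd; have := state_sa_bound hs sd.
rewrite (stateB hp) (stateB hs) => h1 h2.
have -> : phi a - psi a - (phi (F n a) - psi (F n a)) =
          (phi a - phi (F n a)) - (psi a - psi (F n a)) by ring.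
have := normcD (phi a - phi (F n a)) (- (psi a - psi (F n a))); rewrite normcN; lra.
Qed.

Lemma state_cexp0 phi psi a : is_state phi -> is_state psi -> phi (F 0 a) = psi (F 0 a).
Proof. by move=> hp hs; have [c ->] := cexp_scalar a; rewrite !state_scalar. Qed.

Lemma beta_cvg0 : beta @ \oo --> (0 : R).
Proof. exact: cvg_series_cvg_0. Qed.

(* Up to 2 beta(N) the states only see F N a, which lies in a bounded part of a
   finite-dimensional space. *)
Lemma lip_state_near phi (e : R) : is_state phi -> 0 < e ->
  \forall psi \near wstar phi, (mk L phi psi < e%:E)%E.
Proof.
move=> hp e0.
(* Replacing a by E_N a costs 2 beta(N) < e / 4; the finite-dimensional part below is given another
   e / 4, for a total of e / 2. *)
have [N bN] : exists N, beta N < e / 8.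
  have /cvgrPdist_lt/(_ (e / 8)) := beta_cvg0; rewrite divr_gt0 // => /(_ isT)[N _ hN].
  by exists N; have := hN N (leqnn N); rewrite /= sub0r normrN ger0_norm // ltW.
have [u uE] : exists u, forall x, x \in An N -> mu_expand mu u x = x.
  by apply: finite_dim_expand => //; case: hAn.
pose b0 := beta 0%N.
(* A positive bound for the coordinate mu (star x * y) when y has norm at most beta(0). The
   tolerance [d] is divided by it and by the length of u plus 1, so that an empty u causes no
   division by 0. *)
pose w (x : A) := cnorm x * b0 + 1.
have w0 x : 0 < w x.
  have b0_ge0 : 0 <= b0 by exact: ltW (beta_gt0 _).
  by apply: ltr_wpDl => //; rewrite mulr_ge0 ?cnorm_ge0.
pose d x := e / 4 / (size u).+1%:R / w x.
have d0 x : 0 < d x by rewrite !divr_gt0.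
have near_u : \forall psi \near wstar phi,
    forall i : 'I_(size u), normc (psi u`_i - phi u`_i) < d u`_i.
  by apply: filter_forall => i; exact: wstar_eval.
apply: filterS2 near_u (wstar_state phi) => psi near_u hs.
apply: (@le_lt_trans _ _ (e / 2)%:E); last by rewrite lte_fin; lra.
apply: mk_le => a sa_a La; rewrite lee_fin.
(* Subtracting the scalar E_0 a does not change differences of states, and leaves E_N (a - E_0 a),
   of norm at most beta(0). *)
pose x := F N a - F 0 a.
have xN : x \in An N.
  by apply: subalgB; [exact: cexp_in|apply: (filtration_le (leq0n N)); exact: cexp_in].
have xb : cnorm x <= b0.
  rewrite /x -(cexp_id_le (leq0n N) (cexp_in 0 a)) -cexpB.
  by apply: le_trans (cexp_norm _ _) _; have := lip_state_ge 0 La; rewrite mul1r.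
have diff : phi (F N a) - psi (F N a) = phi x - psi x.
  rewrite /x (stateB hp) (stateB hs) (state_cexp0 _ hp hs); ring.
clearbody x.
have := state_cexp_diff N hp hs sa_a La; rewrite diff.
suff : normc (phi x - psi x) <= e / 4.
  have := normcD (phi a - psi a - (phi x - psi x)) (phi x - psi x).
  rewrite subrK; lra.
have -> : phi x - psi x = \sum_(i < size u) mu (star u`_i * x) * (phi u`_i - psi u`_i).
  rewrite -{1 2}(uE _ xN) /mu_expand (state_sum hp) (state_sum hs) -sumrB (big_nth 0) big_mkord.
  by apply: eq_bigr => i _; rewrite (stateZ hp) (stateZ hs) mulrBr.
have normc_sum (I : Type) (r : seq I) (G : I -> R[i]) :
    normc (\sum_(i <- r) G i) <= \sum_(i <- r) normc (G i).
  elim/big_ind2: _ => //; first by rewrite ComplexField.Normc.normc0.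
  by move=> y1 y2 z1 z2 h1 h2; apply: le_trans (normcD _ _) _; exact: lerD.
apply: le_trans (normc_sum _ _ _) _.
apply: (@le_trans _ _ (\sum_(i < size u) e / 4 / (size u).+1%:R)); last first.
  have : 0 <= e / 4 by rewrite divr_ge0 // ltW.
  rewrite sumr_const card_ord; move: (e / 4) => c c0.
  by rewrite -[leLHS]mulr_natr -mulrA ler_piMr // ler_pdivrMl // mulr1 ler_nat.
apply: ler_sum => i _; rewrite ComplexField.Normc.normcM normcB.
have dE : d u`_i * w u`_i = e / 4 / (size u).+1%:R by rewrite /d divfK // gt_eqF.
rewrite -dE mulrC; apply: ler_pM; rewrite ?normc_ge0 //; first exact/ltW/near_u.
apply: le_trans (state_bound mu_state _) _; apply: le_trans (cnormM _ _) _.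
rewrite norm_star /w; have := ler_wpM2l (cnorm_ge0 u`_i) xb; lra.
Qed.

Lemma lip_state_metrizes : mk_metrizes_weak_star L.
Proof.
apply: (mk_metrizesP lip_state_seminorm lip_state_dense); last exact: lip_state_near.
move=> phi psi hp hs; apply: (@le_lt_trans _ _ (2 * beta 0%N)%:E); last exact: ltry.
apply: mk_le => a sa_a La; rewrite lee_fin.
have := state_cexp_diff 0 hp hs sa_a La.
by rewrite (state_cexp0 _ hp hs) subrr subr0.
Qed.

Lemma lip_state_lip_norm : lip_norm L.
Proof.
split; [exact: lip_state_seminorm|exact: lip_state_dense|exact: lip_state_eq0|
  exact: lip_state_metrizes|exact: lip_state_lsc].
Qed.

Lemma lip_state_qleibniz : qleibniz_lip_norm L.
Proof. by split; [exact: lip_state_lip_norm|exact: lip_state_leibniz]. Qed.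

End ExpectationLipNorm.

(** * Lip-norms on direct sums *)

Section PositiveFunctionals.
Variables (R : realType) (A : cstarAlgType R).

(** Dividing by the mass works when it is positive. A positive functional of mass 0 vanishes, and
    [theta] is then the state returned. *)
Lemma positive_normalize (f : A -> R[i]) (theta : A -> R[i]) :
  is_state theta -> scalar f -> (forall a, 0 <= f (star a * a)) ->
  exists2 phi, is_state phi & forall a, f a = (complex.Re (f 1))%:C * phi a.
Proof.
move=> htheta fl fp; set p := complex.Re (f 1).
have f1 : f 1 = p%:C by have [] := positive_bound fl fp (@sa1 _ A).
have p0 : 0 <= p by have := fp 1; rewrite star1 mulr1 f1 lecR.
have fD x y : f (x + y) = f x + f y by have := fl 1 x y; rewrite scale1r mul1r.
have f0 : f 0 = 0 by apply: (addrI (f 0)); rewrite -fD !addr0.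
have fZ l x : f (l *: x) = l * f x by have := fl l x 0; rewrite !addr0 f0 addr0.
have [pE|p_neq0] := eqVneq p 0.
  exists theta => // a; rewrite pE mul0r (re_imE a) fD (fZ 'i).
  have zero b : sa b -> f b = 0.
    move=> sb; have [-> ] := positive_bound fl fp sb.
    by rewrite -/p pE mulr0 normr_le0 => /eqP ->.
  by rewrite !zero ?mulr0 ?addr0 //; [exact: sa_im_part|exact: sa_re_part].
have pC : p%:C != 0 :> R[i] by rewrite eq_complex /= eqxx andbT.
exists (fun a => p%:C^-1 * f a) => [|a]; last by rewrite mulrA divff // mul1r.
split=> [l x y|a|]; last by rewrite f1 mulVf.
  by rewrite fD fZ mulrDr mulrCA.
by rewrite mulr_ge0 // invr_ge0 lecR.
Qed.

End PositiveFunctionals.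

Section StateSum.
Variables (R : realType) (A1 A2 : cstarAlgType R).
Local Notation A12 := (A1 * A2)%type.
Implicit Types z : A12.

Lemma sum_sa z : sa z <-> sa z.1 /\ sa z.2.
Proof. by case: z => a b; split=> [[]|[ea eb]] //; exact: (congr2 pair ea eb). Qed.

Lemma sum_norm1 z : cnorm z.1 <= cnorm z.
Proof. by rewrite le_max lexx. Qed.
Lemma sum_norm2 z : cnorm z.2 <= cnorm z.
Proof. by rewrite le_max lexx orbT. Qed.

Variables (theta1 : A1 -> R[i]) (theta2 : A2 -> R[i]).
Hypotheses (htheta1 : is_state theta1) (htheta2 : is_state theta2).

(** The restrictions of Phi to the two summands are positive functionals whose masses add up to Phi
    1 = 1; the reference states cover the case of a vanishing mass. *)
Lemma state_sum_decomp (Phi : A12 -> R[i]) : is_state Phi ->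
  exists (t : R) (phi1 : A1 -> R[i]) (phi2 : A2 -> R[i]),
    [/\ 0 <= t <= 1, is_state phi1, is_state phi2,
        forall a, Phi (a, 0) = t%:C * phi1 a
      & forall b, Phi (0, b) = (1 - t)%:C * phi2 b].
Proof.
move=> hPhi.
have pairD (x y : A1) (x' y' : A2) : ((x, x') : A12) + (y, y') = (x + y, x' + y') by [].
have [|a|phi1 h1 E1] := @positive_normalize _ _ (fun a => Phi (a, 0)) _ htheta1.
- move=> l x y; rewrite -(stateZ hPhi) -(stateD hPhi); congr Phi.
  by rewrite -[RHS]/(l *: x + y, l *: 0 + 0) scaler0 addr0.
- have := state_ge0 hPhi (a, 0).
  by congr (0 <= Phi _); congr pair; rewrite /= star0 mulr0.
have [|a|phi2 h2 E2] := @positive_normalize _ _ (fun b => Phi (0, b)) _ htheta2.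
- move=> l x y; rewrite -(stateZ hPhi) -(stateD hPhi); congr Phi.
  by rewrite -[RHS]/(l *: 0 + 0, l *: x + y) scaler0 addr0.
- have := state_ge0 hPhi (0, a).
  by congr (0 <= Phi _); congr pair; rewrite /= star0 mulr0.
move: E1 E2; set t := complex.Re (Phi (1, 0)); set s := complex.Re (Phi (0, 1)) => E1 E2.
have st : s = 1 - t.
  have : Phi (1, 0) + Phi (0, 1) = 1.
    by rewrite -(stateD hPhi) pairD addr0 add0r (state1 hPhi).
  rewrite /s /t; case: (Phi (1, 0)) (Phi (0, 1)) => [a b] [c d] /eqP.
  by rewrite eq_complex /= => /andP[/eqP <- _]; rewrite addrC addKr.
have p0 (phi : A12) : star phi * phi = phi -> 0 <= complex.Re (Phi phi).
  by move=> e; have := state_ge0 hPhi phi; rewrite e lecE => /andP[].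
exists t, phi1, phi2; split=> //; last by rewrite -st.
apply/andP; split.
  by apply: p0; rewrite -[LHS]/(star 1 * 1, star 0 * 0) star1 star0 mulr1 mulr0.
rewrite -subr_ge0 -st.
by apply: p0; rewrite -[LHS]/(star 0 * 0, star 1 * 1) star1 star0 mulr1 mulr0.
Qed.

Lemma state_pair (Phi : A12 -> R[i]) z : is_state Phi ->
  Phi z = Phi (z.1, 0) + Phi (0, z.2).
Proof.
move=> hPhi; rewrite -(stateD hPhi); congr Phi.
by case: z => a b /=; congr pair; rewrite /= ?addr0 ?add0r.
Qed.

End StateSum.

(** * Continuity of the components of a state on a direct sum *)

Section ComponentContinuity.
Variables (R : realType) (A F : cstarAlgType R) (j : A -> F) (L : A -> \bar R).
Hypothesis hL : lip_norm L.
Variables (Phi : F -> R[i]) (t : R) (phi : A -> R[i]).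
Hypotheses (t0 : 0 <= t) (hphi : is_state phi).
Hypothesis PhiE : forall a, Phi (j a) = t%:C * phi a.

(** Push-forward of the neighbourhoods of Phi along Psi |-> psi. It is quantified over all
    admissible pairs (s, psi) because a component is not determined by Psi when its mass is 0. *)
Definition component_filter : set_system (A -> R[i]) :=
  [set U | \forall Psi \near wstar Phi, forall (s : R) (psi : A -> R[i]), is_state psi ->
     (forall a, Psi (j a) = s%:C * psi a) -> U psi].

Lemma component_filterP : Filter component_filter.
Proof.
split; rewrite /component_filter /=.
- exact: nearW.
- move=> U V nU nV; apply: (@filterS2 _ (wstar Phi) _ _ _ _ _ nU nV) => Psi hU hV s psi hpsi e.
  by split; [exact: hU e|exact: hV e].
- by move=> U V UV; apply: (@filterS _ (wstar Phi)) => Psi hU s psi hpsi e; apply: UV; exact: hU e.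
Qed.

(** The normalised component is a quotient of values of Psi, hence continuous while the mass t is
    positive; the weight t in the conclusion lets t = 0 be included. The map [j] stands for an
    inclusion a |-> (a, 0) or b |-> (0, b). *)
Lemma component_near (e : R) : 0 < e ->
  \forall Psi \near wstar Phi, forall (s : R) (psi : A -> R[i]), is_state psi ->
     (forall a, Psi (j a) = s%:C * psi a) ->
  forall a, sa a -> (L a <= 1)%E -> t * normc (phi a - psi a) <= e.
Proof.
move=> e0; have [->|t_neq0] := eqVneq t 0.
  by apply: nearW => Psi s psi *; rewrite mul0r ltW.
have {t_neq0}tp : 0 < t by rewrite lt_def t_neq0.
have sub : wstar phi `<=` component_filter.
  apply: wstar_sub; first exact: component_filterP.
    by rewrite /component_filter /=; apply: nearW.
  move=> a e' e'0; set m := normc (phi a).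
  have m0 : 0 <= m := normc_ge0 _.
  (* Evaluation at [j 1] reads off the mass. The first bound keeps s above t / 2; the second makes
     the change of mass contribute at most e' t / 8. In total s times the difference is at most e' t
     / 4, and dividing by s leaves less than e'. *)
  pose d := Num.min (t / 2) (e' * t / (8 * (m + 1))).
  have d0 : 0 < d by rewrite lt_min !divr_gt0 ?mulr_gt0 //; lra.
  have et0 : 0 < e' * t / 8 by rewrite divr_gt0 // mulr_gt0.
  apply: filterS2 (wstar_eval Phi (j a) et0) (wstar_eval Phi (j 1) d0) => Psi.
  rewrite !PhiE (state1 hphi) mulr1 => h1 h2 s psi hpsi PsiE.
  move: h1 h2; rewrite !PsiE (state1 hpsi) mulr1 -rmorphB normc_real => h1 h2.
  move: h2; rewrite lt_min => /andP[h2 h3].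
  have s2 : t / 2 < s by move: h2; rewrite ltr_norml => /andP[]; lra.
  have : s%:C * (psi a - phi a) = (s%:C * psi a - t%:C * phi a) - (s - t)%:C * phi a.
    by rewrite rmorphB; ring.
  move=> /(congr1 (@ComplexField.Normc.normc R)).
  rewrite ComplexField.Normc.normcM normc_real ger0_norm; last lra.
  have := normcD (s%:C * psi a - t%:C * phi a) (- ((s - t)%:C * phi a)).
  rewrite normcN ComplexField.Normc.normcM normc_real -/m => h4 h5.
  have h6 : `|s - t| * m <= e' * t / 8.
    move: h3; rewrite ltr_pdivlMr; last lra.
    have := normr_ge0 (s - t); nra.
  have h7 : s * normc (psi a - phi a) <= e' * t / 4 by lra.
  rewrite /=; have := normc_ge0 (psi a - phi a); nra.
have et : 0 < e / t by rewrite divr_gt0.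
have := sub _ (mk_near hL hphi et).
apply: (@filterS _ (wstar Phi)) => Psi h s psi hpsi PsiE a sa_a La.
have := le_lt_trans (mk_ge phi psi sa_a La) (h s psi hpsi PsiE).
by rewrite lte_fin ltr_pdivlMr // mulrC => /ltW.
Qed.

End ComponentContinuity.

Section SumLipNorm.
Variables (R : realType) (A1 A2 : cstarAlgType R).
Local Notation A12 := (A1 * A2)%type.
Implicit Types z : A12.
Variables (L1 : A1 -> \bar R) (L2 : A2 -> \bar R) (N : A12 -> R).
Hypotheses (hL1 : lip_norm L1) (hL2 : lip_norm L2).
Hypotheses (N_ge0 : forall z, 0 <= N z) (ND : forall z z', N (z + z') <= N z + N z').
Hypotheses (NZ : forall (t : R) z, N (t%:C *: z) = `|t| * N z) (N1 : N 1 = 0).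
Variable M : R.
Hypothesis N_bound : forall z, N z <= M * cnorm z.
Variables (theta1 : A1 -> R[i]) (theta2 : A2 -> R[i]) (C : R).
Hypotheses (htheta1 : is_state theta1) (htheta2 : is_state theta2).
Hypothesis N_couple : forall z, sa z -> normc (theta1 z.1 - theta2 z.2) <= C * N z.

(** [N] couples the summands: with N = 0 the kernel would contain a copy of the scalars from each.
    Through [N_couple] it controls the difference of two reference states, which identifies the two
    constants and keeps the summands at bounded mk-distance. *)
Definition sum_lip z : \bar R := maxe (L1 z.1) (maxe (L2 z.2) (N z)%:E).

Let semi1 := lip_norm_seminorm hL1.
Let semi2 := lip_norm_seminorm hL2.

Lemma sum_lip_le z (r : \bar R) :
  (sum_lip z <= r)%E <-> [/\ (L1 z.1 <= r)%E, (L2 z.2 <= r)%E & ((N z)%:E <= r)%E].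
Proof. by rewrite /sum_lip !ge_max; split=> [/and3P[]|[-> -> ->]]. Qed.

Lemma sum_lip_seminorm : sa_seminorm sum_lip.
Proof.
split=> [z _|t z /sum_sa[s1 s2]|z z' /sum_sa[s1 s2] /sum_sa[s1' s2']].
- by rewrite /sum_lip !le_max lee_fin N_ge0 !orbT.
- rewrite /sum_lip /= (seminormZ semi1) // (seminormZ semi2) // NZ EFinM.
  by rewrite !maxe_pMr.
apply/sum_lip_le; split.
- apply: le_trans (seminormD semi1 s1 s1') _.
  by apply: leeD; rewrite /sum_lip !le_max lexx ?orbT.
- apply: le_trans (seminormD semi2 s2 s2') _.
  by apply: leeD; rewrite /sum_lip !le_max lexx ?orbT.
apply: (@le_trans _ _ ((N z)%:E + (N z')%:E)%E); first by rewrite -EFinD lee_fin.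
by apply: leeD; rewrite /sum_lip !le_max lexx ?orbT.
Qed.

Lemma sum_lip_dense : lip_dom_dense sum_lip.
Proof.
case: hL1 => _ [[_ f1] d1] _ _ _; case: hL2 => _ [[_ f2] d2] _ _ _.
split=> [|z e /sum_sa[s1 s2] e0].
  by split; [exact: sa1|rewrite /sum_lip !gt_max f1 f2 ltry].
have [a [sa_a La] za] := d1 z.1 e s1 e0; have [b [sb Lb] zb] := d2 z.2 e s2 e0.
exists (a, b); last by rewrite gt_max za.
by split; [exact/sum_sa|rewrite /sum_lip /= !gt_max La Lb ltry].
Qed.

Lemma sum_lip_eq0 z : sa z -> (sum_lip z = 0%E <-> exists t : R, z = (t%:C)%:A).
Proof.
move=> /[dup] sz /sum_sa[s1 s2].
case: hL1 => _ _ z1 _ _; case: hL2 => _ _ z2 _ _.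
split=> [Lz|[t zE]]; last first.
  have N0 : N z = 0 by rewrite zE NZ N1 mulr0.
  have -> : sum_lip z = maxe (L1 z.1) (maxe (L2 z.2) 0%E) by rewrite /sum_lip N0.
  have -> : L1 z.1 = 0%E by apply/(z1 _ s1); exists t; rewrite zE.
  have -> : L2 z.2 = 0%E by apply/(z2 _ s2); exists t; rewrite zE.
  by rewrite !maxxx.
have /sum_lip_le[h1 h2] : (sum_lip z <= 0)%E by rewrite Lz.
rewrite lee_fin => h3.
have /(z1 _ s1)[t1 t1E] : L1 z.1 = 0%E.
  by apply/eqP; rewrite eq_le h1 (seminorm_ge0 semi1).
have /(z2 _ s2)[t2 t2E] : L2 z.2 = 0%E.
  by apply/eqP; rewrite eq_le h2 (seminorm_ge0 semi2).
have Nz : N z = 0 by apply/eqP; rewrite eq_le h3 N_ge0.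
have := N_couple sz; rewrite Nz mulr0 t1E t2E !state_scalar //.
move=> /normc0P/eqP; rewrite subr_eq0 => /eqP t12.
by exists t1; case: z t1E t2E {sz s1 s2 Lz h1 h2 h3 Nz} => a b /= -> ->; rewrite -t12.
Qed.

Lemma sum_lip_lsc : sa_lower_semicontinuous sum_lip.
Proof.
case: hL1 => _ _ _ _ c1; case: hL2 => _ _ _ _ c2.
move=> z r /sum_sa[s1 s2]; rewrite /sum_lip !lt_max => /or3P[rl|rl|rl].
- have [e e0 he] := c1 _ _ s1 rl; exists e => // z' /sum_sa[s1' s2'] lt.
  by rewrite /sum_lip !lt_max he // (le_lt_trans (sum_norm1 _) lt).
- have [e e0 he] := c2 _ _ s2 rl; exists e => // z' /sum_sa[s1' s2'] lt.
  by rewrite /sum_lip !lt_max he ?orbT // (le_lt_trans (sum_norm2 _) lt).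
move: rl; rewrite lte_fin => rl; have M1 : 0 < `|M| + 1 by rewrite ltr_wpDl.
(* [N] is Lipschitz with constant M; the denominator is made positive. *)
exists ((N z - r) / (`|M| + 1)); first by rewrite divr_gt0 // subr_gt0.
move=> z' _ lt; rewrite /sum_lip !lt_max lte_fin; apply/or3P/Or33.
have := ND (z - z') z'; rewrite subrK; have := N_bound (z - z').
move: lt; rewrite cnormB ltr_pdivlMr // => lt.
have := ler_wpM2r (cnorm_ge0 (z - z')) (ler_norm M).
have := cnorm_ge0 (z - z'); lra.
Qed.

(** States of either summand are compared with the single number theta1 z.1; crossing to the second
    summand costs C through [N_couple]. This gives finiteness of mk and absorbs changes of mass. *)
Lemma sum_lip_spread : exists2 K : R, 0 < K & forall z, sa z -> (sum_lip z <= 1)%E ->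
  (forall psi, is_state psi -> normc (psi z.1 - theta1 z.1) <= K) /\
  (forall psi, is_state psi -> normc (psi z.2 - theta1 z.1) <= K).
Proof.
have [K1 K10 h1] := mk_bounded hL1 htheta1; have [K2 K20 h2] := mk_bounded hL2 htheta2.
exists (K1 + K2 + `|C|); first by rewrite ltr_wpDr // addr_gt0.
move=> z /[dup] sz /sum_sa[s1 s2] /sum_lip_le[z1 z2]; rewrite lee_fin => z3.
have C0 := normr_ge0 C.
split=> psi hpsi.
  have := le_trans (mk_ge theta1 psi s1 z1) (h1 _ hpsi).
  rewrite lee_fin normcB; lra.
have := le_trans (mk_ge theta2 psi s2 z2) (h2 _ hpsi).
rewrite lee_fin normcB => h.
have := normcD (psi z.2 - theta2 z.2) (theta2 z.2 - theta1 z.1).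
rewrite addrA subrK (normcB (theta2 _)); have := N_couple sz.
have := ler_norm C; have := N_ge0 z; nra.
Qed.

Lemma sum_lip_near Phi (e : R) : is_state Phi -> 0 < e ->
  \forall Psi \near wstar Phi, (mk sum_lip Phi Psi < e%:E)%E.
Proof.
move=> hPhi e0; have [K K0 hK] := sum_lip_spread.
have [t [phi1 [phi2 [/andP[t0 t1] h1 h2 E1 E2]]]] := state_sum_decomp htheta1 htheta2 hPhi.
have t1' : 0 <= 1 - t by rewrite subr_ge0.
have e80 : 0 < e / 8 by rewrite divr_gt0.
have n1 := component_near hL1 t0 h1 E1 e80.
have n2 := component_near hL2 t1' h2 E2 e80.
have e3 : 0 < e / (8 * K) by rewrite divr_gt0 // mulr_gt0.
have n3 := wstar_eval Phi (1, 0) e3.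
apply: filterS2 (filterI n1 n2) (filterI n3 (wstar_state Phi)) => Psi [m1 m2] [m3 hPsi].
have [s [psi1 [psi2 [/andP[s0 s1] h1' h2' E1' E2']]]] :=
  state_sum_decomp htheta1 htheta2 hPsi.
have {}m3 : `|s - t| * K < e / 8.
  move: m3; rewrite E1 E1' (state1 h1) (state1 h1') !mulr1 -rmorphB normc_real.
  have -> : e / (8 * K) = e / 8 / K by rewrite invfM mulrA.
  by rewrite ltr_pdivlMr.
apply: (@le_lt_trans _ _ (e / 2)%:E); last by rewrite lte_fin; lra.
apply: mk_le => z /[dup] sz /sum_sa[sz1 sz2] /[dup] Lz /sum_lip_le[Lz1 Lz2 _].
have {m1}m1 := m1 _ _ h1' E1' _ sz1 Lz1; have {m2}m2 := m2 _ _ h2' E2' _ sz2 Lz2.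
have [/(_ _ h1') k1 /(_ _ h2') k2] := hK z sz Lz.
rewrite lee_fin (state_pair z hPhi) (state_pair z hPsi) E1 E2 E1' E2'.
set c := theta1 z.1 in k1 k2.
(* The reference value c cancels because the masses add up to 1. Each of the four terms is at most e
   / 8: two from continuity of the components, two from the change of mass. *)
have -> : t%:C * phi1 z.1 + (1 - t)%:C * phi2 z.2 -
    (s%:C * psi1 z.1 + (1 - s)%:C * psi2 z.2) =
    (t%:C * (phi1 z.1 - psi1 z.1) + (1 - t)%:C * (phi2 z.2 - psi2 z.2)) +
    (- (s - t)%:C * (psi1 z.1 - c) + (s - t)%:C * (psi2 z.2 - c)).
  by rewrite !rmorphB rmorph1; ring.
apply: le_trans (normcD _ _) _; apply: le_trans (lerD (normcD _ _) (normcD _ _)) _.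
rewrite mulNr normcN !ComplexField.Normc.normcM !normc_real (ger0_norm t0) (ger0_norm t1').
have := ler_wpM2l (normr_ge0 (s - t)) k1; have := ler_wpM2l (normr_ge0 (s - t)) k2; lra.
Qed.

Lemma sum_lip_norm : lip_norm sum_lip.
Proof.
split; [exact: sum_lip_seminorm|exact: sum_lip_dense|exact: sum_lip_eq0| |exact: sum_lip_lsc].
apply: (mk_metrizesP sum_lip_seminorm sum_lip_dense); last exact: sum_lip_near.
move=> Phi Psi hPhi hPsi; have [K K0 hK] := sum_lip_spread.
have bnd Ups z : is_state Ups -> sa z -> (sum_lip z <= 1)%E ->
    normc (Ups z - theta1 z.1) <= K.
  move=> hU sz Lz; have [k1 k2] := hK z sz Lz.
  have [t [phi1 [phi2 [/andP[t0 t1] h1 h2 E1 E2]]]] := state_sum_decomp htheta1 htheta2 hU.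
  rewrite (state_pair z hU) E1 E2.
  have -> : t%:C * phi1 z.1 + (1 - t)%:C * phi2 z.2 - theta1 z.1 =
      t%:C * (phi1 z.1 - theta1 z.1) + (1 - t)%:C * (phi2 z.2 - theta1 z.1).
    by rewrite rmorphB rmorph1; ring.
  apply: le_trans (normcD _ _) _; rewrite !ComplexField.Normc.normcM !normc_real.
  have t1' : 0 <= 1 - t by rewrite subr_ge0.
  rewrite !ger0_norm //.
  have := ler_wpM2l t0 (k1 _ h1); have := ler_wpM2l t1' (k2 _ h2); lra.
apply: (@le_lt_trans _ _ (K + K)%:E); last exact: ltry.
apply: mk_le => z sz Lz; rewrite lee_fin.
have -> : Phi z - Psi z = (Phi z - theta1 z.1) + (theta1 z.1 - Psi z).
  by rewrite addrA subrK.
apply: le_trans (normcD _ _) _; rewrite (normcB (theta1 _)).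
by apply: lerD; exact: bnd.
Qed.

Hypotheses (NZc : forall l z, N (l *: z) = normc l * N z).
Hypothesis NM : forall z z', N (z * z') <= cnorm z * N z' + cnorm z' * N z.
Hypotheses (qL1 : quasi_leibniz L1) (qL2 : quasi_leibniz L2).

Lemma sum_lip_leibniz : quasi_leibniz sum_lip.
Proof.
move=> z z' [/[dup] sz /sum_sa[s1 s2]]; rewrite {1}/sum_lip !gt_max => /and3P[f1 f2 _].
move=> [/[dup] sz' /sum_sa[s1' s2']]; rewrite {1}/sum_lip !gt_max => /and3P[f1' f2' _].
have := qL1 (conj s1 f1) (conj s1' f1'); rewrite ge_max => /andP[j1 l1].
have := qL2 (conj s2 f2) (conj s2' f2'); rewrite ge_max => /andP[j2 l2].
have mono c c' (x x' y y' : \bar R) : (0 <= x)%E -> (0 <= x')%E -> 0 <= c -> 0 <= c' ->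
    c <= cnorm z -> c' <= cnorm z' -> (x <= y)%E -> (x' <= y')%E ->
    (2%:E * (c%:E * x' + c'%:E * x) <= 2%:E * ((cnorm z)%:E * y' + (cnorm z')%:E * y))%E.
  move=> x0 x'0 c0 c'0 cz cz' xy xy'; apply: lee_wpmul2l; first by rewrite lee_fin.
  by apply: leeD; apply: lee_pmul => //; rewrite lee_fin.
have le1 w : (L1 w.1 <= sum_lip w)%E by rewrite /sum_lip le_max lexx.
have le2 w : (L2 w.2 <= sum_lip w)%E by rewrite /sum_lip !le_max lexx orbT.
have le3 w : ((N w)%:E <= sum_lip w)%E by rewrite /sum_lip !le_max lexx !orbT.
have m1 := mono _ _ _ _ _ _ (seminorm_ge0 semi1 s1) (seminorm_ge0 semi1 s1')
  (cnorm_ge0 _) (cnorm_ge0 _) (sum_norm1 z) (sum_norm1 z') (le1 z) (le1 z').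
have m2 := mono _ _ _ _ _ _ (seminorm_ge0 semi2 s2) (seminorm_ge0 semi2 s2')
  (cnorm_ge0 _) (cnorm_ge0 _) (sum_norm2 z) (sum_norm2 z') (le2 z) (le2 z').
have m3 : ((2 * (cnorm z * N z' + cnorm z' * N z))%:E <=
    2%:E * ((cnorm z)%:E * sum_lip z' + (cnorm z')%:E * sum_lip z))%E.
  by apply: (mono (cnorm z) (cnorm z') (N z)%:E (N z')%:E);
    rewrite ?lee_fin ?cnorm_ge0 ?N_ge0.
have p1 := NM z z'; have p2 := NM z' z.
have c0 : 0 <= cnorm z * N z' + cnorm z' * N z by apply: le_trans p1; exact: N_ge0.
rewrite ge_max; apply/andP; split; apply/sum_lip_le; split.
- exact: le_trans j1 m1.
- exact: le_trans j2 m2.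
- apply: le_trans m3; rewrite lee_fin NZc normc_half; have := ND (z * z') (z' * z); lra.
- exact: le_trans l1 m1.
- exact: le_trans l2 m2.
apply: le_trans m3; rewrite lee_fin NZc normc_half_i.
have := ND (z * z') (- (z' * z)); rewrite -scaleN1r NZc normcN1 mul1r scaleN1r; lra.
Qed.

Lemma sum_lip_qleibniz : qleibniz_lip_norm sum_lip.
Proof. by split; [exact: sum_lip_norm|exact: sum_lip_leibniz]. Qed.

End SumLipNorm.

(** * Tunnels from bridges *)

Section HausdorffDistance.
Variables (R : realType) (T : Type) (d : T -> T -> \bar R).
Implicit Types S : set T.
Local Open Scope ereal_scope.

Lemma hausdorff_lt S S' (r : \bar R) : hausdorff_dist d S S' < r ->
  (forall x, S x -> exists2 y, S' y & d x y < r) /\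
  (forall y, S' y -> exists2 x, S x & d x y < r).
Proof.
rewrite /hausdorff_dist gt_max => /andP[h1 h2]; split=> [x Sx|y Sy].
  have : ereal_inf [set d x y | y in S'] < r.
    by apply: le_lt_trans h1; apply: ereal_sup_ubound; exists x.
  by move=> /ereal_inf_lt[_ [y S'y <-]] lt; exists y.
have : ereal_inf [set d x y | x in S] < r.
  by apply: le_lt_trans h2; apply: ereal_sup_ubound; exists y.
by move=> /ereal_inf_lt[_ [x Sx <-]] lt; exists x.
Qed.

Lemma hausdorff_le S S' (r : \bar R) :
  (forall x, S x -> exists2 y, S' y & d x y <= r) ->
  (forall y, S' y -> exists2 x, S x & d x y <= r) -> hausdorff_dist d S S' <= r.
Proof.
move=> h1 h2; rewrite /hausdorff_dist ge_max; apply/andP; split;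
  apply: ge_ereal_sup => _ [x Sx <-].
  by have [y S'y xy] := h1 x Sx; apply: le_trans xy; apply: ereal_inf_lbound; exists y.
by have [y S'y xy] := h2 x Sx; apply: le_trans xy; apply: ereal_inf_lbound; exists y.
Qed.

Lemma hausdorff_sub_le S S' (r : \bar R) : S' `<=` S -> 0 <= r ->
  (forall y, S' y -> d y y <= 0) ->
  (forall x, S x -> exists2 y, S' y & d x y <= r) -> hausdorff_dist d S S' <= r.
Proof.
move=> sub r0 refl h; apply: hausdorff_le => // y S'y.
by exists y; [exact: sub|apply: le_trans r0; exact: refl].
Qed.

Lemma hausdorff_ge0 S S' : (forall x y, 0 <= d x y) -> S !=set0 -> 0 <= hausdorff_dist d S S'.
Proof.
move=> d0 [x Sx]; rewrite /hausdorff_dist le_max; apply/orP; left.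
apply: (@le_trans _ _ (ereal_inf [set d x y | y in S'])).
  by apply: le_ereal_inf_tmp => _ [y _ <-]; exact: d0.
by apply: ereal_sup_ubound; exists x.
Qed.

End HausdorffDistance.

Section QcmsTheory.
Variable R : realType.
Implicit Types X Y : qcms R.

Lemma qcms_lip_norm X : lip_norm (@lipn R X). Proof. by case: (lipnP X). Qed.
Lemma qcms_leibniz X : quasi_leibniz (@lipn R X). Proof. by case: (lipnP X). Qed.
Lemma qcms_seminorm X : sa_seminorm (@lipn R X).
Proof. exact: lip_norm_seminorm (qcms_lip_norm X). Qed.

Lemma mk_qcms_refl X phi : mk (@lipn R X) phi phi = 0%E.
Proof. exact: mk_refl (qcms_seminorm X) _. Qed.
Lemma mk_qcms_ge0 X phi psi : (0 <= mk (@lipn R X) phi psi)%E.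
Proof. exact: mk_ge0 (qcms_seminorm X) _ _. Qed.

Lemma lip_quotient_le X Y (f : X -> Y) (d : X) : lip_quotient f -> star_hom f -> sa d ->
  (lipn (f d) <= lipn d)%E.
Proof.
move=> qf hf sd; rewrite qf; last exact: star_hom_sa.
by apply: ereal_inf_lbound; exists d.
Qed.

Lemma lip_quotient_lift X Y (f : X -> Y) (a : Y) (r : \bar R) : lip_quotient f -> sa a ->
  (lipn a < r)%E -> exists d, [/\ sa d, f d = a & (lipn d < r)%E].
Proof. by move=> qf sa_a; rewrite qf // => /ereal_inf_lt[_ [d [sd fd] <-]] lt; exists d. Qed.

Lemma star_hom_id (A : cstarAlgType R) : star_hom (@id A).
Proof. by split. Qed.

Lemma star_hom_comp (A B C : cstarAlgType R) (f : A -> B) (h : B -> C) :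
  star_hom f -> star_hom h -> star_hom (h \o f).
Proof.
move=> hf hh; split=> [l x y|//|x] /=.
- by rewrite (star_homD hf) (star_homZ hf) (star_homD hh) (star_homZ hh).
- by split=> [|x y] /=; rewrite ?(star_hom1 hf) ?(star_hom1 hh) // (star_homM hf) (star_homM hh).
by rewrite (star_hom_star hf) (star_hom_star hh).
Qed.

Lemma star_hom_fst (A B : cstarAlgType R) : star_hom (fun z : (A * B)%type => z.1).
Proof. by split. Qed.
Lemma star_hom_snd (A B : cstarAlgType R) : star_hom (fun z : (A * B)%type => z.2).
Proof. by split. Qed.

End QcmsTheory.

Section BridgeTunnel.
Variables (R : realType) (X Y Z : qcms R) (g : bridge X Y) (t : tunnel Y Z).
Local Notation D := (tun_space t).
Local Notation w := (br_pivot g).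
Variable lam : R.
Hypotheses (lam0 : 0 < lam) (g_lt : (bridge_length g < lam%:E)%E).

Let hl := br_left_hom g.
Let hr := br_right_hom g.
Let hp := tun_left_hom t.
Let hq := tun_right_hom t.

Definition bridge_seminorm (z : X * D) : R :=
  cnorm (br_left g z.1 * w - w * br_right g (tun_left z.2)) / lam.

Lemma bridge_seminorm_ge0 z : 0 <= bridge_seminorm z.
Proof. by rewrite divr_ge0 ?cnorm_ge0 // ltW. Qed.

Lemma bridge_seminormD z z' :
  bridge_seminorm (z + z') <= bridge_seminorm z + bridge_seminorm z'.
Proof.
rewrite /bridge_seminorm -mulrDl ler_pM2r ?invr_gt0 //=.
rewrite (star_homD hl) (star_homD hp) (star_homD hr) mulrDl mulrDr opprD addrACA.
exact: cnormD.
Qed.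

Lemma bridge_seminormZ l z : bridge_seminorm (l *: z) = normc l * bridge_seminorm z.
Proof.
rewrite /bridge_seminorm /= (star_homZ hl) (star_homZ hp) (star_homZ hr).
by rewrite -scalerAl -scalerAr -scalerBr cnormZ mulrA.
Qed.

Lemma bridge_seminorm1 : bridge_seminorm 1 = 0.
Proof.
rewrite /bridge_seminorm /= (star_hom1 hl) (star_hom1 hp) (star_hom1 hr).
by rewrite mul1r mulr1 subrr cnorm0 mul0r.
Qed.

Lemma bridge_seminorm_bound z : bridge_seminorm z <= (2 * cnorm w / lam) * cnorm z.
Proof.
rewrite /bridge_seminorm mulrAC ler_pM2r ?invr_gt0 //.
apply: le_trans (cnorm_sub _ _) _.
have h1 := le_trans (star_hom_contractive hl z.1) (sum_norm1 z).
have h2 := le_trans (le_trans (star_hom_contractive hr _) (star_hom_contractive hp z.2))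
  (sum_norm2 z).
have := cnormM (br_left g z.1) w; have := cnormM w (br_right g (tun_left z.2)).
have := ler_wpM2l (cnorm_ge0 w) h1; have := ler_wpM2l (cnorm_ge0 w) h2; lra.
Qed.

Lemma bridge_seminormM z z' : bridge_seminorm (z * z') <=
  cnorm z * bridge_seminorm z' + cnorm z' * bridge_seminorm z.
Proof.
rewrite /bridge_seminorm !mulrA -mulrDl ler_pM2r ?invr_gt0 //=.
rewrite (star_homM hl) (star_homM hp) (star_homM hr).
set a := br_left g z.1; set b := br_left g z'.1.
set c := br_right g _; set d := br_right g _.
have -> : a * b * w - w * (c * d) = a * (b * w - w * d) + (a * w - w * c) * d.
  by rewrite mulrBr mulrBl !mulrA addrA subrK.
apply: le_trans (cnormD _ _) _; apply: lerD; apply: le_trans (cnormM _ _) _.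
  apply: ler_wpM2r; first exact: cnorm_ge0.
  exact: le_trans (star_hom_contractive hl _) (sum_norm1 _).
rewrite mulrC; apply: ler_wpM2r; first exact: cnorm_ge0.
apply: le_trans (star_hom_contractive hr _) _.
exact: le_trans (star_hom_contractive hp _) (sum_norm2 _).
Qed.

(** A level state absorbs the pivot on either side, which leaves its value at the element whose norm
    defines the seminorm. This is the coupling hypothesis of the direct sum, with C = lam, and later
    the cost of crossing the bridge. *)
Lemma level_couple psi z : level_set w psi ->
  normc (psi (br_left g z.1) - psi (br_right g (tun_left z.2))) <= lam * bridge_seminorm z.
Proof.
move=> [hpsi lev]; rewrite /bridge_seminorm mulrC divfK ?gt_eqF //.
have [_ ->] := lev (br_left g z.1); have [-> _] := lev (br_right g (tun_left z.2)).
by rewrite -(stateB hpsi); exact: state_bound.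
Qed.

Lemma level_state_left psi : level_set w psi -> is_state (psi \o br_left g).
Proof. by case=> hpsi _; exact: is_state_comp hl hpsi. Qed.
Lemma level_state_right psi : level_set w psi -> is_state (psi \o br_right g).
Proof. by case=> hpsi _; exact: is_state_comp hr hpsi. Qed.

Definition bridge_lip : (X * D)%type -> \bar R := sum_lip (@lipn R X) (@lipn R D) bridge_seminorm.

Lemma bridge_lip_qleibniz : qleibniz_lip_norm bridge_lip.
Proof.
have [psi lev] := br_level_neq0 g.
have h2 : is_state ((psi \o br_right g) \o @tun_left _ _ _ t).
  exact: is_state_comp hp (level_state_right lev).
apply: (@sum_lip_qleibniz R X D _ _ _ (qcms_lip_norm X) (qcms_lip_norm D)
  bridge_seminorm_ge0 bridge_seminormD _ bridge_seminorm1 _ bridge_seminorm_bound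
  _ _ lam (level_state_left lev) h2).
- by move=> s z; rewrite bridge_seminormZ normc_real.
- by move=> z _; exact: level_couple.
- exact: bridge_seminormZ.
- exact: bridge_seminormM.
- exact: qcms_leibniz.
- exact: qcms_leibniz.
Qed.

Definition bridge_space : qcms R := QCMS bridge_lip_qleibniz.

Lemma bridge_reach_lt : (bridge_reach g < lam%:E)%E.
Proof. by move: g_lt; rewrite /bridge_length gt_max => /andP[]. Qed.

Lemma bridge_height_left phi : is_state phi ->
  exists2 psi, level_set w psi & (mk (@lipn R X) phi (psi \o br_left g) < lam%:E)%E.
Proof.
move=> hphi; move: g_lt; rewrite /bridge_length gt_max => /andP[_].
rewrite /bridge_height gt_max => /andP[h _].
by have [/(_ _ hphi)[_ [psi lev <-]] lt _] := hausdorff_lt h; exists psi.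
Qed.

Lemma bridge_height_right phi : is_state phi ->
  exists2 psi, level_set w psi & (mk (@lipn R Y) phi (psi \o br_right g) < lam%:E)%E.
Proof.
move=> hphi; move: g_lt; rewrite /bridge_length gt_max => /andP[_].
rewrite /bridge_height gt_max => /andP[_ h].
by have [/(_ _ hphi)[_ [psi lev <-]] lt _] := hausdorff_lt h; exists psi.
Qed.

(** The reach compares unit balls; homogeneity of the Lip-norms gives every radius l > 0. *)
Lemma reach_left a (l : R) : 0 < l -> sa a -> (lipn a <= l%:E)%E ->
  exists b, [/\ sa b, (lipn b <= l%:E)%E &
    cnorm (br_left g a * w - w * br_right g b) <= lam * l].
Proof.
move=> l0 sa_a La; have [/(_ (br_left g (l^-1%:C *: a) * w)) h _] := hausdorff_lt bridge_reach_lt.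
have [|_ [b [sb Lb] <-]] := h.
  exists (l^-1%:C *: a) => //; split; first exact: saZ.
  exact: (seminorm_unit_scale (qcms_seminorm X) sa_a l0 La).
rewrite lte_fin => /ltW lt; exists (l%:C *: b); split; first exact: saZ.
  rewrite (seminormZ (qcms_seminorm Y)) // ger0_norm ?(ltW l0) //.
  by rewrite -[leRHS]mule1 lee_wpmul2l // lee_fin ltW.
have -> : a = l%:C *: (l^-1%:C *: a).
  by rewrite scalerA -rmorphM divff ?gt_eqF // rmorph1 scale1r.
rewrite (star_homZ hl l%:C) (star_homZ hr) -scalerAl -scalerAr -scalerBr cnormZr.
by rewrite ger0_norm ?(ltW l0) // mulrC ler_pM2r.
Qed.

Lemma reach_right b (l : R) : 0 < l -> sa b -> (lipn b <= l%:E)%E ->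
  exists a, [/\ sa a, (lipn a <= l%:E)%E &
    cnorm (br_left g a * w - w * br_right g b) <= lam * l].
Proof.
move=> l0 sb Lb; have [_ /(_ (w * br_right g (l^-1%:C *: b))) h] := hausdorff_lt bridge_reach_lt.
have [|_ [a [sa_a La] <-]] := h.
  exists (l^-1%:C *: b) => //; split; first exact: saZ.
  exact: (seminorm_unit_scale (qcms_seminorm Y) sb l0 Lb).
rewrite lte_fin => /ltW lt; exists (l%:C *: a); split; first exact: saZ.
  rewrite (seminormZ (qcms_seminorm X)) // ger0_norm ?(ltW l0) //.
  by rewrite -[leRHS]mule1 lee_wpmul2l // lee_fin ltW.
have -> : b = l%:C *: (l^-1%:C *: b).
  by rewrite scalerA -rmorphM divff ?gt_eqF // rmorph1 scale1r.
rewrite (star_homZ hr l%:C) (star_homZ hl) -scalerAl -scalerAr -scalerBr cnormZr.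
by rewrite ger0_norm ?(ltW l0) // mulrC ler_pM2r.
Qed.

Lemma bridge_lip_le (z : bridge_space) (l : R) : (lipn z.1 <= l%:E)%E -> (lipn z.2 <= l%:E)%E ->
  cnorm (br_left g z.1 * w - w * br_right g (tun_left z.2)) <= lam * l ->
  (lipn z <= l%:E)%E.
Proof.
move=> h1 h2 h3; apply/sum_lip_le; split=> //.
by rewrite lee_fin ler_pdivrMr // mulrC.
Qed.

Lemma bridge_lip_ge (z : bridge_space) (r : \bar R) : (lipn z <= r)%E ->
  [/\ (lipn z.1 <= r)%E, (lipn z.2 <= r)%E & ((bridge_seminorm z)%:E <= r)%E].
Proof. by move=> /sum_lip_le. Qed.

Definition bridge_left (z : bridge_space) : X := z.1.
Definition bridge_right (z : bridge_space) : Z := tun_right z.2.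

Lemma bridge_left_hom : star_hom bridge_left.
Proof. exact: star_hom_fst. Qed.
Lemma bridge_right_hom : star_hom bridge_right.
Proof. exact: star_hom_comp (@star_hom_snd R X D) hq. Qed.

Lemma bridge_left_surj a : exists d, bridge_left d = a.
Proof. by exists (a, 0). Qed.
Lemma bridge_right_surj c : exists d, bridge_right d = c.
Proof. by have [d dc] := tun_right_surj t c; exists (0, d). Qed.

(** A lift without loss need not exist, so the bound is tested at every l strictly above the
    Lip-norm of a. *)
Lemma inf_le_of_lift (W V : qcms R) (f : W -> V) (a : V) :
  (forall l : R, 0 < l -> (lipn a < l%:E)%E ->
     exists d, [/\ sa d, f d = a & (lipn d <= l%:E)%E]) -> sa a ->
  (ereal_inf [set lipn d | d in [set d | sa d /\ f d = a]] <= lipn a)%E.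
Proof.
move=> h sa_a; have := seminorm_ge0 (qcms_seminorm V) sa_a.
case E: (lipn a) => [l| |] //; first rewrite lee_fin; last by move=> _; rewrite leey.
move=> l0; apply/lee_addgt0Pr => e e0.
have [||d [sd fd Ld]] := h (l + e); first by rewrite ltr_wpDl.
  by rewrite E lte_fin ltrDl.
by apply: le_trans Ld; apply: ereal_inf_lbound; exists d.
Qed.

Lemma bridge_left_quotient : lip_quotient bridge_left.
Proof.
move=> a sa_a; apply/eqP; rewrite eq_le; apply/andP; split.
  apply: le_ereal_inf_tmp => _ [d [_ <-] <-].
  by have [] := bridge_lip_ge (lexx (lipn d)).
apply: (@inf_le_of_lift bridge_space X bridge_left a) => // l l0 La.
(* The reach returns an element b with a non-strict bound, whereas lifting b through the old tunnel
   requires a strict one; the radius l' makes room for both. *)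
have [l' l'0 [l'l Ll']] : exists2 l' : R, 0 < l' & l' < l /\ (lipn a <= l'%:E)%E.
  move: La; have := seminorm_ge0 (qcms_seminorm X) sa_a.
  case: (lipn a) => [m| |] //; rewrite lee_fin lte_fin => m0 ml.
  by exists ((m + l) / 2); [lra|split; [lra|rewrite lee_fin; lra]].
have [b [sb Lb ab]] := reach_left l'0 sa_a Ll'.
have [|d [sd db Ld]] := @lip_quotient_lift R D Y (@tun_left _ _ _ t) b l%:E
    (@tun_left_quotient _ _ _ t) sb.
  by apply: le_lt_trans Lb _; rewrite lte_fin.
exists (a, d); split=> //; first exact/sum_sa.
apply: bridge_lip_le => /=; [exact: ltW| exact: ltW|rewrite db].
by apply: le_trans ab _; rewrite ler_pM2l // ltW.
Qed.

(** A lift d of c in the old tunnel is completed by a first coordinate that the reach provides for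
    [tun_left d]. *)
Lemma bridge_right_quotient : lip_quotient bridge_right.
Proof.
move=> c sc; apply/eqP; rewrite eq_le; apply/andP; split.
  apply: le_ereal_inf_tmp => _ [d [/sum_sa[_ sd] <-] <-].
  have [_ h _] := bridge_lip_ge (lexx (lipn d)); apply: le_trans h.
  exact: lip_quotient_le (@tun_right_quotient _ _ _ t) hq sd.
apply: (@inf_le_of_lift bridge_space Z bridge_right c) => // l l0 Lc.
have [d [sd dc /ltW Ld]] := @lip_quotient_lift R D Z (@tun_right _ _ _ t) c l%:E
    (@tun_right_quotient _ _ _ t) sc Lc.
have Lb : (lipn (tun_left d) <= l%:E)%E.
  by apply: le_trans Ld; exact: lip_quotient_le (@tun_left_quotient _ _ _ t) hp sd.
have [a [sa_a La ab]] := reach_right l0 (star_hom_sa hp sd) Lb.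
by exists (a, d); split=> //; [exact/sum_sa|exact: bridge_lip_le].
Qed.

Definition bridge_tunnel : tunnel X Z := Tunnel bridge_left_hom bridge_right_hom
  bridge_left_surj bridge_right_surj bridge_left_quotient bridge_right_quotient.

Variable chi : R.
Hypothesis t_lt : (extent t < chi%:E)%E.

Lemma extent_left phi : is_state phi -> exists2 eta, is_state eta &
  (mk (@lipn R D) phi (eta \o @tun_left _ _ _ t) < chi%:E)%E.
Proof.
move=> hphi; move: t_lt; rewrite /extent gt_max => /andP[h _].
by have [/(_ _ hphi)[_ [eta heta <-]] lt _] := hausdorff_lt h; exists eta.
Qed.

Lemma extent_right phi : is_state phi -> exists2 eta, is_state eta &
  (mk (@lipn R D) phi (eta \o @tun_right _ _ _ t) < chi%:E)%E.
Proof.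
move=> hphi; move: t_lt; rewrite /extent gt_max => /andP[_ h].
by have [/(_ _ hphi)[_ [eta heta <-]] lt _] := hausdorff_lt h; exists eta.
Qed.

Lemma mk_real_le (A : cstarAlgType R) (L : A -> \bar R) phi psi (r : R) a :
  (mk L phi psi < r%:E)%E -> sa a -> (L a <= 1)%E -> normc (phi a - psi a) <= r.
Proof.
by move=> /ltW h sa_a La; have := le_trans (mk_ge phi psi sa_a La) h; rewrite lee_fin.
Qed.

(** The state phi of D moves to a state of Y (cost chi), then to a level state seen from Y (cost
    lam), and finally across the bridge to X (cost lam). *)
Lemma state_to_left phi : is_state phi -> exists2 theta, is_state theta &
  forall z : bridge_space, sa z -> (lipn z <= 1)%E ->
  normc (phi z.2 - theta z.1) <= 2 * lam + chi.
Proof.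
move=> hphi; have [eta heta h1] := extent_left hphi.
have [psi lev h2] := bridge_height_right heta.
exists (psi \o br_left g); first exact: level_state_left.
move=> z /sum_sa[s1 s2] /bridge_lip_ge[z1 z2]; rewrite lee_fin => z3 /=.
have sp := star_hom_sa hp s2.
have Lp := le_trans (lip_quotient_le (@tun_left_quotient _ _ _ t) hp s2) z2.
have k1 := mk_real_le h1 s2 z2; have k2 := mk_real_le h2 sp Lp.
have k3 := level_couple z lev.
have k4 : lam * bridge_seminorm z <= lam by rewrite ler_piMr // ltW.
rewrite /= in k1 k2; set u := phi z.2 in k1 *; set v := psi (br_left g z.1) in k3 *.
have -> : u - v = (u - eta (tun_left z.2)) +
    ((eta (tun_left z.2) - psi (br_right g (tun_left z.2))) +
     (psi (br_right g (tun_left z.2)) - v)) by ring.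
rewrite normcB in k3.
by apply: le_trans (normcD _ _) _; apply: le_trans (lerD k1 (normcD _ _)) _; lra.
Qed.

(** The same route in reverse: to a level state (cost lam), across the bridge and into D through
    [tun_left] (cost lam), then to Z (cost chi). *)
Lemma state_to_right phi : is_state phi -> exists2 zeta, is_state zeta &
  forall z : bridge_space, sa z -> (lipn z <= 1)%E ->
  normc (phi z.1 - zeta (tun_right z.2)) <= 2 * lam + chi.
Proof.
move=> hphi; have [psi lev h1] := bridge_height_left hphi.
have heta := is_state_comp hp (level_state_right lev).
have [zeta hzeta h2] := extent_right heta; exists zeta => //.
move=> z /sum_sa[s1 s2] /bridge_lip_ge[z1 z2]; rewrite lee_fin => z3 /=.
have k1 := mk_real_le h1 s1 z1; have k2 := mk_real_le h2 s2 z2.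
have k3 := level_couple z lev.
have k4 : lam * bridge_seminorm z <= lam by rewrite ler_piMr // ltW.
rewrite /= in k1 k2; set u := phi z.1 in k1 *; set v := zeta (tun_right z.2) in k2 *.
have -> : u - v = (u - psi (br_left g z.1)) +
    ((psi (br_left g z.1) - psi (br_right g (tun_left z.2))) +
     (psi (br_right g (tun_left z.2)) - v)) by ring.
by apply: le_trans (normcD _ _) _; apply: le_trans (lerD k1 (normcD _ _)) _; lra.
Qed.

(** The two components of a state of the direct sum are moved separately and mixed again with the
    same weights, so the larger cost bounds the total. Towards X the component on X stays in place;
    towards Z the component on D costs chi. *)
Lemma bridge_tunnel_extent : (extent bridge_tunnel <= (2 * lam + chi)%:E)%E.
Proof.
have [psi0 lev0] := br_level_neq0 g.
have hl0 := level_state_left lev0.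
have hr0 := is_state_comp hp (level_state_right lev0).
have chi0 : 0 < chi.
  have [eta _ h] := extent_left hr0; rewrite -lte_fin; apply: le_lt_trans h.
  exact: mk_qcms_ge0.
have r0 : 0 <= 2 * lam + chi by rewrite addr_ge0 ?mulr_ge0 // ltW.
have conv (s : R) (Phi : bridge_space -> R[i]) (u v : R[i]) (z : bridge_space) :
  0 <= s <= 1 -> normc u <= 2 * lam + chi -> normc v <= 2 * lam + chi ->
  normc (s%:C * u + (1 - s)%:C * v) <= 2 * lam + chi.
  move=> /andP[s0 s1] hu hv; have s1' : 0 <= 1 - s by rewrite subr_ge0.
  apply: le_trans (normcD _ _) _; rewrite !ComplexField.Normc.normcM !normc_real.
  rewrite (ger0_norm s0) (ger0_norm s1').
  have := ler_wpM2l s0 hu; have := ler_wpM2l s1' hv; lra.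
rewrite /extent ge_max; apply/andP; split; apply: hausdorff_sub_le.
- by move=> _ [phi hphi <-]; exact: is_state_comp bridge_left_hom hphi.
- by rewrite lee_fin.
- by move=> phi _; rewrite (mk_qcms_refl (X := bridge_space)).
- move=> Phi hPhi; have [s [phi1 [phi2 [s01 h1 h2 E1 E2]]]] := state_sum_decomp hl0 hr0 hPhi.
  have [theta htheta th] := state_to_left h2.
  exists ((fun a => s%:C * phi1 a + (1 - s)%:C * theta a) \o bridge_left).
    exists (fun a => s%:C * phi1 a + (1 - s)%:C * theta a) => //.
  exact: is_state_conv.
  apply: mk_le => z sz Lz; rewrite lee_fin (state_pair z hPhi) E1 E2 /=.
  have -> : s%:C * phi1 z.1 + (1 - s)%:C * phi2 z.2 -
      (s%:C * phi1 (bridge_left z) + (1 - s)%:C * theta (bridge_left z)) =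
      s%:C * 0 + (1 - s)%:C * (phi2 z.2 - theta z.1).
    by rewrite /bridge_left; ring.
  by apply: conv => //; [rewrite ComplexField.Normc.normc0|exact: th].
- by move=> _ [phi hphi <-]; exact: is_state_comp bridge_right_hom hphi.
- by rewrite lee_fin.
- by move=> phi _; rewrite (mk_qcms_refl (X := bridge_space)).
move=> Phi hPhi; have [s [phi1 [phi2 [s01 h1 h2 E1 E2]]]] := state_sum_decomp hl0 hr0 hPhi.
have [zeta1 hz1 k1] := state_to_right h1; have [zeta2 hz2 k2] := extent_right h2.
exists ((fun a => s%:C * zeta1 a + (1 - s)%:C * zeta2 a) \o bridge_right).
  exists (fun a => s%:C * zeta1 a + (1 - s)%:C * zeta2 a) => //.
  exact: is_state_conv.
apply: mk_le => z sz Lz; rewrite lee_fin (state_pair z hPhi) E1 E2 /=.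
have -> : s%:C * phi1 z.1 + (1 - s)%:C * phi2 z.2 -
    (s%:C * zeta1 (bridge_right z) + (1 - s)%:C * zeta2 (bridge_right z)) =
    s%:C * (phi1 z.1 - zeta1 (tun_right z.2)) +
    (1 - s)%:C * (phi2 z.2 - zeta2 (tun_right z.2)).
  by rewrite /bridge_right; ring.
apply: conv => //; first exact: k1.
have [_ Lz2 _] := bridge_lip_ge Lz; case/sum_sa: sz => _ sz2.
apply: le_trans (mk_real_le k2 sz2 Lz2) _.
by rewrite lerDr mulr_ge0 // ltW.
Qed.

End BridgeTunnel.

(** * Comparison of the dual and the quantum propinquity *)

Section DualPropinquity.
Variable R : realType.
Implicit Types X Y Z : qcms R.
Local Open Scope ereal_scope.

(** A state is required because a supremum over the empty set is -oo. *)
Lemma extent_ge0 X Y (t : tunnel X Y) : (exists phi : X -> R[i], is_state phi) -> 0 <= extent t.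
Proof.
case=> phi hphi; rewrite /extent le_max; apply/orP; left; apply: hausdorff_ge0.
  exact: mk_qcms_ge0.
by exists (phi \o @tun_left _ _ _ t); exact: is_state_comp (tun_left_hom t) hphi.
Qed.

Lemma dual_propinquity_ge0 X Y : (exists phi : X -> R[i], is_state phi) ->
  0 <= dual_propinquity X Y.
Proof. by move=> hX; apply: le_ereal_inf_tmp => _ [t ->]; exact: extent_ge0. Qed.

Section IsometryTunnel.
Variables (X Y : qcms R) (f : X -> Y).
Hypothesis hf : quantum_isometry f.

Let f_hom : star_hom f. Proof. by case: hf => [[]]. Qed.

Lemma isometry_quotient : lip_quotient f.
Proof.
case: hf => [[_ [h fK hK]] L] b sb.
have sh : sa (h b) by apply: (can_inj fK); rewrite (star_hom_star f_hom) hK.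
apply/eqP; rewrite eq_le; apply/andP; split.
  by apply: le_ereal_inf_tmp => _ [d [sd <-] <-]; rewrite L.
by apply: ereal_inf_lbound; exists (h b); [|rewrite -L ?hK].
Qed.

Lemma id_quotient : lip_quotient (@id X).
Proof.
move=> a sa_a; apply/eqP; rewrite eq_le; apply/andP; split.
  by apply: le_ereal_inf_tmp => _ [d [_ <-] <-].
by apply: ereal_inf_lbound; exists a.
Qed.

Lemma isometry_surj b : exists a, f a = b.
Proof. by case: hf => [[_ [h fK hK]] _]; exists (h b). Qed.

Definition isometry_tunnel : tunnel X Y := Tunnel (@star_hom_id R X) f_hom
  (fun a => ex_intro _ a erefl) isometry_surj id_quotient isometry_quotient.

Lemma isometry_extent_le0 : extent isometry_tunnel <= 0.
Proof.
case: (hf) => [[_ [h fK hK]] _].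
rewrite /extent ge_max; apply/andP; split; apply: hausdorff_sub_le => //.
- by move=> _ [phi hphi <-].
- by move=> phi _; rewrite mk_qcms_refl.
- by move=> phi hphi; exists phi; [exists phi|rewrite mk_qcms_refl].
- by move=> _ [phi hphi <-]; exact: is_state_comp f_hom hphi.
- by move=> phi _; rewrite mk_qcms_refl.
move=> phi hphi; exists phi; last by rewrite mk_qcms_refl.
exists (phi \o h); last by apply/funext => a /=; rewrite fK.
apply: is_state_comp hphi; split=> [l x y||x]; [|split=> [|x y]|]; apply: (can_inj fK).
- by rewrite (star_homD f_hom) (star_homZ f_hom) !hK.
- by rewrite hK (star_hom1 f_hom).
- by rewrite (star_homM f_hom) !hK.
by rewrite (star_hom_star f_hom) !hK.
Qed.

End IsometryTunnel.

Lemma dual_propinquity_isometry X Y (f : X -> Y) :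
  (exists phi : X -> R[i], is_state phi) -> quantum_isometry f -> dual_propinquity X Y = 0.
Proof.
move=> hX hf; apply/eqP; rewrite eq_le dual_propinquity_ge0 // andbT.
apply: le_trans (isometry_extent_le0 hf).
by apply: ereal_inf_lbound; exists (isometry_tunnel hf).
Qed.

Lemma bridge_state_left X Y (g : bridge X Y) : exists phi : X -> R[i], is_state phi.
Proof.
have [psi lev] := br_level_neq0 g.
by exists (psi \o br_left g); exact: level_state_left.
Qed.

Lemma bridge_state_right X Y (g : bridge X Y) : exists phi : Y -> R[i], is_state phi.
Proof.
have [psi lev] := br_level_neq0 g.
by exists (psi \o br_right g); exact: level_state_right.
Qed.

Lemma bridge_length_ge0 X Y (g : bridge X Y) : 0 <= bridge_length g.
Proof.
rewrite /bridge_length /bridge_height le_max; apply/orP; right; rewrite le_max.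
apply/orP; left; apply: hausdorff_ge0; first exact: mk_qcms_ge0.
exact: bridge_state_left g.
Qed.

Lemma dual_le_bridge X Y Z (g : bridge X Y) (t : tunnel Y Z) :
  dual_propinquity X Z <= 2%:E * bridge_length g + extent t.
Proof.
have := bridge_length_ge0 g; have := extent_ge0 t (bridge_state_right g).
case Et : (extent t) => [c| |] // c0; case Eg : (bridge_length g) => [l| |] // l0; last 3 first.
- by rewrite gt0_muley ?lte_fin // addye ?leey.
- by rewrite addey ?leey.
- by rewrite addey ?leey // gt0_muley.
rewrite lee_fin in l0; apply/lee_addgt0Pr => e e0.
(* The slack e is shared as 2 * (e / 4) + e / 2. *)
have e4 : (0 < e / 4)%R by rewrite divr_gt0.
have lam0 : (0 < l + e / 4)%R by rewrite ltr_wpDl.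
have g_lt : bridge_length g < (l + e / 4)%:E by rewrite Eg lte_fin ltrDl.
have t_lt : extent t < (c + e / 2)%:E by rewrite Et lte_fin ltrDl divr_gt0.
have := bridge_tunnel_extent lam0 g_lt t_lt.
have -> : (2 * (l + e / 4) + (c + e / 2))%:E = 2%:E * l%:E + c%:E + e%:E.
  by rewrite -EFinM -!EFinD; congr EFin; field.
by apply: le_trans; apply: ereal_inf_lbound; exists (bridge_tunnel t lam0 g_lt).
Qed.

Lemma bridge_chain_ge0 X Y l : bridge_chain X Y l -> 0 <= l.
Proof.
elim=> {X Y l} [X Y g|X Y Z g l _ l0]; first exact: bridge_length_ge0.
by apply: adde_ge0 => //; exact: bridge_length_ge0.
Qed.

Lemma quantum_isometry_id X : quantum_isometry (@id X).
Proof. by split=> //; split; [exact: star_hom_id|exists id]. Qed.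

Lemma dual_le_chain X Y l : bridge_chain X Y l -> dual_propinquity X Y <= 2%:E * l.
Proof.
elim=> {X Y l} [X Y g|X Y Z g l ch IH].
  apply: le_trans (dual_le_bridge g (isometry_tunnel (quantum_isometry_id Y))) _.
  rewrite -[leRHS]adde0; apply: leeD => //; exact: isometry_extent_le0.
have l0 := bridge_chain_ge0 ch; have g0 := bridge_length_ge0 g.
rewrite ge0_muleDr //; case Eg : (bridge_length g) g0 => [m| |] // m0.
  apply: (@le_trans _ _ (2%:E * m%:E + dual_propinquity Y Z)); last exact: leeD.
  (* With the finite length moved to the left, the infimum over tunnels from Y to Z can be taken. *)
  rewrite -leeBlDl //; apply: le_ereal_inf_tmp => _ [t ->].
  by rewrite leeBlDl // -Eg; exact: dual_le_bridge.
rewrite gt0_muley ?lte_fin // addye ?leey //.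
by rewrite gt_eqF // (lt_le_trans ltNy0) // mule_ge0.
Qed.

Lemma dual_le_propinquity X Y : dual_propinquity X Y <= 2%:E * propinquity X Y.
Proof.
rewrite -lee_pdivrMl //; apply: le_ereal_inf_tmp => l ch.
by rewrite lee_pdivrMl //; exact: dual_le_chain.
Qed.

Lemma propinquity_ge0 X Y : 0 <= propinquity X Y.
Proof. by apply: le_ereal_inf_tmp => l; exact: bridge_chain_ge0. Qed.

Lemma propinquity_le_bridge X Y (g : bridge X Y) : propinquity X Y <= bridge_length g.
Proof. by apply: ereal_inf_lbound; exact: bridge_chain1. Qed.

End DualPropinquity.

(** * The inductive limit *)

Section LipNormTransfer.
Variable R : realType.

(** No clause of the axioms reads L outside sa(A), and neither does mk. Thus [lip_seq], known on
    self-adjoint elements, inherits everything from [lip_state]. *)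
Lemma qleibniz_ext (A : cstarAlgType R) (L L' : A -> \bar R) :
  (forall a, sa a -> L a = L' a) -> qleibniz_lip_norm L -> qleibniz_lip_norm L'.
Proof.
move=> LL' [[[ge0 Z D] [[dom1 fin1] dense] eq0 [mfin msep met] lsc] leib].
have mkE : mk L' = mk L.
  apply/funext => phi; apply/funext => psi; congr ereal_sup.
  by apply/seteqP; split=> _ [a [sa_a La] <-]; exists a => //; split=> //; rewrite -?LL' // LL'.
split; first split.
- split=> [a sa_a|t a sa_a|a b sa_a sb]; first by rewrite -LL' ?ge0.
    by rewrite -!LL' ?Z //; exact: saZ.
  by rewrite -!LL' ?D //; exact: saD.
- split=> [|a e sa_a e0]; first by split=> //; rewrite -LL'.
  by have [b [sb Lb] ab] := dense a e sa_a e0; exists b => //; split=> //; rewrite -LL'.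
- by move=> a sa_a; rewrite -LL' //; exact: eq0.
- by split; rewrite mkE.
- move=> a r sa_a; rewrite -LL' // => /(lsc a r sa_a)[e e0 h].
  by exists e => // b sb ab; rewrite -LL' //; exact: h.
move=> a b [sa_a La] [sb Lb]; have := leib a b; rewrite /lip_dom /= !LL' //.
- by apply.
- exact: sa_lie.
- exact: sa_jordan.
Qed.

(* The states of B are restrictions of states of A along j, with a weak*
   continuous extension map phi |-> phi \o e. *)
Lemma qleibniz_retract (A B : cstarAlgType R) (L : A -> \bar R) (j : B -> A) (e : A -> B) :
  qleibniz_lip_norm L -> star_hom j -> (forall b, cnorm (j b) = cnorm b) ->
  (forall b, e (j b) = b) -> (forall phi, is_state phi -> is_state (phi \o e)) ->
  (forall b, (L (j b) < +oo)%E) -> qleibniz_lip_norm (L \o j).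
Proof.
move=> [hL leib] hj nj ej he fin; have semi := lip_norm_seminorm hL.
have jinj : injective j by exact: can_inj ej.
have mk_le_ext phi psi : (mk (L \o j) phi psi <= mk L (phi \o e) (psi \o e))%E.
  apply: mk_le => b sb Lb; have := mk_ge (phi \o e) (psi \o e) (star_hom_sa hj sb) Lb.
  by rewrite /= !ej.
have semi' : sa_seminorm (L \o j).
  split=> [b sb|t b sb|b c sb sc] /=; first exact: seminorm_ge0 (star_hom_sa hj sb).
    by rewrite (star_homZ hj) (seminormZ semi) //; exact: star_hom_sa.
  by rewrite (star_homD hj); apply: (seminormD semi); exact: star_hom_sa.
have dense' : lip_dom_dense (L \o j).
  split=> [|b r sb r0]; first by split; [exact: sa1|exact: fin].
  by exists b; [split=> //; exact: fin|rewrite subrr cnorm0].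
split; first split=> //.
- move=> b sb /=; case: hL => _ _ /(_ _ (star_hom_sa hj sb)) eq0 _ _.
  split=> [/eq0[t jb]|[t bE]]; last first.
    by apply/eq0; exists t; rewrite bE (star_homZ hj) (star_hom1 hj).
  by exists t; apply: jinj; rewrite (star_homZ hj) (star_hom1 hj).
- apply: (mk_metrizesP semi' dense').
    move=> phi psi hp hs; apply: le_lt_trans (mk_le_ext _ _) _.
    by case: hL => _ _ _ [+ _ _] _; apply; exact: he.
  move=> phi r hp r0.
  pose G : set_system (A -> R[i]) :=
    [set U : set (A -> R[i]) | \forall psi \near wstar phi, U (psi \o e)].
  have FG : Filter G.
    split; rewrite /G /=; first exact: nearW.
      by move=> U V nU nV; apply: (@filterS2 _ (wstar phi) _ _ _ _ _ nU nV) => psi.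
    by move=> U V UV; apply: (@filterS _ (wstar phi)) => psi; exact: UV.
  have sub : wstar (phi \o e) `<=` G.
    apply: wstar_sub.
      by apply: (@filterS _ (wstar phi)) (wstar_state phi) => psi; exact: he.
    by move=> a d d0; exact: wstar_eval.
  have := sub _ (mk_near hL (he _ hp) r0).
  by apply: (@filterS _ (wstar phi)) => psi; exact: le_lt_trans.
- move=> b r sb /=; case: hL => _ _ _ _ lsc /(lsc _ _ (star_hom_sa hj sb))[d d0 h].
  exists d => // c sc bc; apply: h; first exact: star_hom_sa.
  by rewrite -(star_homB hj) nj.
move=> b c [sb Lb] [sc Lc] /=.
rewrite !(star_homZ hj) (star_homD hj) (star_homB hj) !(star_homM hj) -!nj.
by apply: leib; split=> //; exact: star_hom_sa.
Qed.

End LipNormTransfer.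

Lemma eventually_bounded (R : realType) (f : nat -> R) (N : nat) (c : R) :
  (forall n, (N <= n)%N -> f n <= c) -> exists2 M : R, 0 <= M & forall n, f n <= M.
Proof.
move=> fc; exists (`|c| + \sum_(k < N) `|f k|).
  by rewrite addr_ge0 // sumr_ge0.
move=> n; have [Nn|nN] := leqP N n.
  apply: le_trans (fc n Nn) _; apply: le_trans (ler_norm c) _.
  by rewrite lerDl sumr_ge0.
apply: le_trans (ler_norm _) _.
by rewrite (bigD1 (Ordinal nN)) //= addrCA lerDl addr_ge0 // sumr_ge0.
Qed.

Section InductiveLimit.
Variables (R : realType) (A : cstarAlgType R) (An : nat -> cstar_subalg A).
Hypothesis hAn : af_filtration An.
Variable mu : A -> R[i].
Hypothesis hmu : faithful_tracial_state mu.
Variable beta : nat -> R.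
Hypotheses (beta_gt0 : forall n, 0 < beta n) (beta_summable : cvgn (series beta)).
Variable E : forall n, A -> csub (An n).
Hypotheses (E_cond : forall n, cond_exp (E n)).
Hypothesis (E_mu : forall n a, mu (val (E n a)) = mu a).
Local Notation F n a := (val (E n a)).
Local Notation L := (lip_state beta E).
Local Notation Es := (cond_step E).
Implicit Types (d : dseq An) (a b : A).

Let F_comp := cexp_comp hAn hmu E_cond E_mu.

Lemma Ecomp_cexp n (a : csub (An n)) m : (m <= n)%N -> Ecomp Es m a = F m (val a).
Proof.
elim: n a => [|n IH] a /=; first by rewrite leqn0 => /eqP ->; rewrite (cexp_id E_cond) ?csub_valP.
rewrite leq_eqVlt ltnS => /predU1P[->|mn].
  by rewrite ltnn (cexp_id E_cond) ?csub_valP.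
by rewrite mn IH // /cond_step F_comp.
Qed.

(** Indices m >= n contribute nothing to the supremum because E_m fixes A_n; for m < n the tower
    property identifies E_{n,m} with E_m. *)
Lemma lip_finE n (a : csub (An n)) : lip_fin beta Es a = L (val a).
Proof.
have tm (m : 'I_n) : cnorm (val a - Ecomp Es m a) / beta m = cnorm (val a - F m (val a)) / beta m.
  by rewrite Ecomp_cexp // ltnW.
rewrite /lip_fin (eq_bigr _ (fun m _ => tm m)); apply/eqP; rewrite eq_le; apply/andP; split.
  have := lip_state_fin hAn beta_gt0 E_cond (csub_valP a).
  have := lip_state_ge0 beta_gt0 E (val a); rewrite -[csub_val a]/(val a).
  case El : (L (val a)) => [l| |] //; rewrite lee_fin => l0 _.
  rewrite lee_fin; apply: bigmax_le => // m _.
  by rewrite -lee_fin -El; exact: lip_state_term.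
apply: (lip_state_le beta_gt0) => k; rewrite -ler_pdivrMr //.
have [kn|nk] := ltnP k n.
  exact: (le_bigmax _ (fun m : 'I_n => cnorm (val a - F m (val a)) / beta m) (Ordinal kn)).
rewrite (cexp_id_le hAn E_cond nk (csub_valP a)) subrr cnorm0 mul0r.
exact: bigmax_ge_id.
Qed.

Definition compatible d := forall n, (d n.+1).1 = (d n).2.
(** First coordinates suffice: under [compatible] the second ones are their shift. *)
Definition dlim d a : Prop := ctends (fun n => val (d n).1) a.

Lemma compatible_re d : compatible d ->
  compatible (Defs.dscale 2^-1 (Defs.dadd d (dstar d))).
Proof. by move=> cd n; exact: (congr1 (@re_part R (csub (An n.+1))) (cd n)). Qed.

Lemma compatible_im d : compatible d ->
  compatible (Defs.dscale (2 * 'i)^-1 (Defs.dsub d (dstar d))).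
Proof. by move=> cd n; exact: (congr1 (@im_part R (csub (An n.+1))) (cd n)). Qed.

Lemma dlim_snd d a : compatible d -> dlim d a -> ctends (fun n => val (d n).2) a.
Proof.
move=> cd /ctends_shift; rewrite (_ : (fun n => _) = (fun n => val (d n).2)) //.
by apply/funext => n; rewrite cd.
Qed.

Lemma dlim_unique d a b : dlim d a -> dlim d b -> a = b.
Proof. exact: ctends_unique. Qed.

Lemma cnorm_pairE n (x : csub (An n) * csub (An n.+1)) :
  cnorm x = Num.max (cnorm (val x.1)) (cnorm (val x.2)).
Proof. by []. Qed.

Lemma dprod_lim d a : compatible d -> dlim d a -> dprod d.
Proof.
move=> cd da; have /ctendsP/(_ 1 ltr01)[N hN] := da.
have [|M _ hM] := @eventually_bounded _ (fun n => cnorm (val (d n).1)) N (cnorm a + 1).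
  move=> n /hN/ltW h; rewrite -(subrK a (val (d n).1)) addrC.
  by apply: le_trans (cnormD _ _) _; rewrite lerD2l.
apply: (@le_lt_trans _ _ M%:E); last exact: ltry.
apply: ge_ereal_sup => _ [n _ <-].
by rewrite lee_fin cnorm_pairE -cd ge_max !hM.
Qed.

Lemma S0_le d (r : \bar R) : (S0 beta Es d <= r)%E <-> forall n,
  [/\ (L (val (d n).1) <= r)%E, (L (val (d n).2) <= r)%E &
      ((cnorm (val (d n).1 - val (d n).2) / (2 * beta n))%:E <= r)%E].
Proof.
split=> [Sr n|h].
  have : (lip_pair beta Es (d n) <= r)%E.
    by apply: le_trans Sr; apply: ereal_sup_ubound; exists n.
  by rewrite /lip_pair !ge_max !lip_finE => /and3P[].
apply: ge_ereal_sup => _ [n _ <-]; have [h1 h2 h3] := h n.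
by rewrite /lip_pair !ge_max !lip_finE h1 h2 h3.
Qed.

Lemma S0_ge0 d : (0 <= S0 beta Es d)%E.
Proof.
have /S0_le/(_ 0%N)[h _ _] := lexx (S0 beta Es d).
exact: le_trans (lip_state_ge0 beta_gt0 E _) h.
Qed.

Lemma S0_real d : (S0 beta Es d < +oo)%E -> exists2 s : R, 0 <= s & S0 beta Es d = s%:E.
Proof.
have := S0_ge0 d; case: (S0 beta Es d) => [s| |] // + _.
by rewrite lee_fin => s0; exists s.
Qed.

(** From N on the pair is (b, b), with cost L b and no coupling term; the finitely many other pairs
    have finite cost. *)
Lemma S0_eventually_cst d b N : compatible d -> (forall n, (N <= n)%N -> val (d n).1 = b) ->
  (S0 beta Es d < +oo)%E.
Proof.
move=> cd dN; have fin n : (L (val (d n).1) < +oo)%E.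
  exact: (lip_state_fin hAn beta_gt0 E_cond (csub_valP (d n).1)).
have realL n : L (val (d n).1) = (fine (L (val (d n).1)))%:E.
  by rewrite fineK // ge0_fin_numE // (lip_state_ge0 beta_gt0).
have [|M1 M10 h1] := @eventually_bounded _ (fun n => fine (L (val (d n).1))) N (fine (L b)).
  by move=> n /dN ->.
have [|M2 M20 h2] := @eventually_bounded _
    (fun n => cnorm (val (d n).1 - val (d n).2) / (2 * beta n)) N 0.
  by move=> n Nn; rewrite -cd !dN ?subrr ?cnorm0 ?mul0r // (leq_trans Nn).
apply: (@le_lt_trans _ _ (M1 + M2)%:E); last exact: ltry.
apply/S0_le => n; rewrite -cd (realL n) (realL n.+1) !lee_fin; split.
- by apply: le_trans (h1 n) _; rewrite lerDl.
- by apply: le_trans (h1 n.+1) _; rewrite lerDl.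
by rewrite cd; apply: le_trans (h2 n) _; rewrite lerDr.
Qed.

(** The coupling term of [S0] bounds the n-th increment by 2 beta(n) times the cost, and [beta] is
    summable. *)
Lemma K0_cauchy d : compatible d -> (S0 beta Es d < +oo)%E ->
  exists a, dlim d a.
Proof.
move=> cd /S0_real[s s0 Ss]; apply: cauchy_ctends.
apply: (@summable_cauchy _ _ _ ((2 * s) *: beta)); first exact: is_cvg_seriesZ.
move=> n; have /S0_le/(_ n)[_ _] : (S0 beta Es d <= s%:E)%E by rewrite Ss.
rewrite lee_fin ler_pdivrMr ?mulr_gt0 // -cd => h.
by apply: le_trans h _; rewrite [_ *: _ n]/GRing.scale /= mulrCA mulrA.
Qed.

Lemma SS0_parts d : SS0 beta Es d -> compatible d /\ exists a, dlim d a.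
Proof.
move=> [_ [[_ c1] f1] [[_ c2] f2]].
have dE n : d n = re_part (d n) + 'i *: im_part (d n) by exact: re_imE.
split=> [n|].
  rewrite (dE n.+1) (dE n).
  exact: (congr2 (fun x y => x + 'i *: y) (c1 n) (c2 n)).
have [a1 h1] := K0_cauchy c1 f1; have [a2 h2] := K0_cauchy c2 f2.
exists (a1 + 'i *: a2); have := ctendsD h1 (ctendsZ 'i h2).
rewrite /dlim (_ : (fun n => _) = (fun n => val (d n).1)) //.
by apply/funext => n; rewrite [in RHS](dE n).
Qed.

(** Gluing and convergence both survive uniform approximation by elements of [SS0]. *)
Lemma G0_lim d : G0 beta Es d -> compatible d /\ exists a, dlim d a.
Proof.
move=> [_ approx].
have close (e : R) : 0 < e -> exists2 s, compatible s /\ (exists a, dlim s a) &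
    forall n, cnorm (val (d n).1 - val (s n).1) < e /\ cnorm (val (d n).2 - val (s n).2) < e.
  move=> e0; have [s /SS0_parts hs ds] := approx e e0; exists s => // n.
  have : ((cnorm (Defs.dsub d s n))%:E < e%:E)%E.
    by apply: le_lt_trans ds; apply: ereal_sup_ubound; exists n.
  by rewrite lte_fin cnorm_pairE gt_max => /andP[].
split=> [n|].
  apply: val_inj; apply/eqP; rewrite -subr_eq0; apply/eqP/cnorm_eq0P.
  apply/ler_addgt0Pr => e e0; rewrite add0r.
  have [|s [cs _] ds] := close (e / 2); first by rewrite divr_gt0.
  have [h1 _] := ds n.+1; have [_ h2] := ds n.
  have := cnorm_trans (val (s n.+1).1) (val (d n.+1).1) (val (d n).2).
  move: h2; rewrite cnormB -cs; lra.
apply: cauchy_ctends => e e0.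
have [|s [_ [a /ctendsP sa]] ds] := close (e / 4); first by rewrite divr_gt0.
have [|N hN] := sa (e / 4); first by rewrite divr_gt0.
exists N => m n /hN hm /hN hn; have [h1 _] := ds m; have [h2 _] := ds n.
have := cnorm_trans (val (s m).1) (val (d m).1) (val (d n).1).
have := cnorm_trans a (val (s m).1) (val (d n).1).
have := cnorm_trans (val (s n).1) a (val (d n).1).
rewrite (cnormB a (val (s n).1)) (cnormB (val (s n).1) (val (d n).1)); lra.
Qed.

Lemma val_incl m n (x : csub (An m)) : (m <= n)%N -> val (Defs.incl n x) = val x.
Proof.
move=> mn; rewrite /Defs.incl val_insubd.
by rewrite (filtration_le hAn mn (csub_valP x)).
Qed.

(* The tail of d is replaced by a constant b of some A_m close to its limit. *)
Lemma lim_G0 d a : compatible d -> dlim d a -> G0 beta Es d.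
Proof.
move=> cd da; split; first exact: dprod_lim da.
move=> e e0; have e4 : 0 < e / 4 by rewrite divr_gt0.
case: (hAn) => _ _ _ /(_ a _ e4)[m [b bm ab]].
have /ctendsP/(_ _ e4)[N0 hN0] := da; pose N := maxn m N0.
(* The second coordinate switches one index earlier, being the first coordinate at n.+1; this keeps
   s compatible. *)
pose s : dseq An := fun n =>
  (if (n < N)%N then (d n).1 else Defs.incl n (CSub bm),
   if (n.+1 < N)%N then (d n).2 else Defs.incl n.+1 (CSub bm)).
have cs : compatible s by move=> n; rewrite /s /= cd.
have sN n : (N <= n)%N -> val (s n).1 = b.
  move=> Nn; rewrite /s /= ltnNge Nn /= val_incl //.
  by apply: leq_trans Nn; exact: leq_maxl.
have slim : dlim s b.
  by apply: ctends_near (ctends_cst b); exists N => // n /sN ->.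
have near n : cnorm (val (d n).1 - val (s n).1) <= e / 2.
  have [nN|Nn] := ltnP n N; first by rewrite /s /= nN subrr cnorm0 divr_ge0 // ltW.
  rewrite sN //; have := hN0 n (leq_trans (leq_maxr _ _) Nn).
  have := cnorm_trans a (val (d n).1) b; lra.
exists s.
  split; first exact: dprod_lim slim.
    split; last first.
      apply: (@S0_eventually_cst _ (re_part b) N) => [|n /sN sn].
        exact: compatible_re.
      by rewrite -sn.
    split; last exact: compatible_re.
    split; last by apply: functional_extensionality_dep => n; exact: sa_re_part (s n).
    apply: (@dprod_lim _ (re_part b)) => [|]; first exact: compatible_re.
    exact: ctendsZ (ctendsD slim (ctends_star slim)).
  split; last first.
    apply: (@S0_eventually_cst _ (im_part b) N) => [|n /sN sn].
      exact: compatible_im.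
    by rewrite -sn.
  split; last exact: compatible_im.
  split; last by apply: functional_extensionality_dep => n; exact: sa_im_part (s n).
  apply: (@dprod_lim _ (im_part b)) => [|]; first exact: compatible_im.
  exact: ctendsZ (ctendsB slim (ctends_star slim)).
apply: (@le_lt_trans _ _ (e / 2)%:E); last by rewrite lte_fin; lra.
apply: ge_ereal_sup => _ [n _ <-]; rewrite lee_fin cnorm_pairE ge_max.
by apply/andP; split; [exact: near|have := near n.+1; rewrite cd cs].
Qed.

Lemma I0P d a : compatible d -> dlim d a -> (I0 beta Es d <-> a = 0).
Proof.
move=> cd da; split=> [[_ h]|a0].
  apply: dlim_unique da _; apply: ctends_squeeze h.
  by apply: nearW => n; rewrite subr0 cnorm_pairE le_max lexx.
split; first exact: lim_G0 da.
have h1 := da; have h2 := dlim_snd cd da; rewrite a0 in h1 h2.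
have := cvgD h1 h2; rewrite addr0 => /(_ _) h.
apply: (squeeze_cvgr _ (cvg_cst 0) h).
apply: nearW => n; rewrite cnorm_ge0 /= cnorm_pairE ge_max.
rewrite -[X in (_ <= X) && _]/(cnorm (val (d n).1 - 0) + cnorm (val (d n).2 - 0)).
rewrite -[X in _ && (_ <= X)]/(cnorm (val (d n).1 - 0) + cnorm (val (d n).2 - 0)) !subr0.
by rewrite lerDl lerDr !cnorm_ge0.
Qed.

(** The coset attached to a, written without a representative. *)
Definition lim_coset a : set (dseq An) := [set d | compatible d /\ dlim d a].

Lemma coset_lim d a : compatible d -> dlim d a -> coset beta Es d = lim_coset a.
Proof.
move=> cd da; apply/seteqP; split=> [e [/G0_lim[ce [b eb]]]|e [ce ea]].
  have csub : compatible (Defs.dsub e d) by move=> n; rewrite /Defs.dsub /= ce cd.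
  have lsub : dlim (Defs.dsub e d) (b - a) by exact: ctendsB.
  move=> /(I0P csub lsub)/eqP; rewrite subr_eq0 => /eqP <-.
  by split.
split; first exact: lim_G0 ea.
apply/(@I0P _ 0) => //; first by move=> n; rewrite /Defs.dsub /= ce cd.
by rewrite -(subrr a); exact: ctendsB.
Qed.

Lemma lim_coset_dlim d a : G0 beta Es d -> lim_coset a = coset beta Es d ->
  compatible d /\ dlim d a.
Proof.
move=> /G0_lim[cd [b db]]; rewrite (coset_lim cd db) => ab.
by have : lim_coset b d by []; rewrite -ab.
Qed.

Definition cexp_seq a : dseq An := fun n => (E n a, E n.+1 a).

Lemma cexp_seq_compatible a : compatible (cexp_seq a). Proof. by []. Qed.
Lemma cexp_seq_lim a : dlim (cexp_seq a) a.
Proof. exact: cexp_cvg. Qed.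
Lemma cexp_seq_G0 a : G0 beta Es (cexp_seq a).
Proof. exact: lim_G0 (cexp_seq_compatible a) (cexp_seq_lim a). Qed.
Lemma cexp_seq_coset a : coset beta Es (cexp_seq a) = lim_coset a.
Proof. exact: coset_lim (cexp_seq_compatible a) (cexp_seq_lim a). Qed.

Lemma lim_coset_inj : injective lim_coset.
Proof.
move=> a b ab; have [_] : lim_coset b (cexp_seq a).
  by rewrite -ab; split; [exact: cexp_seq_compatible|exact: cexp_seq_lim].
exact: dlim_unique (cexp_seq_lim a).
Qed.

Lemma lim_coset_op (op : A -> A -> A) (dop : dseq An -> dseq An -> dseq An) a b d e :
  (forall d e, compatible d -> compatible e -> compatible (dop d e)) ->
  (forall d e a b, dlim d a -> dlim e b -> dlim (dop d e) (op a b)) ->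
  G0 beta Es d -> G0 beta Es e -> lim_coset a = coset beta Es d ->
  lim_coset b = coset beta Es e -> lim_coset (op a b) = coset beta Es (dop d e).
Proof.
move=> cop lop Gd Ge /(lim_coset_dlim Gd)[cd da] /(lim_coset_dlim Ge)[ce eb].
by rewrite (coset_lim (cop _ _ cd ce) (lop _ _ _ _ da eb)).
Qed.

Lemma lim_coset_spec : psi_spec beta Es lim_coset.
Proof.
split; first split.
- split=> [a _|a b _ _|c [d /G0_lim[cd [a da]] <-]].
  + by exists (cexp_seq a); [exact: cexp_seq_G0|exact: cexp_seq_coset].
  + exact: lim_coset_inj.
  + by exists a => //; rewrite (coset_lim cd da).
- by rewrite (@coset_lim _ 1) //; exact: ctends_cst.
- move=> a b d e Gd Ge ad be; split.
    apply: (lim_coset_op (op := +%R) (dop := @Defs.dadd R A An)) ad be => // d' e'.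
      by move=> cd ce n; rewrite /Defs.dadd /= cd ce.
    by move=> a' b'; exact: ctendsD.
  apply: (lim_coset_op (op := *%R) (dop := @dmul R A An)) ad be => // d' e'.
    by move=> cd ce n; rewrite /dmul /= cd ce.
  by move=> a' b'; exact: ctendsM.
- move=> l a d Gd /(lim_coset_dlim Gd)[cd da].
  by rewrite (@coset_lim _ (l *: a)) // => [n|]; [rewrite /Defs.dscale /= cd|exact: ctendsZ].
- move=> a d Gd /(lim_coset_dlim Gd)[cd da].
  by rewrite (@coset_lim _ (star a)) // => [n|]; [rewrite /dstar /= cd|exact: ctends_star].
(* From index n on, [psin a] is the constant pair (a, a). *)
move=> n a; rewrite (@coset_lim _ (val a)) //.
apply: ctends_near (ctends_cst (val a)); exists n => // k /= nk.
by rewrite nk val_incl.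
Qed.

(* lim_coset^-1 \o psi is a star homomorphism, hence contractive, and it fixes
   the dense union of the A_n. *)
Lemma psi_spec_unique psi' : psi_spec beta Es psi' -> psi' = lim_coset.
Proof.
move=> [[[fun_ _ _] p1 pop pZ pstar] pn].
have /choice[sigma sE] : forall a, exists b, psi' a = lim_coset b.
  by move=> a; have [d /G0_lim[cd [b db]] <-] := fun_ a I; exists b; exact: coset_lim.
have sE' a : psi' a = coset beta Es (cexp_seq (sigma a)) by rewrite cexp_seq_coset.
have sG a := cexp_seq_G0 (sigma a).
have [[_ q1 qop qZ qstar] qn] := lim_coset_spec.
have cE a := esym (cexp_seq_coset a).
have sD a b : sigma (a + b) = sigma a + sigma b.
  apply: lim_coset_inj; rewrite -sE.
  have [-> _] := pop _ _ _ _ (sG a) (sG b) (sE' a) (sE' b).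
  by have [-> _] := qop _ _ _ _ (sG a) (sG b) (cE _) (cE _).
have sM a b : sigma (a * b) = sigma a * sigma b.
  apply: lim_coset_inj; rewrite -sE.
  have [_ ->] := pop _ _ _ _ (sG a) (sG b) (sE' a) (sE' b).
  by have [_ ->] := qop _ _ _ _ (sG a) (sG b) (cE _) (cE _).
have sZ l a : sigma (l *: a) = l *: sigma a.
  by apply: lim_coset_inj; rewrite -sE (pZ l _ _ (sG a) (sE' a)) (qZ l _ _ (sG a) (cE _)).
have sst a : sigma (star a) = star (sigma a).
  by apply: lim_coset_inj; rewrite -sE (pstar _ _ (sG a) (sE' a)) (qstar _ _ (sG a) (cE _)).
have s1 : sigma 1 = 1 by apply: lim_coset_inj; rewrite -sE p1 q1.
have sid n (a : csub (An n)) : sigma (val a) = val a.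
  by apply: lim_coset_inj; rewrite -sE pn qn.
have hs : star_hom sigma by split=> // l x y; rewrite sD sZ.
apply/funext => a; rewrite sE; congr lim_coset.
apply/eqP; rewrite -subr_eq0; apply/eqP/cnorm_eq0P/ler_addgt0Pr => e e0; rewrite add0r.
case: (hAn) => _ _ _ /(_ a (e / 2)) [|n [b bn ab]]; first by rewrite divr_gt0.
have := cnorm_trans b (sigma a) a; have sb : sigma b = b := sid n (CSub bn).
rewrite -{1}sb -(star_homB hs).
have := star_hom_contractive hs (a - b); rewrite (cnormB b a); lra.
Qed.

(** [psi] is an [xget]: existence of a solution of [psi_spec] excludes the default value, and
    uniqueness identifies the choice. *)
Lemma psiE : psi beta Es = lim_coset.
Proof.
apply: psi_spec_unique; apply: xgetPex.
by exists lim_coset; exact: lim_coset_spec.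
Qed.

(** For fixed m, a - E_m a is the limit of the same expression at the entries of d, each of norm at
    most beta(m) times the cost of d. *)
Lemma lip_state_S0 d a : dlim d a -> (L a <= S0 beta Es d)%E.
Proof.
move=> da; case ES : (S0 beta Es d) => [s| |]; last 2 first.
- exact: leey.
- by have := S0_ge0 d; rewrite ES.
apply: (lip_state_le beta_gt0) => m.
have Fd : ctends (fun n => F m (val (d n).1)) (F m a).
  apply: ctends_squeeze da; apply: nearW => n.
  by rewrite -(cexpB E_cond); exact: cexp_norm.
apply: (cvgr_to_le (ctends_norm (ctendsB da Fd))); apply: nearW => n.
have /S0_le/(_ n)[h _ _] : (S0 beta Es d <= s%:E)%E by rewrite ES.
exact: (lip_state_ge beta_gt0 m h).
Qed.

(** For m <= n, E_n a - E_m a = E_n (a - E_m a) and E_n is contractive; for m > n the term vanishes.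
    It also bounds the reach of the inclusion bridge. *)
Lemma lip_state_cexp n a : (L (F n a) <= L a)%E.
Proof.
apply: ge_ereal_sup => _ [m _ <-]; apply: le_trans (lip_state_term beta E m a).
rewrite lee_fin ler_pM2r ?invr_gt0 //.
have [mn|nm] := leqP m n.
  rewrite F_comp // -{1}(cexp_id_le hAn E_cond mn (cexp_in E m a)) -(cexpB E_cond).
  exact: cexp_norm.
by rewrite (cexp_id_le hAn E_cond (ltnW nm) (cexp_in E n a)) subrr cnorm0 cnorm_ge0.
Qed.

Lemma S0_cexp_seq a : (S0 beta Es (cexp_seq a) <= L a)%E.
Proof.
apply/S0_le => n; split; [exact: lip_state_cexp|exact: lip_state_cexp|].
apply: le_trans (lip_state_term beta E n a); rewrite /cexp_seq /= lee_fin.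
(* Since E_n a - E_{n+1} a = E_{n+1} (E_n a - a), the coupling term is at most half of the n-th term
   of L_mu a. *)
rewrite -{1}(cexp_id_le hAn E_cond (leqnSn n) (cexp_in E n a)) -(cexpB E_cond).
apply: ler_pM; rewrite ?cnorm_ge0 ?invr_ge0 ?mulr_ge0 ?(ltW (beta_gt0 n)) //.
  by apply: le_trans (cexp_norm E_cond _ _) _; rewrite cnormB.
by rewrite lef_pV2 ?posrE ?mulr_gt0 // ler_peMl ?ler1n // ltW.
Qed.

(** Self-adjointness of a matters: otherwise no self-adjoint sequence tends to a, and the infimum
    over lifts is +oo. *)
Lemma lip_seqE a : sa a -> lip_seq beta Es a = L a.
Proof.
move=> sa_a; rewrite /lip_seq psiE /lip_tau; apply/eqP; rewrite eq_le; apply/andP; split.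
  apply: le_trans (S0_cexp_seq a); apply: ereal_inf_lbound; exists (cexp_seq a) => //.
  split; [exact: cexp_seq_G0| |exact: cexp_seq_coset].
  split; first exact: dprod_lim (cexp_seq_compatible a) (cexp_seq_lim a).
  apply: functional_extensionality_dep => n.
  by congr pair; apply: val_inj => /=; exact: (cexp_sa hmu E_cond E_mu).
apply: le_ereal_inf_tmp => _ [d [Gd _ /esym/(lim_coset_dlim Gd)[_ da]] <-].
exact: lip_state_S0.
Qed.

End InductiveLimit.

(** * Bridges from the finite-dimensional stages, and conclusion *)

Section FiniteStageBridge.
Variables (R : realType) (A : cstarAlgType R) (B : cstar_subalg A).

Lemma star_hom_val : star_hom (val : csub B -> A).
Proof. by split. Qed.

(** Complete positivity at size 1 writes e (star a * a) as [star x * x] with x in the subalgebra, so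
    positivity of phi carries over. *)
Lemma cond_exp_state (e : A -> csub B) (phi : csub B -> R[i]) :
  cond_exp e -> is_state phi -> is_state (phi \o e).
Proof.
move=> [el _ ecp [_ eid _]] hphi.
have [e0 eD] : e 0 = 0 /\ forall x y, e (x + y) = e x + e y.
  have D x y : e (x + y) = e x + e y by have := el 1 x y; rewrite !scale1r.
  by split=> //; apply: (addrI (e 0)); rewrite -D !addr0.
split=> [l x y|a|] /=; last by have := eid 1; rewrite /= => ->; exact: state1.
  by rewrite el (stateD hphi) (stateZ hphi).
pose M : 'M[A]_1 := \matrix_(i, j) (star a * a).
have [|X] := ecp 1%N M.
  exists (\matrix_(i, j) a); apply/matrixP => i j.
  by rewrite !mxE big_ord1 !mxE.
move=> /matrixP/(_ ord0 ord0); rewrite !mxE big_ord1 !mxE => ->.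
exact: state_ge0.
Qed.

Lemma level_set1 (phi : A -> R[i]) : is_state phi -> level_set 1 phi.
Proof. by move=> hphi; split=> // d; rewrite mul1r mulr1. Qed.

Definition incl_bridge (phi : A -> R[i]) (hphi : is_state phi) : bridge (csub B) A :=
  @Bridge R (csub B) A A 1 val id (ex_intro _ phi (level_set1 hphi))
    star_hom_val (@star_hom_id R A) val_inj (@inj_id A).

End FiniteStageBridge.
Local Open Scope ereal_scope.

(** The height is 0: with pivot 1 every state of A is a level state, and a state psi of B is the
    restriction of [psi \o e]. For the reach, the unit ball of B lies in that of A, and e maps the
    latter back within distance r. *)
Lemma incl_bridge_length (R : realType) (A : cstarAlgType R) (B : cstar_subalg A)
    (LB : csub B -> \bar R) (LA : A -> \bar R) (hB : qleibniz_lip_norm LB)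
    (hA : qleibniz_lip_norm LA) (e : A -> csub B) (r : R)
    (phi : A -> R[i]) (hphi : is_state phi) :
  cond_exp e -> (forall a, sa a -> sa (e a)) ->
  (forall b : csub B, sa b -> LA (val b) = LB b) ->
  (forall a, sa a -> LA a <= 1 -> LB (e a) <= 1 /\ (cnorm (a - val (e a)) <= r)%R) ->
  @bridge_length R (QCMS hB) (QCMS hA) (incl_bridge B hphi) <= r%:E.
Proof.
move=> ce sae LAB Le; have r0 : 0 <= r%:E.
  have sz : LA 0%R <= 1 by rewrite (seminorm0 (lip_norm_seminorm (proj1 hA))) lee01.
  have [_ h] := Le 0%R (@sa0 _ A) sz.
  by rewrite lee_fin; apply: le_trans h; exact: cnorm_ge0.
have r_id : forall (X : qcms R) (psi : X -> R[i]), mk (@lipn R X) psi psi <= 0.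
  by move=> X psi; rewrite mk_qcms_refl.
rewrite /bridge_length ge_max; apply/andP; split.
  apply: hausdorff_le => [_ [b [sb Lb] <-]|_ [a [sa_a La] <-]] /=.
    exists (1 * val b)%R; last by rewrite mulr1 mul1r subrr cnorm0.
    exists (val b) => //; split; first exact: (star_hom_sa (star_hom_val B)).
    by rewrite /= LAB.
  have [Lea ea] := Le a sa_a La.
  exists (val (e a) * 1)%R; last by rewrite lee_fin mulr1 mul1r cnormB.
  by exists (e a) => //; split; [exact: sae|].
apply: le_trans r0; rewrite /bridge_height ge_max; apply/andP; split; apply: hausdorff_sub_le => //.
- by move=> _ [psi [hpsi _] <-]; exact: is_state_comp (star_hom_val B) hpsi.
- move=> psi hpsi; exists psi; last exact: (r_id (QCMS hB)).
  exists (psi \o e); first exact/level_set1/cond_exp_state.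
  by apply/funext => b /=; case: ce => _ _ _ [_ -> _].
- by move=> _ [psi [hpsi _] <-].
move=> psi hpsi; exists psi; last exact: (r_id (QCMS hA)).
by exists psi => //; exact: level_set1.
Qed.

Theorem proposition3p5 (R : realType) (A : cstarAlgType R)
  (An : nat -> cstar_subalg A) (hAn : af_filtration An)
  (mu : A -> R[i]) (hmu : faithful_tracial_state mu)
  (beta : nat -> R) (beta_gt0 : forall n, (0 < beta n)%R)
  (beta_summable : cvgn (series beta))
  (E : forall n, A -> csub (An n)) (E_cond : forall n, cond_exp (E n))
  (E_mu : forall n a, mu (val (E n a)) = mu a) :
  exists (Lmu : qleibniz_lip_norm (lip_state beta E))
         (Ln : forall n, qleibniz_lip_norm (@lip_fin R A An beta (cond_step E) n))
         (LU : qleibniz_lip_norm (lip_seq beta (cond_step E))),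
  [/\ forall n (a : csub (An n)),
        lip_state beta E (val a) = lip_fin beta (cond_step E) a,
      forall n (a : csub (An n)), sa a ->
        lip_state beta E (val a) <= lip_seq beta (cond_step E) (val a) /\
        lip_seq beta (cond_step E) (val a) <=
          (Num.max 1 (if n is k.+1 then 2 * beta 0%N / beta k else 0))%R%:E *
          lip_state beta E (val a),
      (exists pi : A -> A, @quantum_isometry R (QCMS Lmu) (QCMS LU) pi) /\
      dual_propinquity (QCMS Lmu) (QCMS LU) = 0
    & (forall n,
         dual_propinquity (QCMS (Ln n)) (QCMS LU) <=
           2%:E * propinquity (QCMS (Ln n)) (QCMS LU) /\
         2%:E * propinquity (QCMS (Ln n)) (QCMS LU) <= (2 * beta n)%R%:E) /\
      (fun n => propinquity (QCMS (Ln n)) (QCMS LU)) @ \oo --> 0].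
Proof.
have mu_state : is_state mu by case: hmu.
have finE n (a : csub (An n)) : lip_fin beta (cond_step E) a = lip_state beta E (val a).
  exact: (lip_finE hAn hmu beta_gt0 E_cond E_mu).
have seqE a : sa a -> lip_state beta E a = lip_seq beta (cond_step E) a.
  by move=> sa_a; rewrite (lip_seqE hAn hmu beta_gt0 beta_summable E_cond E_mu sa_a).
have Lmu : qleibniz_lip_norm (lip_state beta E).
  exact: (lip_state_qleibniz hAn hmu beta_gt0 beta_summable E_cond E_mu).
have Ln n : qleibniz_lip_norm (@lip_fin R A An beta (cond_step E) n).
  apply: (@qleibniz_ext _ _ (lip_state beta E \o (val : csub (An n) -> A))) .
    by move=> a _; rewrite /= finE.
  (* E_n is the retraction of A onto A_n along which states are extended. *)
  apply: (@qleibniz_retract _ _ _ _ _ (E n)) => //.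
  - by case: (E_cond n) => _ _ _ [].
  - by move=> phi; exact: cond_exp_state.
  by move=> b; apply: (lip_state_fin hAn beta_gt0 E_cond (csub_valP b)).
have LU : qleibniz_lip_norm (lip_seq beta (cond_step E)) by exact: qleibniz_ext Lmu.
exists Lmu, Ln, LU.
have isom : @quantum_isometry R (QCMS Lmu) (QCMS LU) id.
  by split=> [|a sa_a]; [split; [exact: star_hom_id|exists id]|rewrite /= seqE].
have prop n : propinquity (QCMS (Ln n)) (QCMS LU) <= (beta n)%:E.
  pose g : bridge (QCMS (Ln n)) (QCMS LU) := incl_bridge (An n) mu_state.
  apply: le_trans (propinquity_le_bridge g) _.
  apply: incl_bridge_length (E_cond n) _ _ _.
  - by move=> a sa_a; apply: val_inj; exact: (cexp_sa hmu E_cond E_mu).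
  - by move=> b sb; rewrite finE -seqE //; exact: (star_hom_sa (star_hom_val _)).
  move=> a sa_a; rewrite -seqE // => La; split.
    rewrite finE; apply: le_trans La.
    exact: (lip_state_cexp hAn hmu beta_gt0 E_cond E_mu).
  by have := lip_state_ge beta_gt0 n La; rewrite mul1r.
split=> //.
- move=> n a saa; have sva : sa (val a) by exact: (star_hom_sa (star_hom_val _)).
  rewrite seqE //; split=> //; rewrite -seqE //.
  (* The Lip-norms agree on sa(A) and the factor is at least 1, also for n = 0, where it is
     [max 1 0]. *)
  apply: lee_pemull; first exact: (lip_state_ge0 beta_gt0).
  by rewrite lee_fin le_max lexx.
- split; first by exists id.
  by apply: dual_propinquity_isometry isom; exists mu.
split=> [n|]; first by split; [exact: dual_le_propinquity|rewrite EFinM lee_wpmul2l].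
apply: (@squeeze_cvge _ _ _ _ (fun=> 0) _ (EFin \o beta)).
- by apply: nearW => n; rewrite propinquity_ge0 prop.
- exact: cvg_cst.
by apply: cvg_EFin; [exact: nearW|exact: beta_cvg0].
Qed.
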